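(* Let $(\mathcal{E},\mathcal{D}(\mathcal{E}))$ be a symmetric, regular, strongly local Dirichlet form on $L^2(X,m)$ admitting a carré du champ operator $\Gamma$, and let $p>2$. Suppose that the topology of $X$ is connected and coincides with the topology $\tau_\rho$ generated by the balls of the intrinsic metric $\rho$. Let $U\subset X$ be open, $x_0\in U$ and $0<r<R$ be such that the ball $\overline{B}_R(x_0)$ is included in $U$. If $u\in\mathcal{D}_p|_U$ is $\mathsf{L}_p$-harmonic on $U$ and $c\in\mathbb{R}$, then $$\Big(\int_{B_r(x_0)}\Gamma(u)^{\frac p2}\,dm\Big)^{\frac1p}\le\frac{p}{R-r}\Big(\int_{B_R(x_0)}|u-c|^p\,dm\Big)^{\frac1p}.$$
   Context: Setting. $X$ is a locally compact separable metric space, $m$ is a finite positive Radon measure on $X$ with full support. A Dirichlet form $(\mathcal{E},\mathcal{D}(\mathcal{E}))$ on $L^2(X,m)$ is regular if $\mathcal{D}(\mathcal{E})\cap C_c(X)$ is dense in $C_c(X)$ in the uniform norm and dense in $\mathcal{D}(\mathcal{E})$ in the norm $(\mathcal{E}(u,u)+\|u\|_2^2)^{1/2}$. It is strongly local if $\mathcal{E}(u,v)=0$ whenever $u,v\in\mathcal{D}(\mathcal{E})$ have compact support and $v$ is constant on a neighbourhood of $\operatorname{supp}u$. It admits a carré du champ operator if there is a positive symmetric bilinear map $\Gamma:\mathcal{D}(\mathcal{E})\times\mathcal{D}(\mathcal{E})\to L^1(X,m)$ with $\mathcal{E}(uf,v)+\mathcal{E}(vf,u)-\mathcal{E}(uv,f)=\int_X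 f\,\Gamma(u,v)\,dm$ for all $u,v,f\in\mathcal{D}(\mathcal{E})\cap L^\infty(X,m)$; in the strongly local case $\mathcal{E}(u,v)=\frac12\int_X\Gamma(u,v)\,dm$ for all $u,v\in\mathcal{D}(\mathcal{E})$. Write $\Gamma(u):=\Gamma(u,u)$. The energy measure of $u\in\mathcal{D}(\mathcal{E})$ is $\mu_{\langle u\rangle}=\Gamma(u)\cdot m$. The operator $\Gamma$ is local: $\Gamma(u)=\Gamma(w)$ $m$-a.e. on an open set $G$ if $u=w$ $m$-a.e. on $G$; hence $\Gamma(u)$ and $\mu_{\langle u\rangle}$ make sense locally. Intrinsic metric. $\mathcal{D}_{loc}$ is the set of $u:X\to\mathbb{R}$ such that for each relatively compact open $G$ there is $w\in\mathcal{D}(\mathcal{E})$ with $u=w$ $m$-a.e. on $G$ (and then $\mu_{\langle u\rangle}:=\mu_{\langle w\rangle}$ on $G$). For $x,y\in X$, $\rho(x,y):=\sup\{u(x)-u(y):u\in\mathcal{D}_{loc}\cap C(X),\ \mu_{\langle u\rangle}\le m\}$. $B_r(x):=\{y\in X:\rho(x,y)<r\}$, $\overline{B}_r(x)$ is the closure of $B_r(x)$, and $\tau_\rho$ is the topology generated by the balls $B_r(x)$. $p$-form and harmonicity. $\mathcal{D}_p:=\{u\in\mathcal{D}(\mathcal{E})\cap L^p(X,m):\Gamma(u)^{1/2}\in L^p(X,m)\}$, and $\langle\mathsf{L}_pu,v\rangle=\mathcal{E}^p(u,v):=\int_X\Gamma(u)^{\frac{p-2}{2}}\Gamma(u,v)\,dm$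 for $u,v\in\mathcal{D}_p$. For $U\subset X$ open, $\mathcal{D}_p|_U:=\{u:U\to\mathbb{R}:\text{there is }\bar u\in\mathcal{D}_p\text{ with }u=\bar u\ m\text{-a.e. on }U\}$ and $\mathcal{D}_p(U)_c:=\{v\in\mathcal{D}_p:\operatorname{supp}v\subset U\text{ compact}\}$. For $u\in\mathcal{D}_p|_U$, $v\in\mathcal{D}_p(U)_c$ put $\mathcal{E}^p(u,v):=\mathcal{E}^p(\bar u,v)$ and $\Gamma(u):=\Gamma(\bar u)$ on $U$ (independent of the choice of $\bar u$). $u\in\mathcal{D}_p|_U$ is $\mathsf{L}_p$-harmonic on $U$ if $\mathcal{E}^p(u,v)=0$ for each open $V\subset U$ and all $v\in\mathcal{D}_p(V)_c$.
   Formalization: The closed ball of radius R is additionally assumed to be compact; mere inclusion in U is not enough, since harmonicity is tested only with compactly supported functions (the inequality fails e.g. on X=(0,1) with a weighted H^1_0 form, p=3). *)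

(* Defs.v *)
From HB Require Import structures.
From mathcomp Require Import all_boot all_order all_algebra.
From mathcomp Require Import all_classical all_reals all_analysis.
Set Implicit Arguments.
Unset Strict Implicit.
Unset Printing Implicit Defensive.
Import Order.TTheory GRing.Theory Num.Theory.
Import numFieldNormedType.Exports.

Local Open Scope classical_set_scope.
Local Open Scope ring_scope.

(* Elements of L^2(X, m) are represented by Borel functions X -> R; domains,
   forms and operators on classes are required to be compatible with m-a.e.
   equality. Partially defined objects are total functions whose values outside
   their domain are never used. *)

HB.mixin Record isBorel (d : measure_display) T
    & Topological T & Measurable d T := {
  borel_measurableE : (measurable : set (set T)) = <<s (open : set (set T)) >>
}.

#[short(type="borelMetricType")]
HB.structure Definition BorelMetric (R : numDomainType) (d : measure_display) :=
  { T of Metric R T & Measurable d T & isBorel d T }.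

Section Measures.
Context {R : realType} {d : measure_display} {X : borelMetricType R d}.
Variable m : {measure set X -> \bar R}.

Definition separable := exists2 D : set X, countable D & dense D.

Definition radon :=
  [/\ forall C : set X, compact C -> (m C < +oo)%E,
      forall A : set X, measurable A ->
        m A = ereal_inf [set m G | G in [set G : set X | open G /\ A `<=` G]]
    & forall G : set X, open G ->
        m G = ereal_sup [set m C | C in [set C : set X | compact C /\ C `<=` G]]].

Definition full_support := forall G : set X, open G -> G !=set0 -> (0 < m G)%E.

(* The support of the class of [u], i.e. of the measure |u| m. *)
Definition ae_support (u : X -> R) : set X :=
  [set x | forall G, open_nbhs x G -> ~ (u = cst 0 %[ae m in G])].

Definition Cc : set (X -> R) :=
  [set f | continuous f /\ compact (closure [set x | f x != 0])].

Definition rel_compact_open (G : set X) := open G /\ precompact G.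

End Measures.

Section DirichletForms.
Context {R : realType} {d : measure_display} {X : borelMetricType R d}.
Variable m : {measure set X -> \bar R}.

Definition form1_norm (E : (X -> R) -> (X -> R) -> R) (u : X -> R) : R :=
  Num.sqrt (E u u + \int[m]_x (u x ^+ 2)).

Record dirichlet_form := DirichletForm {
  dom : set (X -> R) ;
  form :> (X -> R) -> (X -> R) -> R ;
  dom_L2 : forall u, dom u -> u \in Lfun m 2%:E ;
  dom_ae : forall u v, dom u -> v \in Lfun m 2%:E -> u = v %[ae m] -> dom v ;
  dom0 : dom (cst 0) ;
  domP : forall a u v, dom u -> dom v -> dom (a \*: u \+ v) ;
  dom_dense : forall f, f \in Lfun m 2%:E -> forall e : R, 0 < e ->
    exists2 u, dom u & ('N[m]_2%:E [EFin \o (f \- u)%R] < e%:E)%E ;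
  form_ae : forall u u' v, dom u -> dom u' -> dom v -> u = u' %[ae m] ->
    form u v = form u' v ;
  form_sym : forall u v, dom u -> dom v -> form u v = form v u ;
  form_linear : forall a u v w, dom u -> dom v -> dom w ->
    form (a \*: u \+ v) w = a * form u w + form v w ;
  form_ge0 : forall u, dom u -> 0 <= form u u ;
  form_closed : forall u_ : nat -> X -> R, (forall n, dom (u_ n)) ->
    (forall e : R, 0 < e -> exists N, forall i j, (N <= i)%N -> (N <= j)%N ->
       form1_norm form (u_ i \- u_ j) < e) ->
    exists2 u, dom u & form1_norm form (u_ n \- u) @[n --> \oo] --> (0 : R) ;
  form_markov : forall u, dom u ->
    let v := fun x => Num.min (Num.max 0 (u x)) 1 in
    dom v /\ form v v <= form u u
}.

Definition regular (E : dirichlet_form) :=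
  (forall f, Cc f -> forall e : R, 0 < e ->
     exists2 g, (dom E `&` Cc) g & forall x, `|f x - g x| <= e) /\
  (forall u, dom E u -> forall e : R, 0 < e ->
     exists2 g, (dom E `&` Cc) g & form1_norm E (u \- g) <= e).

Definition strongly_local (E : dirichlet_form) :=
  forall u v, dom E u -> dom E v ->
    compact (ae_support m u) -> compact (ae_support m v) ->
    (exists c : R, exists W : set X,
       [/\ open W, ae_support m u `<=` W & v = cst c %[ae m in W]]) ->
    E u v = 0.

Definition bdom (E : dirichlet_form) : set (X -> R) :=
  dom E `&` [set u | u \in Lfun m +oo%E].

(* [cdc_energy] is part of the definition because [cdc_form] only constrains
   Gamma on bounded functions. *)
Record carre_du_champ (E : dirichlet_form)
    (Gamma : (X -> R) -> (X -> R) -> X -> R) : Prop := CarreDuChamp {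
  cdc_L1 : forall u v, dom E u -> dom E v -> Gamma u v \in Lfun m 1%:E ;
  cdc_ae : forall u u' v, dom E u -> dom E u' -> dom E v -> u = u' %[ae m] ->
    Gamma u v = Gamma u' v %[ae m] ;
  cdc_sym : forall u v, dom E u -> dom E v -> Gamma u v = Gamma v u %[ae m] ;
  cdc_linear : forall a u v w, dom E u -> dom E v -> dom E w ->
    Gamma (a \*: u \+ v) w = a \*: Gamma u w \+ Gamma v w %[ae m] ;
  cdc_ge0 : forall u, dom E u -> \forall x \ae m, 0 <= Gamma u u x ;
  cdc_form : forall u v f, bdom E u -> bdom E v -> bdom E f ->
    E (u \* f) v + E (v \* f) u - E (u \* v) f = \int[m]_x (f x * Gamma u v x) ;
  cdc_energy : strongly_local E -> forall u v, dom E u -> dom E v ->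
    E u v = 2^-1 * \int[m]_x Gamma u v x
}.

End DirichletForms.

Section IntrinsicMetric.
Context {R : realType} {d : measure_display} {X : borelMetricType R d}.
Variables (m : {measure set X -> \bar R}) (E : dirichlet_form m).
Variable Gamma : (X -> R) -> (X -> R) -> X -> R.

Definition dom_loc : set (X -> R) :=
  [set u | forall G, rel_compact_open G ->
     exists2 w, dom E w & u = w %[ae m in G]].

Definition energy_measure (u : X -> R) (A : set X) : \bar R :=
  (\int[m]_(x in A) (Gamma u u x)%:E)%E.

(* For [u] in [dom_loc]: the energy measure of [u] is bounded by [m]. *)
Definition energy_measure_le (u : X -> R) :=
  forall G w, rel_compact_open G -> dom E w -> u = w %[ae m in G] ->
  forall A, measurable A -> A `<=` G -> (energy_measure w A <= m A)%E.

Definition rho (x y : X) : \bar R :=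
  ereal_sup [set (u x - u y)%:E | u in
    [set u | [/\ dom_loc u, continuous u & energy_measure_le u]]].

Definition rho_ball (x : X) (r : R) : set X := [set y | (rho x y < r%:E)%E].

Definition is_topology (T : set (set X)) :=
  [/\ T setT, setI_closed T
    & forall F : set (set X), F `<=` T -> T (\bigcup_(A in F) A)].

Definition tau_rho : set (set X) :=
  smallest is_topology [set rho_ball xr.1 xr.2 | xr in [set: X * R]].

End IntrinsicMetric.

Section PHarmonic.
Context {R : realType} {d : measure_display} {X : borelMetricType R d}.
Variables (m : {measure set X -> \bar R}) (E : dirichlet_form m).
Variable Gamma : (X -> R) -> (X -> R) -> X -> R.
Variable p : R.

Definition dom_p : set (X -> R) :=
  [set u | [/\ dom E u, u \in Lfun m p%:E
     & (fun x => Num.sqrt (Gamma u u x)) \in Lfun m p%:E]].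

Definition form_p (u v : X -> R) : R :=
  \int[m]_x (Gamma u u x `^ ((p - 2) / 2) * Gamma u v x).

(* A function on [U] is the restriction to [U] of a function on [X]. *)
Definition extension (U : set X) (u : X -> R) : set (X -> R) :=
  [set w | dom_p w /\ u = w %[ae m in U]].

Definition dom_p_restr (U : set X) : set (X -> R) :=
  [set u | extension U u !=set0].

Definition ext (U : set X) (u : X -> R) : X -> R := xget (cst 0) (extension U u).

Definition form_p_restr (U : set X) (u v : X -> R) : R := form_p (ext U u) v.

Definition Gamma_restr (U : set X) (u : X -> R) : X -> R :=
  Gamma (ext U u) (ext U u).

Definition dom_p_c (U : set X) : set (X -> R) :=
  [set v | [/\ dom_p v, ae_support m v `<=` U & compact (ae_support m v)]].

Definition p_harmonic (U : set X) (u : X -> R) :=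
  dom_p_restr U u /\
  forall V v, open V -> V `<=` U -> dom_p_c V v -> form_p_restr U u v = 0.

End PHarmonic.

(* Main.v *)
(* For r < t < s, a cutoff function phi equal to 1 on B_r, vanishing off B_s and
   with Gamma(phi) <= 1/(t - r)^2 is obtained as a truncated minimum of finitely many
   functions u_y - u_y(x0) + t, where u_y is one of the functions defining rho(x0, y)
   and y runs over a finite cover of a compact shell around B_t. Testing harmonicity
   with phi^p (w - c), the Leibniz rule and the Cauchy-Schwarz inequality give
     int phi^p Gamma(w)^(p/2)
       <= p/(t - r) int phi^(p-1) |w - c| Gamma(w)^((p-1)/2),
   Young's inequality absorbs the right-hand side, and t tends to s.

   The Leibniz rule for Gamma and its locality have to be derived from the identity
   defining Gamma: the defect of the Leibniz rule is a symmetric 4-linear form,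
   which vanishes on the diagonal by strong locality. *)

Require Import Defs.
From mathcomp Require Import all_boot all_order all_algebra.
From mathcomp Require Import all_classical all_reals all_analysis.
From mathcomp Require Import measurable_realfun ess_sup_inf ring lra.
Import Order.TTheory GRing.Theory Num.Theory.
Import numFieldNormedType.Exports.
Set Implicit Arguments.
Unset Strict Implicit.
Unset Printing Implicit Defensive.

Local Open Scope classical_set_scope.
Local Open Scope ring_scope.

(** Strong locality concerns E alone and asks for constancy near a whole support. What carries it to
    Gamma is [form_weak]: along functions of bounded energy that are small in L^2, E tends weakly to
    0. It first allows a thin layer of values to be discarded, so that E vanishes as soon as one
    core function is constant where the other is nonzero. Applied to (1 - (1 - k)^n) / n, it then
    shows that Gamma k k vanishes on {k = 0}, so Gamma is local on arbitrary level sets, not only on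
    open ones.

    Level-set locality replaces the chain rule: Gamma is computed only for products, truncations and
    piecewise affine compositions, and phi^p is replaced by a piecewise affine majorant. Since
    constants need not lie in the domain, c only occurs multiplied by a function of the domain;
    since w may be unbounded, it is clamped before it is multiplied.

    In the constant p/(R - r), the factor p is that of the derivative of t^p and 1/(R - r) is the
    limit of the slopes of the cutoffs. Absorption costs nothing: Young's inequality has
    coefficients 1 - 1/p and 1/p, and subtracting leaves 1/p on both sides. *)

Lemma filterS4 T (F : set_system T) {FF : Filter F} (P Q S U V : set T) :
  (forall x, P x -> Q x -> S x -> U x -> V x) -> F P -> F Q -> F S -> F U -> F V.
Proof.
move=> PV FP FQ FS; apply: filterS2 (filterI FP (filterI FQ FS)).
by move=> x [Px [Qx Sx]]; exact: PV.
Qed.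

(** * Real-valued integrals over a finite measure *)

Section RealIntegral.
Context {d : measure_display} {T : measurableType d} {R : realType}.
Variable m : {finite_measure set T -> \bar R}.

Local Notation L1 f := (m.-integrable setT (EFin \o f)).

Lemma integrable_measurable {f : T -> R} : L1 f -> measurable_fun setT f.
Proof. by move=> /measurable_int /measurable_EFinP. Qed.

Lemma ae_eqTP (f g : T -> R) :
  (f = g %[ae m]) <-> (\forall x \ae m, f x = g x).
Proof. by split; apply: filterS => x //; apply. Qed.

Lemma Rintegral_ae_eq (f g : T -> R) :
  measurable_fun setT f -> measurable_fun setT g ->
  (\forall x \ae m, f x = g x) -> \int[m]_x f x = \int[m]_x g x.
Proof.
move=> mf mg fg; rewrite /Rintegral; congr fine.
apply: ae_eq_integral => //; [exact/measurable_EFinP|exact/measurable_EFinP|].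
by apply: filterS fg => x -> _.
Qed.

Lemma Rintegral_ae_ge0 (f : T -> R) : measurable_fun setT f ->
  (\forall x \ae m, 0 <= f x) -> 0 <= \int[m]_x f x.
Proof.
move=> mf f0; rewrite (@Rintegral_ae_eq _ (fun x => `|f x|)) //.
- exact: Rintegral_ge0.
- exact: measurableT_comp.
- by apply: filterS f0 => x /ger0_norm ->.
Qed.

Lemma integrableB_R (f g : T -> R) : L1 f -> L1 g -> L1 (fun x => f x - g x).
Proof. by move=> L1f L1g; have := integrableB measurableT L1f L1g. Qed.

Lemma integrableD_R (f g : T -> R) : L1 f -> L1 g -> L1 (fun x => f x + g x).
Proof. by move=> L1f L1g; have := integrableD measurableT L1f L1g. Qed.

Lemma integrableZ_R (k : R) (f : T -> R) : L1 f -> L1 (fun x => k * f x).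
Proof. by move=> L1f; have := integrableZl measurableT k L1f. Qed.

Lemma integrableM_bounded (f g : T -> R) (M : R) : measurable_fun setT f ->
  (forall x, `|f x| <= M) -> L1 g -> L1 (fun x => f x * g x).
Proof.
move=> mf fM L1g.
apply: (@le_integrable _ _ _ m setT measurableT _
  (EFin \o (fun x => M * g x))); last exact: integrableZ_R.
  apply/measurable_EFinP; apply: measurable_funM => //.
  exact: integrable_measurable L1g.
move=> x _ /=; rewrite lee_fin !normrM ler_wpM2r //.
by apply: le_trans (fM x) _; exact: ler_norm.
Qed.

Lemma integrableM_indic (A : set T) (f : T -> R) : measurable A -> L1 f ->
  L1 (fun x => \1_A x * f x).
Proof.
move=> mA L1f; apply: (integrableM_bounded (M := 1)) L1f.
  exact: measurable_indic.
by move=> x; rewrite indicE; case: (_ \in _); rewrite ?normr1 ?normr0.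
Qed.

Lemma integrable_ae_le (f g : T -> R) : measurable_fun setT f ->
  (\forall x \ae m, `|f x| <= g x) -> L1 g -> L1 f.
Proof.
move=> mf fg L1g; have mg := integrable_measurable L1g.
apply/integrableP; split; first exact/measurable_EFinP.
apply: le_lt_trans (_ : (\int[m]_x `|(g x)%:E| < +oo)%E); last first.
  by move/integrableP : L1g => [].
apply: ae_ge0_le_integral => //.
- by apply: measurableT_comp => //; exact/measurable_EFinP.
- by apply: measurableT_comp => //; exact/measurable_EFinP.
by apply: filterS fg => x fgx _ /=; rewrite lee_fin (le_trans fgx)// ler_norm.
Qed.

Lemma integrable_bounded (f : T -> R) (M : R) : measurable_fun setT f ->
  (forall x, `|f x| <= M) -> L1 f.
Proof.
move=> mf fM; apply: (@integrable_ae_le _ (cst M)) => //.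
- exact: nearW.
- exact: finite_measure_integrable_cst.
Qed.

Lemma Rintegral_ae_le (f g : T -> R) : L1 f -> L1 g ->
  (\forall x \ae m, f x <= g x) -> \int[m]_x f x <= \int[m]_x g x.
Proof.
move=> L1f L1g fg; rewrite -subr_ge0 -RintegralB //.
apply: Rintegral_ae_ge0.
  by apply: integrable_measurable; exact: integrableB_R.
by apply: filterS fg => x; rewrite subr_ge0.
Qed.

Lemma Rintegral_eq0_ae (f : T -> R) : L1 f -> (\forall x \ae m, 0 <= f x) ->
  \int[m]_x f x <= 0 -> \forall x \ae m, f x = 0.
Proof.
move=> L1f f0 If0; have mf := integrable_measurable L1f.
have nf0 : \int[m]_x `|f x| = 0.
  apply/eqP; rewrite eq_le Rintegral_ge0 // andbT.
  rewrite (@Rintegral_ae_eq _ f) //; first exact: measurableT_comp.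
  by apply: filterS f0 => x /ger0_norm.
have : (\int[m]_x `|(f x)%:E| = 0)%E.
  rewrite -[LHS]fineK; last first.
    rewrite ge0_fin_numE; last exact: integral_ge0.
    by move/integrableP : L1f => [].
  exact: (congr1 EFin nf0).
move/ae_eq_integral_abs => /(_ measurableT) h.
have /h : measurable_fun [set: T] (EFin \o f) by exact/measurable_EFinP.
by apply: filterS => x /(_ Logic.I) [].
Qed.

Lemma Lfun2P (f : T -> R) : f \in Lfun m 2%:E <->
  measurable_fun setT f /\ L1 (fun x => f x ^+ 2).
Proof.
split=> [f2|[mf if2]].
  split; last exact: Lfun2_integrable_sqr.
  by move: f2; rewrite inE => /andP[]; rewrite inE.
rewrite inE; apply/andP; split; rewrite inE //=.
rewrite /finite_norm unlock poweR_lty //=.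
move/integrableP : if2 => [_].
under eq_integral => x _ do rewrite /= normrX -powR_mulrn //.
by under [in X in _ -> X]eq_integral => x _ do rewrite /=.
Qed.

Lemma Lfun_bounded (p M : R) (f : T -> R) : 0 < p -> measurable_fun setT f ->
  (forall x, `|f x| <= M) -> f \in Lfun m p%:E.
Proof.
move=> p0 mf fM; rewrite inE; apply/andP; split; rewrite inE //=.
rewrite /finite_norm unlock poweR_lty //=.
have mfp : measurable_fun setT (fun x => `|f x| `^ p).
  apply: (measurableT_comp (measurable_powR _)) => //; exact: measurableT_comp.
have : L1 (fun x => `|f x| `^ p).
  apply: (@integrable_bounded _ (M `^ p)) => // x.
  rewrite ger0_norm ?powR_ge0 //; apply: ge0_ler_powR => //.
  - exact: ltW.
  - by rewrite nnegrE (le_trans _ (fM x)).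
move/integrableP => [_].
by under eq_integral => x _ do rewrite /= ger0_norm ?powR_ge0 //.
Qed.

Lemma Rintegral_dominated (f_ : nat -> T -> R) (f g : T -> R) :
  (forall n, measurable_fun setT (f_ n)) -> measurable_fun setT f ->
  (\forall x \ae m, f_ n x @[n --> \oo] --> f x) -> L1 g ->
  (\forall x \ae m, forall n, `|f_ n x| <= g x) ->
  forall e, 0 < e -> exists N, forall n, (N <= n)%N ->
    \int[m]_x `|f_ n x - f x| < e.
Proof.
move=> mf_ mf f_f L1g f_g e e0.
have [//|//|||_ + _] := @dominated_convergence _ _ _ m setT measurableT
  (fun n x => (f_ n x)%:E) (EFin \o f) (EFin \o g) _ _ _ L1g.
- by move=> n; exact/measurable_EFinP.
- exact/measurable_EFinP.
- by apply: filterS f_f => x h _; apply/fine_cvgP; split => //; exact: nearW.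
- by apply: filterS f_g => x h n _ /=; rewrite lee_fin.
move/fine_cvgP => [_ /cvgrPdist_lt/(_ _ e0)[N _ HN]].
exists N => n Nn; have := HN n Nn; rewrite /= sub0r normrN; apply: le_lt_trans.
exact: ler_norm.
Qed.

End RealIntegral.

(** * Lower semicontinuity and contractions of the form *)

Section ClosedForm.
Context {R : realType} {d : measure_display} {X : borelMetricType R d}.
Context {m : {finite_measure set X -> \bar R}} (E : dirichlet_form m).

Local Notation L1 f := (m.-integrable setT (EFin \o f)).

Definition sqn (u : X -> R) : R := \int[m]_x (u x ^+ 2).

Lemma dom_meas u : dom E u -> measurable_fun setT u.
Proof. by move=> /dom_L2 /Lfun2P[]. Qed.

Lemma domD u v : dom E u -> dom E v -> dom E (u + v).
Proof.
move=> du dv; have := domP 1 du dv.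
by congr (dom E _); apply/funext => x; rewrite /= scale1r.
Qed.

Lemma domZ a u : dom E u -> dom E (a *: u).
Proof.
move=> du; have := domP a du (dom0 E).
by congr (dom E _); apply/funext => x; rewrite /= addr0.
Qed.

Lemma domN u : dom E u -> dom E (- u).
Proof. by move=> du; rewrite -scaleN1r; exact: domZ. Qed.

Lemma domB u v : dom E u -> dom E v -> dom E (u - v).
Proof. by move=> du dv; apply: domD => //; exact: domN. Qed.

Lemma dformDl u v w : dom E u -> dom E v -> dom E w ->
  E (u + v) w = E u w + E v w.
Proof.
move=> du dv dw; rewrite -[E u w]mul1r -form_linear //; congr (E _ w).
by apply/funext => x; rewrite /= scale1r.
Qed.

Lemma dform0l w : dom E w -> E 0 w = 0.
Proof.
move=> dw; have d0 := dom0 E.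
have := dformDl d0 d0 dw; rewrite -[cst 0]/(0 : X -> R) addr0 => h.
by lra.
Qed.

Lemma dformZl a u w : dom E u -> dom E w -> E (a *: u) w = a * E u w.
Proof.
move=> du dw; rewrite -[RHS]addr0 -(dform0l dw) -form_linear //; last exact: dom0.
by congr (E _ w); apply/funext => x; rewrite /= addr0.
Qed.

Lemma dformNl u w : dom E u -> dom E w -> E (- u) w = - E u w.
Proof. by move=> du dw; rewrite -scaleN1r dformZl // mulN1r. Qed.

Lemma dformBl u v w : dom E u -> dom E v -> dom E w ->
  E (u - v) w = E u w - E v w.
Proof.
by move=> du dv dw; rewrite dformDl ?dformNl //; exact: domN.
Qed.

Lemma dformDr u v w : dom E u -> dom E v -> dom E w ->
  E w (u + v) = E w u + E w v.
Proof.
by move=> du dv dw; rewrite form_sym ?dformDl ?(form_sym _ dw)//; exact: domD.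
Qed.

Lemma dformZr a u w : dom E u -> dom E w -> E w (a *: u) = a * E w u.
Proof.
by move=> du dw; rewrite form_sym ?dformZl ?(form_sym _ dw)//; exact: domZ.
Qed.

Lemma dformBr u v w : dom E u -> dom E v -> dom E w ->
  E w (u - v) = E w u - E w v.
Proof.
by move=> du dv dw; rewrite form_sym ?dformBl ?(form_sym _ dw)//; exact: domB.
Qed.

Lemma dformDD u v : dom E u -> dom E v ->
  E (u + v) (u + v) = E u u + 2 * E u v + E v v.
Proof.
move=> du dv; rewrite dformDl ?dformDr //; last exact: domD.
by rewrite (form_sym dv du); ring.
Qed.

Lemma dformBB u v : dom E u -> dom E v ->
  E (u - v) (u - v) = E u u - 2 * E u v + E v v.
Proof.
move=> du dv; rewrite dformBl ?dformBr //; last exact: domB.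
by rewrite (form_sym dv du); ring.
Qed.

(** Positivity of E at s u - v for s = t and s = -t. This parametrised Cauchy-Schwarz inequality
    needs no square root, and no case distinction when [E u u = 0]. *)
Lemma form_amgm t u v : dom E u -> dom E v ->
  2 * t * `|E u v| <= t ^+ 2 * E u u + E v v.
Proof.
move=> du dv.
have h s : 2 * s * E u v <= s ^+ 2 * E u u + E v v.
  have := form_ge0 (domB (domZ s du) dv).
  by rewrite dformBB ?dformZl ?dformZr //; [nra|exact: domZ..].
have := h t; have := h (- t); rewrite sqrrN.
by case: (ler0P (E u v)) => _; lra.
Qed.

Definition L2 (u : X -> R) := measurable_fun setT u /\ L1 (fun x => u x ^+ 2).

Lemma dom_L2' u : dom E u -> L2 u.
Proof. by move=> /dom_L2 /Lfun2P. Qed.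

Lemma L2D u v : L2 u -> L2 v -> L2 (u + v).
Proof.
move=> [mu u2] [mv v2]; split; first exact: measurable_funD.
have h : L1 (fun x => 2 * (u x ^+ 2) + 2 * (v x ^+ 2)).
  by apply: integrableD_R; exact: integrableZ_R.
refine (integrable_ae_le _ _ h).
  by apply: (@measurable_funX _ _ _ _ (u + v)); exact: measurable_funD.
apply: nearW => x /=; rewrite ger0_norm ?sqr_ge0 // !fctE.
by have := sqr_ge0 (u x - v x); rewrite sqrrB sqrrD; lra.
Qed.

Lemma L2N u : L2 u -> L2 (- u).
Proof.
move=> [mu u2]; split; first exact: measurableT_comp.
by apply: eq_integrable u2 => // x _; rewrite /= fctE sqrrN.
Qed.

Lemma L2B u v : L2 u -> L2 v -> L2 (u - v).
Proof. by move=> u2 v2; apply: L2D => //; exact: L2N. Qed.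

Lemma sqnD (u v : X -> R) : L2 u -> L2 v -> sqn (u + v) <= 2 * sqn u + 2 * sqn v.
Proof.
move=> u2 v2; have [_ uv2] := L2D u2 v2; case: u2 v2 => [mu u2] [mv v2].
rewrite /sqn -!RintegralZl // -RintegralD //; last 2 first.
- exact: integrableZ_R.
- exact: integrableZ_R.
apply: le_Rintegral => // [|x _]; last first.
  rewrite !fctE; have := sqr_ge0 (u x - v x); rewrite sqrrB sqrrD; lra.
by apply: integrableD_R; exact: integrableZ_R.
Qed.

Lemma sqn_ge0 u : 0 <= sqn u.
Proof. by apply: Rintegral_ge0 => x _; exact: sqr_ge0. Qed.

Lemma sqnN u : sqn (- u) = sqn u.
Proof. by apply: eq_Rintegral => x _; rewrite fctE sqrrN. Qed.

Lemma sqnB (v u w : X -> R) : L2 u -> L2 v -> L2 w ->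
  sqn (u - w) <= 2 * sqn (u - v) + 2 * sqn (v - w).
Proof.
move=> u2 v2 w2; rewrite (_ : u - w = (u - v) + (v - w)).
  by apply: sqnD; exact: L2B.
by rewrite addrA subrK.
Qed.

Lemma sqnZ k u : L1 (fun x => u x ^+ 2) -> sqn (k *: u) = k ^+ 2 * sqn u.
Proof.
move=> u2; rewrite /sqn -RintegralZl //.
by apply: eq_Rintegral => x _; rewrite fctE /= exprMn.
Qed.

Lemma form1_norm_lt u e : 0 < e -> dom E u ->
  (form1_norm m E u < e) = (E u u + sqn u < e ^+ 2).
Proof.
move=> e0 du; rewrite /form1_norm -[e in LHS]gtr0_norm // -sqrtr_sqr.
by rewrite ltr_sqrt // exprn_gt0.
Qed.

Lemma form_complete (v_ : nat -> X -> R) : (forall n, dom E (v_ n)) ->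
  (forall e, 0 < e -> exists N, forall i j, (N <= i)%N -> (N <= j)%N ->
     E (v_ i - v_ j) (v_ i - v_ j) + sqn (v_ i - v_ j) < e) ->
  exists2 v, dom E v & forall e, 0 < e -> exists N, forall n, (N <= n)%N ->
     E (v_ n - v) (v_ n - v) + sqn (v_ n - v) < e.
Proof.
move=> dv cv; have [|v dvl lv] := form_closed dv.
  move=> e e0; have [N HN] := cv (e ^+ 2) (exprn_gt0 _ e0).
  exists N => i j Ni Nj; rewrite form1_norm_lt //; first exact: HN.
  exact: domB.
exists v => // e e0.
have se0 : 0 < Num.sqrt e by rewrite sqrtr_gt0.
move/cvgrPdist_lt : lv => /(_ _ se0) [N _ HN].
exists N => n Nn; have := HN n Nn; rewrite /= sub0r normrN ger0_norm ?sqrtr_ge0 //.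
by rewrite form1_norm_lt // ?sqr_sqrtr ?ltW //; exact: domB.
Qed.

End ClosedForm.

Section LowerSemicontinuity.
Context {R : realType} {d : measure_display} {X : borelMetricType R d}.
Context {m : {finite_measure set X -> \bar R}} (E : dirichlet_form m).

Local Notation sqn := (@sqn R d X m).
Local Notation L2 := (@L2 R d X m).

Lemma natinv_lt (e : R) : 0 < e -> exists N, forall n, (N <= n)%N -> n.+1%:R^-1 < e.
Proof.
move=> e0; have [N _ HN] := near_infty_natSinv_lt (PosNum e0).
by exists N => n Nn; exact: HN.
Qed.

Lemma natinv_le (i N : nat) : (N <= i)%N -> (i.+1%:R^-1 : R) <= N.+1%:R^-1.
Proof. by move=> Ni; rewrite lef_pV2 ?posrE ?ltr0n // ler_nat. Qed.

Lemma form_le_lim (v_ : nat -> X -> R) v C : (forall n, dom E (v_ n)) -> dom E v ->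
  (forall e, 0 < e -> exists2 n, E (v_ n - v) (v_ n - v) < e &
     E (v_ n) (v_ n) <= C + e) -> E v v <= C.
Proof.
move=> dv_ dv h; have Ev0 := form_ge0 dv.
rewrite leNgt; apply/negP => Cv.
set g := E v v - C; have g0 : 0 < g by rewrite subr_gt0.
(* In the expansion of [E (v_ n) (v_ n)] around [v], this [t] and the bounds on [e] keep the cross
   term below 3g/8 in absolute value; the energy then exceeds C + g/8 >= C + e. *)
set t := g / (4 * (E v v + 1)).
have t0 : 0 < t by rewrite divr_gt0 // mulr_gt0 //; lra.
have tv : t * E v v <= g / 4.
  rewrite /t -mulrA ler_pM2l // invfM -mulrA ler_piMr ?invr_ge0 //.
  by rewrite mulrC ler_pdivrMr; lra.
set e := Num.min (g / 8) (t * g / 8).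
have e0 : 0 < e by rewrite lt_min !divr_gt0 // mulr_gt0.
have [n Hn1 Hn2] := h e e0.
have eg : e <= g / 8 by rewrite ge_min lexx.
have etg : e <= t * g / 8 by rewrite ge_min lexx orbT.
have dw := domB (dv_ n) dv.
have Evn : E (v_ n) (v_ n) = E v v + 2 * E v (v_ n - v) + E (v_ n - v) (v_ n - v).
  by rewrite -dformDD // addrC subrK.
have := form_amgm t dv dw; have := form_ge0 dw.
move: Evn Hn1 Hn2; set F := E (v_ n - v) _; set G := E v (v_ n - v) => Evn Hn1 Hn2 F0 H.
have : 2 * `|G| <= g / 4 + g / 8.
  rewrite -(ler_pM2l t0).
  have : t ^+ 2 * E v v <= t * (g / 4) by rewrite expr2 -mulrA ler_pM2l.
  lra.
have := ler_norm (- G); rewrite normrN.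
have : E v v = C + g by rewrite /g; lra.
lra.
Qed.

(* A minimizing sequence for E on shrinking L^2-balls around u is Cauchy for E by
   the parallelogram identity. *)
Lemma form_lsc u C : L2 u ->
  (forall e, 0 < e -> exists v, [/\ dom E v, E v v <= C & sqn (v - u) <= e]) ->
  dom E u /\ E u u <= C.
Proof.
move=> u2 h.
(* The supremum over e of the infima of [A e] is the value at [u] of the L^2-lower semicontinuous
   envelope of E. *)
pose A e := [set E v v | v in [set v | dom E v /\ sqn (v - u) <= e]].
have A0 e : lbound (A e) 0 by move=> _ [v [dv _] <-]; exact: form_ge0.
have Ainf e : 0 < e -> has_inf (A e).
  move=> e0; split; last by exists 0.
  by have [v [dv _ vu]] := h e e0; exists (E v v), v.
have AC e : 0 < e -> inf (A e) <= C.
  move=> e0; have [v [dv vC vu]] := h e e0; apply: le_trans vC.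
  by apply: ge_inf; [exists 0|exists v].
pose B := [set inf (A e) | e in [set e | 0 < e]].
have Bsup : has_sup B.
  split; first by exists (inf (A 1)), 1 => //=.
  by exists C => _ [e e0 <-]; exact: AC.
set J := sup B.
have JC : J <= C by apply: ge_sup; [case: Bsup|move=> _ [e e0 <-]; exact: AC].
have AJ e : 0 < e -> inf (A e) <= J.
  by move=> e0; apply: ub_le_sup; [case: Bsup|exists e].
have step (n : nat) : exists v, [/\ dom E v, E v v <= J + n.+1%:R^-1,
    sqn (v - u) <= n.+1%:R^-1 & exists2 e, sqn (v - u) <= e &
    forall w, dom E w -> sqn (w - u) <= e -> J - n.+1%:R^-1 <= E w w].
  have n0 : 0 < n.+1%:R^-1 :> R by rewrite invr_gt0 ltr0n.
  have [_ [e e0 <-] He] := sup_adherent n0 Bsup.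
  set e' := Num.min e n.+1%:R^-1.
  have e'0 : 0 < e' by rewrite lt_min e0.
  have [_ [v [dv vu] <-] Hv] := inf_adherent n0 (Ainf _ e'0).
  exists v; split => //.
  - by apply: (le_trans (ltW Hv)); rewrite lerD2r; exact: AJ.
  - by apply: le_trans vu _; rewrite ge_min lexx orbT.
  exists e'; first exact: vu.
  move=> w dw wu; apply: (le_trans (ltW He)).
  apply: ge_inf; first by exists 0.
  by exists w => //; split => //; apply: le_trans wu _; rewrite ge_min lexx.
have [v_ Hv] := choice step.
have dv_ n : dom E (v_ n) by case: (Hv n).
have v2 n : L2 (v_ n) := dom_L2' (dv_ n).
have [|v dv vlim] := form_complete dv_.
  (* By the parallelogram identity the energy of v_i - v_j is at most 4 (J + r) - 4 (J - r) = 8 r,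
     and its squared L^2 norm at most 4 r, hence 12 r < e in all. *)
  move=> e e0; have [N HN] := natinv_lt (divr_gt0 e0 (ltr0n _ 13)).
  exists N => i j Ni Nj.
  have {HN} := HN N (leqnn N); set r := (N.+1%:R^-1 : R) => re.
  have [_ Ei ui [ei uei Hi]] := Hv i.
  have [_ Ej uj [ej uej Hj]] := Hv j.
  have ri : i.+1%:R^-1 <= r := natinv_le Ni.
  have rj : j.+1%:R^-1 <= r := natinv_le Nj.
  move: Ei ui Hi ri; move: (i.+1%:R^-1) => ai Ei ui Hi ri.
  move: Ej uj Hj rj; move: (j.+1%:R^-1) => aj Ej uj Hj rj.
  clearbody r.
  have dw : dom E (2^-1 *: (v_ i + v_ j)) by apply: domZ; exact: domD.
  have w2 := dom_L2' dw.
  have iu2 : L2 (v_ i - u) := L2B (v2 i) u2.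
  have ju2 : L2 (v_ j - u) := L2B (v2 j) u2.
  have wu : sqn (2^-1 *: (v_ i + v_ j) - u) <= 2^-1 * (sqn (v_ i - u) + sqn (v_ j - u)).
    rewrite (_ : _ - u = 2^-1 *: ((v_ i - u) + (v_ j - u))); last first.
      by apply/funext => x; rewrite !fctE /GRing.scale /=; field.
    rewrite sqnZ; last by case: (L2D iu2 ju2).
    by have := sqnD iu2 ju2; lra.
  (* The midpoint is no farther from [u] than the farther of the two points, so the lower bound
     attached to that point applies to it. *)
  have Jw : J - r <= E (2^-1 *: (v_ i + v_ j)) (2^-1 *: (v_ i + v_ j)).
    have [le|/ltW le] := leP (sqn (v_ i - u)) (sqn (v_ j - u)).
      by apply: le_trans (Hj _ dw _); lra.
    by apply: le_trans (Hi _ dw _); lra.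
  have dD : dom E (v_ i + v_ j) by exact: domD.
  rewrite (dformZl 2^-1 dD dw) in Jw.
  rewrite (dformZr 2^-1 dD dD) dformDD // in Jw.
  move: Jw.
  have := sqnB (v2 i) u2 (v2 j); rewrite dformBB // -(sqnN (u - v_ j)) opprB.
  lra.
have v2' := dom_L2' dv.
have uv0 : sqn (u - v) <= 0.
  apply/ler_addgt0Pl => e e0; rewrite addr0.
  have [N HN] := vlim (e / 4) (divr_gt0 e0 (ltr0n _ 4)).
  have [M HM] := natinv_lt (divr_gt0 e0 (ltr0n _ 4)).
  have := HN (maxn N M) (leq_maxl _ _).
  have := HM (maxn N M) (leq_maxr _ _).
  set n := maxn N M; have [_ _ nu _] := Hv n; move: nu; move: (n.+1%:R^-1) => a nu.
  have := form_ge0 (domB (dv_ n) dv).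
  have := sqnB u2 (v2 n) v2'; rewrite -(sqnN (u - v_ n)) opprB.
  lra.
have uv : u = v %[ae m].
  have [muv uv2] := L2B u2 v2'.
  have sq0 : \forall x \ae m, 0 <= (u - v) x ^+ 2.
    by apply: nearW => x; exact: sqr_ge0.
  have := Rintegral_eq0_ae uv2 sq0 uv0.
  apply: filterS => x /eqP; rewrite sqrf_eq0 fctE subr_eq0 => /eqP -> //.
have du : dom E u.
  apply: (dom_ae dv); first exact/Lfun2P.
  by apply: filterS uv => x ->.
split => //.
have <- : E v v = E u u.
  have vu : v = u %[ae m] by apply: filterS uv => x ->.
  by rewrite (form_ae dv du dv vu) (form_sym du dv) (form_ae dv du du vu).
apply: (form_le_lim dv_ dv) => e e0.
have [N HN] := vlim e e0; have [M HM] := natinv_lt e0.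
exists (maxn N M).
  have := HN _ (leq_maxl N M).
  by have := sqn_ge0 (m := m) (v_ (maxn N M) - v); lra.
have [_ + _ _] := Hv (maxn N M); have := HM _ (leq_maxr N M).
by move: (_.+1%:R^-1) => a; lra.
Qed.

(* On the vectors with E v v <= C, the functional E _ w is continuous at 0 for the
   L^2 norm: otherwise w + t v, with v small in L^2, would contradict the lower
   semicontinuity of E at w. *)
Lemma form_weak w C e : dom E w -> 0 <= C -> 0 < e -> exists2 r, 0 < r &
  forall v, dom E v -> E v v <= C -> sqn v <= r -> `|E v w| <= e.
Proof.
move=> dw C0 e0; apply: contrapT => H.
(* If E(v, w) < -e, the energy of w + t v is at most E(w, w) - 2 t e + t (t C), and t C <= e. *)
set t := e / (C + 1).
have t0 : 0 < t by rewrite divr_gt0 //; lra.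
have tC : t * (C + 1) = e by rewrite /t divfK //; lra.
suff [_] : dom E w /\ E w w <= E w w - t * e by have := mulr_gt0 t0 e0; lra.
apply: form_lsc; first exact: dom_L2' dw.
move=> r r0; set r' := r / t ^+ 2.
have r'0 : 0 < r' by rewrite divr_gt0 // exprn_gt0.
have [v [dv vC vr ve]] : exists v, [/\ dom E v, E v v <= C, sqn v <= r' & E v w < - e].
  apply: contrapT => H'; apply: H; exists r' => // v dv vC vr.
  rewrite leNgt; apply/negP; rewrite ltr_normr => /orP[ve|ve]; apply: H'.
    exists (- v); split => //; first exact: domN.
    - by rewrite -scaleN1r dformZl ?dformZr //; [lra|exact: domZ].
    - by rewrite sqnN.
    - by rewrite dformNl //; lra.
  by exists v; split => //; lra.
exists (w + t *: v); split.
- by apply: domD => //; exact: domZ.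
- rewrite dformDD ?dformZl ?dformZr //; [|exact: domZ..].
  rewrite (form_sym dw dv); nra.
- rewrite addrAC subrr add0r sqnZ; last by case: (dom_L2' dv).
  by rewrite mulrC -ler_pdivlMr // exprn_gt0.
Qed.

End LowerSemicontinuity.

Section Clipping.
Context {R : realType} {T : Type}.
Implicit Types (u v w : T -> R) (a : R).

Definition clip a u : T -> R := fun x => Num.min (Num.max 0 (u x)) a.

Lemma clip_ge0 a u x : 0 <= a -> 0 <= clip a u x.
Proof. by move=> a0; rewrite /clip le_min a0 le_max lexx. Qed.

Lemma clip_le a u x : clip a u x <= a.
Proof. by rewrite /clip ge_min lexx orbT. Qed.

Lemma clip0 u : clip 0 u = 0.
Proof. by apply/funext => x; rewrite /clip min_r // le_max lexx. Qed.

Lemma clip_id a u x : 0 <= u x <= a -> clip a u x = u x.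
Proof. by case/andP => u0 ua; rewrite /clip max_r // min_l. Qed.

Lemma clip_eq_bound a u x : 0 <= a -> a <= u x -> clip a u x = a.
Proof. by move=> a0 au; rewrite /clip min_r // le_max au orbT. Qed.

Lemma clip_eq0 a u x : 0 <= a -> u x <= 0 -> clip a u x = 0.
Proof. by move=> a0 u0; rewrite /clip max_l // min_l. Qed.

Lemma clip_mono a b u x : a <= b -> clip a u x <= clip b u x.
Proof. by move=> ab; rewrite /clip le_min ge_min lexx /= ge_min ab orbT. Qed.

Lemma clip_sub_eq0 a b u x : 0 <= a -> a <= b -> clip b u x - clip a u x != 0 ->
  a < u x.
Proof.
move=> a0 ab; apply: contraNT; rewrite -leNgt => ua; rewrite /clip.
have h : Num.max 0 (u x) <= a by rewrite ge_max a0.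
by rewrite !min_l ?subrr // (le_trans h).
Qed.

Lemma clip_sub_bound a b u x : 0 <= a -> a <= b ->
  0 <= clip b u x - clip a u x <= b - a.
Proof.
move=> a0 ab; rewrite subr_ge0 clip_mono //=.
have [ua|au] := leP (u x) a; last first.
  by rewrite (clip_eq_bound a0 (ltW au)) lerD2r clip_le.
have [->|ne] := eqVneq (clip b u x - clip a u x) 0; first by rewrite subr_ge0.
by have := clip_sub_eq0 a0 ab ne; rewrite ltNge ua.
Qed.

Lemma clip_steep v w a t : 0 <= a -> 0 <= t -> (forall x, 0 <= v x <= a) ->
  (forall x, 0 <= w x) -> (forall x, w x != 0 -> v x = a) ->
  clip a (v + t *: w) = v.
Proof.
move=> a0 t0 va w0 wv; apply/funext => x.
have [wx|wx] := eqVneq (w x) 0.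
  by rewrite clip_id !fctE wx ?scaler0 addr0 //; exact: va.
rewrite clip_eq_bound //; first by rewrite wv.
by rewrite !fctE wv // lerDl mulr_ge0.
Qed.

End Clipping.

Section Contraction.
Context {R : realType} {d : measure_display} {X : borelMetricType R d}.
Context {m : {finite_measure set X -> \bar R}} (E : dirichlet_form m).

Local Notation sqn := (@sqn R d X m).
Local Notation L2 := (@L2 R d X m).

Lemma clip_dom a u : 0 <= a -> dom E u ->
  dom E (clip a u) /\ E (clip a u) (clip a u) <= E u u.
Proof.
rewrite le_eqVlt => /predU1P[<- du|a0 du].
  rewrite clip0; split; first exact: dom0.
  by rewrite dform0l ?form_ge0 //; exact: dom0.
have [] := form_markov (domZ a^-1 du); set v := (fun x => _) => dv vle.
have -> : clip a u = a *: v.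
  apply/funext => x; rewrite /clip /v /= !fctE /GRing.scale /= minr_pMr ?ltW //.
  by rewrite maxr_pMr ?ltW // mulr0 mulVKf ?gt_eqF // mulr1.
split; first exact: domZ.
move: vle; rewrite !dformZl ?dformZr //; [|exact: domZ..] => vle.
have -> : E u u = a * (a * (a^-1 * (a^-1 * E u u))) by field; rewrite gt_eqF.
by rewrite !ler_pM2l.
Qed.

Lemma dom_clip a u : 0 <= a -> dom E u -> dom E (clip a u).
Proof. by move=> a0 /(clip_dom a0)[]. Qed.

Lemma form_clip_le a u : 0 <= a -> dom E u -> E (clip a u) (clip a u) <= E u u.
Proof. by move=> a0 /(clip_dom a0)[]. Qed.

(** Clipping v + t w at height a gives back v, so the Markov property reads 0 <= 2 E(v, w) + t E(w,
    w) for every t > 0; small t gives the sign. *)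
Lemma form_steep_ge0 a v w : 0 <= a -> dom E v -> dom E w ->
  (forall x, 0 <= v x <= a) -> (forall x, 0 <= w x) ->
  (forall x, w x != 0 -> v x = a) -> 0 <= E v w.
Proof.
move=> a0 dv dw va w0 wv.
have h t : 0 < t -> 0 <= 2 * E v w + t * E w w.
  move=> t0; have dvw := domD dv (domZ t dw).
  have := form_clip_le a0 dvw; rewrite clip_steep // ?(ltW t0) //.
  rewrite dformDD ?dformZl ?dformZr //; [|exact: domZ..] => h.
  rewrite -(pmulr_rge0 _ t0); lra.
have := form_ge0 dw; rewrite le_eqVlt => /predU1P[w00|w_gt0].
  by have := h 1 ltr01; rewrite -w00; lra.
rewrite leNgt; apply/negP => vw0.
have t0 : 0 < - E v w / E w w by rewrite divr_gt0 // oppr_gt0.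
have := h _ t0; rewrite divfK ?gt_eqF //; lra.
Qed.

(** The upper slice is nonzero only where the lower one has reached its full height, which is the
    situation of [form_steep_ge0]. *)
Lemma form_slice_ge0 a b a' b' u : dom E u -> 0 <= a -> a <= b -> b <= a' ->
  a' <= b' -> 0 <= E (clip b u - clip a u) (clip b' u - clip a' u).
Proof.
move=> du a0 ab ba' a'b'.
have b0 := le_trans a0 ab; have a'0 := le_trans b0 ba'.
have b'0 := le_trans a'0 a'b'.
apply: (@form_steep_ge0 (b - a)).
- by rewrite subr_ge0.
- by apply: domB; exact: dom_clip.
- by apply: domB; exact: dom_clip.
- by move=> x; rewrite !fctE clip_sub_bound.
- by move=> x; rewrite !fctE subr_ge0 clip_mono.
move=> x /(clip_sub_eq0 a'0 a'b') a'u.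
have bu := le_lt_trans ba' a'u; have au := le_lt_trans ab bu.
by rewrite !fctE !clip_eq_bound // ltW.
Qed.

(** The composition of [u] with the function that is 0 on negative reals, has slope [c i] on
    [i h, (i+1) h] and is constant beyond k h. It is written as a combination of slices because
    slices have nonnegative mutual energy. *)
Fixpoint staircase (c : nat -> R) (h : R) (u : X -> R) (k : nat) : X -> R :=
  if k is k'.+1 then staircase c h u k' +
    c k' *: (clip (k'.+1%:R * h) u - clip (k'%:R * h) u) else 0.

Section Staircase.
Variables (c : nat -> R) (h L : R) (u : X -> R) (n : nat).
Hypotheses (h0 : 0 <= h) (du : dom E u).
Hypothesis cL : forall i, (i < n)%N -> `|c i| <= L.

Let A k := clip (k%:R * h) u.
Let S := staircase c h u.

Let kh0 k : 0 <= k%:R * h. Proof. by rewrite mulr_ge0. Qed.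
Let dA k : dom E (A k). Proof. exact: dom_clip. Qed.
Let kkh k : k%:R * h <= k.+1%:R * h.
Proof. by rewrite ler_wpM2r // ler_nat. Qed.

Lemma dom_staircase k : dom E (S k).
Proof.
elim: k => [|k dk] /=; first exact: dom0.
by apply: domD => //; apply: domZ; apply: domB; exact: dA.
Qed.


Let dD i : dom E (A i.+1 - A i). Proof. by apply: domB; exact: dA. Qed.

(** [A k] is the sum of the same slices with all coefficients 1. Each of them has nonnegative energy
    against the slice j, so the triangle inequality may be applied term by term. *)
Lemma form_staircase_slice k j : (k <= n)%N -> (k <= j)%N ->
  `|E (S k) (A j.+1 - A j)| <= L * E (A k) (A j.+1 - A j).
Proof.
elim: k => [_ _|k IH kn kj].
  by rewrite /S /A /= mul0r clip0 !dform0l ?normr0 ?mulr0 //; exact: dD.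
have {}IH := IH (ltnW kn) (ltnW kj).
have s0 : 0 <= E (A k.+1 - A k) (A j.+1 - A j).
  by apply: form_slice_ge0 => //; rewrite ler_wpM2r // ler_nat.
have -> : E (A k.+1) (A j.+1 - A j) =
    E (A k) (A j.+1 - A j) + E (A k.+1 - A k) (A j.+1 - A j).
  by rewrite (dformBl (dA _) (dA _) (dD j)); ring.
rewrite (dformDl (dom_staircase k) (domZ _ (dD k)) (dD j)) (dformZl _ (dD k) (dD j)).
apply: le_trans (ler_normD _ _) _; rewrite normrM (ger0_norm s0) mulrDr.
by apply: lerD => //; rewrite ler_wpM2r // cL.
Qed.

(** Adding one slice, both the square of the new coefficient and the cross term are dominated by
    their values for coefficients all equal to L, that is, for L times [A k]. *)
Lemma form_staircase_le k : (k <= n)%N -> E (S k) (S k) <= L ^+ 2 * E (A k) (A k).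
Proof.
elim: k => [_|k IH kn].
  by rewrite /S /A /= mul0r clip0 dform0l ?mulr0 //; exact: dom0.
have := form_staircase_slice (ltnW kn) (leqnn k).
have -> : E (A k.+1) (A k.+1) = E (A k) (A k) + 2 * E (A k) (A k.+1 - A k) +
    E (A k.+1 - A k) (A k.+1 - A k).
  rewrite (dformBB (dA _) (dA _)) (dformBr (dA _) (dA _) (dA _)).
  by rewrite (form_sym (dA k) (dA k.+1)); ring.
have dcD := domZ (c k) (dD k); have dSk := dom_staircase k.
rewrite (dformDD dSk dcD) (dformZr _ (dD k) dSk) (dformZl _ (dD k) dcD) (dformZr _ (dD k) (dD k)).
have := form_ge0 (dD k); have := cL kn; have := IH (ltnW kn).
set e1 := E _ _; set e2 := E (A k) _; set e3 := E _ (A k.+1 - A k).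
set e4 := E (A k) _; set e5 := E (S k) _ => IH' ck e30 e54.
have h1 : c k * e5 <= L * (L * e4).
  by apply: le_trans (ler_norm _) _; rewrite normrM ler_pM.
have h2 : c k * (c k * e3) <= L * (L * e3).
  rewrite !mulrA ler_wpM2r //; apply: le_trans (ler_norm _) _.
  by rewrite normrM ler_pM.
by rewrite !mulrDr expr2; lra.
Qed.

End Staircase.

Definition slope (f : R -> R) h (i : nat) := (f (i.+1%:R * h) - f (i%:R * h)) / h.

Lemma staircase_approx (f : R -> R) (h L : R) (u : X -> R) k x : 0 < h -> 0 <= L -> f 0 = 0 ->
  0 <= u x -> (forall s t, 0 <= s <= k%:R * h -> 0 <= t <= k%:R * h ->
     `|f s - f t| <= L * `|s - t|) ->
  `|staircase (slope f h) h u k x - f (clip (k%:R * h) u x)| <= 2 * L * h.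
Proof.
move=> h0 L0 f0 ux fL.
(* The exact value at the grid points already passed is needed in the induction: beyond j h the
   staircase of length j is frozen at f(j h). Inside a cell, f and its chord each move by at most L
   h. *)
suff : forall j, (j <= k)%N ->
    (j%:R * h <= u x -> staircase (slope f h) h u j x = f (j%:R * h)) /\
    `|staircase (slope f h) h u j x - f (clip (j%:R * h) u x)| <= 2 * L * h.
  by move=> /(_ k (leqnn k))[].
elim=> [_|j IH jk].
  rewrite /= mul0r f0 clip0 f0 subr0 normr0; split => //.
  by rewrite !mulr_ge0 // ltW.
have {IH} [IH1 IH2] := IH (ltnW jk).
have tk : j.+1%:R * h <= k%:R * h by rewrite ler_pM2r // ler_nat.
move: IH1 IH2 tk; rewrite /= !fctE /slope.
have -> : j.+1%:R * h = j%:R * h + h by rewrite -natr1 mulrDl mul1r.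
have : 0 <= j%:R * h by rewrite mulr_ge0 // ltW.
move: (j%:R * h) => t t0 IH1 IH2 tk.
have t'0 : 0 <= t + h by rewrite addr_ge0 // ltW.
have [ut|tu] := leP (u x) t.
  have ub1 : 0 <= u x <= t by rewrite ux.
  have ub2 : 0 <= u x <= t + h by rewrite ux (le_trans ut) // lerDl ltW.
  rewrite (clip_id ub1) in IH2; rewrite (clip_id ub1) (clip_id ub2).
  rewrite subrr scaler0 addr0; split => // tu.
  by have := le_trans tu ut; rewrite gerDl leNgt h0.
rewrite (IH1 (ltW tu)) (clip_eq_bound t0 (ltW tu)).
have [tu'|ut'] := leP (t + h) (u x).
  rewrite (clip_eq_bound t'0 tu').
  have -> : f t + ((f (t + h) - f t) / h) *: (t + h - t) = f (t + h).
    by rewrite /GRing.scale /=; field; rewrite gt_eqF.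
  by rewrite subrr normr0; split => //; rewrite !mulr_ge0 // ltW.
split => [//|].
have ub2 : 0 <= u x <= t + h by rewrite ux ltW.
rewrite (clip_id ub2) /GRing.scale /=.
have tb : 0 <= t <= k%:R * h by rewrite t0 (le_trans _ tk) // lerDl ltW.
have t'b : 0 <= t + h <= k%:R * h by rewrite t'0.
have ub : 0 <= u x <= k%:R * h by rewrite ux (le_trans _ tk) // ltW.
have h1 := fL _ _ tb ub; have h2 := fL _ _ t'b tb.
have uth : `|t - u x| <= h by rewrite distrC ger0_norm; lra.
have cL : `|(f (t + h) - f t) / h| <= L.
  rewrite normrM normfV (gtr0_norm h0) ler_pdivrMr //.
  have th : t + h - t = h by ring.
  by rewrite th (gtr0_norm h0) in h2.
rewrite addrAC; apply: le_trans (ler_normD _ _) _.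
have : `|(f (t + h) - f t) / h * (u x - t)| <= L * h.
  by rewrite normrM ler_pM // distrC.
have : L * `|t - u x| <= L * h by rewrite ler_wpM2l.
lra.
Qed.

(** The Markov axiom only covers truncation to [0, 1]. A Lipschitz function is a uniform limit of
    staircases whose slopes are bounded by L, and the energy bound passes to the limit by
    [form_lsc]. *)
Lemma form_lipschitz (f : R -> R) (L M : R) u : dom E u -> 0 <= L -> f 0 = 0 ->
  (forall x, 0 <= u x <= M) -> measurable_fun setT (f \o u) ->
  (forall s t, 0 <= s <= M -> 0 <= t <= M -> `|f s - f t| <= L * `|s - t|) ->
  dom E (f \o u) /\ E (f \o u) (f \o u) <= L ^+ 2 * E u u.
Proof.
move=> du L0 f0 uM mfu fL.
have [M0|M0] := leP M 0.
  have -> : f \o u = 0.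
    apply/funext => x; have /andP[u0 uM'] := uM x.
    by rewrite /= (_ : u x = 0) //; apply/eqP; rewrite eq_le u0 (le_trans uM').
  rewrite dform0l; last exact: dom0.
  by split; [exact: dom0|rewrite mulr_ge0 ?sqr_ge0 ?form_ge0].
apply: form_lsc.
  split => //; apply: (@integrable_bounded _ _ _ _ _ ((L * M) ^+ 2)).
    exact: measurable_funX.
  move=> x /=; have /andP[u0 uM'] := uM x.
  have h0 : (0 : R) <= 0 <= M by rewrite lexx ltW.
  have := fL _ _ (uM x) h0; rewrite f0 !subr0 (ger0_norm u0) => fu.
  rewrite normrX lerXn2r ?nnegrE ?mulr_ge0 ?(ltW M0) //.
  by apply: le_trans fu _; rewrite ler_wpM2l.
move=> e e0.
(* With h = M / n the squared L^2 error is at most (2 L M)^2 m(X) / n^2, hence at most K / n. The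
   added units make K positive. *)
set K := (fine (m setT) + 1) * (2 * L * M) ^+ 2 + 1.
have mu0 : 0 <= fine (m setT) by rewrite fine_ge0.
have K0 : 0 < K by rewrite ltr_wpDl // mulr_ge0 ?sqr_ge0 // addr_ge0.
have [N HN] := natinv_lt (divr_gt0 e0 K0).
have {HN} := HN N (leqnn _); set n := N.+1 => He.
have n0 : 0 < n%:R :> R by rewrite ltr0n.
set h := M / n%:R.
have nh : n%:R * h = M by rewrite /h mulrC divfK // gt_eqF.
have h0 : 0 < h by rewrite divr_gt0.
have tM : clip (n%:R * h) u = u.
  by apply/funext => x; rewrite nh clip_id.
exists (staircase (slope f h) h u n); split.
- by apply: dom_staircase => //; exact: ltW.
- rewrite -[in leRHS]tM; apply: (form_staircase_le (ltW h0) du _ (leqnn n)).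
  move=> i ni; rewrite /slope normrM normfV (gtr0_norm h0) ler_pdivrMr //.
  have ib : 0 <= i%:R * h <= M.
    apply/andP; split; first by rewrite mulr_ge0 // ltW.
    by rewrite -[leRHS]nh ler_pM2r // ler_nat ltnW.
  have i'b : 0 <= i.+1%:R * h <= M.
    apply/andP; split; first by rewrite mulr_ge0 // ltW.
    by rewrite -[leRHS]nh ler_pM2r // ler_nat.
  have := fL _ _ i'b ib; rewrite -mulrBl -natrB // subSnn mul1r.
  by rewrite (gtr0_norm h0).
have bd x : `|(staircase (slope f h) h u n - (f \o u)) x| <= 2 * L * h.
  have := @staircase_approx f h L u n x h0 L0 f0; rewrite nh => H.
  have /andP[u0 _] := uM x.
  by have tM' := tM; rewrite nh in tM'; have := H u0 fL; rewrite tM'.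
have c0 : 0 <= 2 * L * h by rewrite !mulr_ge0 // ltW.
have le : sqn (staircase (slope f h) h u n - (f \o u)) <=
    \int[m]_x (cst ((2 * L * h) ^+ 2) x).
  apply: le_Rintegral => //.
  - apply: (@integrable_bounded _ _ _ _ _ ((2 * L * h) ^+ 2)).
      apply: (@measurable_funX _ _ _ _ (_ - _)); apply: measurable_funB => //.
      by apply: dom_meas; apply: dom_staircase => //; exact: ltW.
    by move=> x; rewrite normrX lerXn2r ?nnegrE.
  - exact: finite_measure_integrable_cst.
  by move=> x _; rewrite -real_normK ?num_real // lerXn2r ?nnegrE.
apply: (le_trans le); rewrite Rintegral_cst //.
have -> : 2 * L * h = (2 * L * M) * n%:R^-1 by rewrite /h mulrA.
have ninv1 : n%:R^-1 <= 1 :> R by rewrite invf_le1 ?ler1n.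
have ninv0 : 0 < n%:R^-1 :> R by rewrite invr_gt0.
have : n%:R^-1 * K <= e by rewrite -ler_pdivlMr // ltW.
rewrite /K; move: (n%:R^-1) ninv0 ninv1 => y y0 y1 yK.
set z := (2 * L * M) ^+ 2 in yK *.
have z0 : 0 <= z by exact: sqr_ge0.
rewrite exprMn -/z; move: (fine _) mu0 yK => mu mu0 yK.
apply: le_trans yK.
have h1 : 0 <= z * mu * (y - y ^+ 2).
  apply: mulr_ge0; first exact: mulr_ge0.
  by rewrite subr_ge0 expr2 ler_piMr // ltW.
have h2 : 0 <= y * z by rewrite mulr_ge0 // ltW.
lra.
Qed.

End Contraction.

(** * The algebra of bounded functions of the domain and the core *)

Section BoundedDomain.
Context {R : realType} {d : measure_display} {X : borelMetricType R d}.
Context {m : {finite_measure set X -> \bar R}} (E : dirichlet_form m).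

Local Notation sqn := (@sqn R d X m).
Local Notation L2 := (@L2 R d X m).
Local Notation Cc := (@Cc R d X).

(** The bound holds at every point, unlike the essential bound in [bdom], so that truncations and
    Lipschitz compositions can be handled pointwise. *)
Definition bounded_dom (u : X -> R) :=
  dom E u /\ exists M, forall x, `|u x| <= M.

Local Notation bd := bounded_dom.

Lemma bdD u v : bd u -> bd v -> bd (u + v).
Proof.
move=> [du [M uM]] [dv [N vN]]; split; first exact: domD.
by exists (M + N) => x; rewrite (le_trans (ler_normD _ _)) // lerD.
Qed.

Lemma bdZ a u : bd u -> bd (a *: u).
Proof.
move=> [du [M uM]]; split; first exact: domZ.
by exists (`|a| * M) => x; rewrite normrM ler_wpM2l.
Qed.

Lemma bdN u : bd u -> bd (- u).
Proof. by move=> bu; rewrite -scaleN1r; exact: bdZ. Qed.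

Lemma bdB u v : bd u -> bd v -> bd (u - v).
Proof. by move=> bu bv; apply: bdD => //; exact: bdN. Qed.

Lemma bd_clip a u : 0 <= a -> dom E u -> bd (clip a u).
Proof.
move=> a0 du; split; first exact: dom_clip.
by exists a => x; rewrite ger0_norm ?clip_ge0 // clip_le.
Qed.

Lemma bd_bdom u : bd u -> bdom E u.
Proof.
move=> [du [M uM]]; split => //=; rewrite inE; apply/andP; split.
  by rewrite inE /=; exact: dom_meas du.
rewrite inE /= /finite_norm unlock /=.
case: ifPn => // m0; apply: (@le_lt_trans _ _ M%:E); last exact: ltry.
by apply/ess_supP; apply: nearW => x /=; rewrite lee_fin.
Qed.

Lemma bd_sqr_ge0 u : bd u -> (forall x, 0 <= u x) -> bd (u * u).
Proof.
move=> [du [M uM]] u0; split; last first.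
  by exists (M * M) => x; rewrite normrM ler_pM.
have [M0|M0] := leP 0 M; last first.
  have -> : u * u = cst 0.
    by apply/funext => x; have := le_trans (normr_ge0 _) (uM x); rewrite leNgt M0.
  exact: dom0.
have := @form_lipschitz _ _ _ _ E (fun t => t * t) (2 * M) M u du.
case=> //; first exact: mulr_ge0.
- by rewrite mul0r.
- by move=> x; rewrite u0 (le_trans (ler_norm _)).
- by apply: measurable_funM; exact: dom_meas du.
move=> s t /andP[s0 sM] /andP[t0 tM].
have -> : s * s - t * t = (s + t) * (s - t) by ring.
by rewrite normrM ler_wpM2r // ger0_norm ?addr_ge0 //; lra.
Qed.

Lemma clip_posneg M (u : X -> R) : (forall x, `|u x| <= M) ->
  u = clip M u - clip M (- u).
Proof.
move=> uM; apply/funext => x; have := uM x; rewrite ler_norml => /andP[h1 h2].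
have M0 := le_trans (normr_ge0 _) (uM x).
rewrite !fctE; have [u0|u0] := leP 0 (u x).
  rewrite clip_id ?u0 // clip_eq0 ?subr0 //.
  by rewrite oppr_le0.
rewrite clip_eq0 ?(ltW u0) // clip_id ?sub0r ?opprK //.
by rewrite oppr_ge0 (ltW u0) /= lerNl.
Qed.

(** By polarization only squares matter. Since [form_lipschitz] is for nonnegative functions, the
    square is split as the sum of the squares of the positive and negative parts. *)
Lemma bd_mul u v : bd u -> bd v -> bd (u * v).
Proof.
have sq w : bd w -> bd (w * w).
  move=> [dw [M wM]]; have [|M0] := leP M 0.
    move=> M0; suff -> : w * w = 0 *: w by apply: bdZ; split => //; exists M.
    apply/funext => x; rewrite !fctE scale0r.
    have := le_trans (wM x) M0; rewrite normr_le0 => /eqP ->.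
    by rewrite mulr0.
  have b1 : bd (clip M w) by apply: bd_clip => //; exact: ltW.
  have b2 : bd (clip M (- w)).
    by apply: bd_clip; [exact: ltW|exact: domN].
  have -> : w * w = clip M w * clip M w + clip M (- w) * clip M (- w).
    apply/funext => x; rewrite {1 2}(clip_posneg wM) !fctE.
    suff : clip M w x * clip M (- w) x = 0 by lra.
    have [w0|w0] := leP 0 (w x).
      by rewrite [clip M (- w) x]clip_eq0 ?mulr0 ?(ltW M0) // oppr_le0.
    by rewrite clip_eq0 ?mul0r ?ltW.
  by apply: bdD; apply: bd_sqr_ge0 => // x; rewrite clip_ge0 ?ltW.
move=> bu bv.
have -> : u * v = 2^-1 *: ((u + v) * (u + v) - u * u - v * v).
  by apply/funext => x; rewrite !fctE /GRing.scale /=; field.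
by apply: bdZ; apply: bdB; [apply: bdB|]; apply: sq => //; exact: bdD.
Qed.

(** Compact supports are what strong locality requires, and regularity makes this class dense:
    identities are proved here first and extended afterwards. *)
Definition core (u : X -> R) := dom E u /\ Cc u.

Lemma CcD u v : Cc u -> Cc v -> Cc (u + v).
Proof.
move=> [cu su] [cv sv]; split; first by move=> x; apply: cvgD; [exact: cu|exact: cv].
apply: subclosed_compact (compactU su sv) _; first exact: closed_closure.
rewrite -closureU; apply: closure_subset => x /=.
rewrite !fctE; have [->|] := eqVneq (u x) 0; last by left.
by rewrite add0r; right.
Qed.

Lemma Cc_comp (f : R -> R) u : continuous f -> f 0 = 0 -> Cc u -> Cc (f \o u).
Proof.
move=> cf f0 [cu su]; split.
  by move=> x; apply: continuous_comp; [exact: cu|exact: cf].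
apply: subclosed_compact su _; first exact: closed_closure.
by apply: closure_subset => x /=; apply: contra_neq => ->.
Qed.

Lemma CcM u v : Cc u -> Cc v -> Cc (u * v).
Proof.
move=> [cu su] [cv sv]; split; first by move=> x; apply: cvgM; [exact: cu|exact: cv].
apply: subclosed_compact su _; first exact: closed_closure.
by apply: closure_subset => x /=; apply: contra_neq; rewrite !fctE => ->; rewrite mul0r.
Qed.

Lemma core_bd u : core u -> bd u.
Proof.
move=> [du [cu su]]; split => //.
have : compact (u @` closure [set x | u x != 0]).
  by apply: continuous_compact => //; exact: continuous_subspaceT.
move/compact_bounded => [M [_ HM]]; exists (Num.max 0 (M + 1)) => x.
have [->|ux] := eqVneq (u x) 0; first by rewrite normr0 le_max lexx.
have : (fun y => `|y| <= M + 1) (u x).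
  by apply: HM; [rewrite ltrDl|exists x => //; exact: subset_closure].
by move=> uM; rewrite le_max uM orbT.
Qed.

Lemma coreD u v : core u -> core v -> core (u + v).
Proof. by move=> [du cu] [dv cv]; split; [exact: domD|exact: CcD]. Qed.

Lemma coreZ a u : core u -> core (a *: u).
Proof.
move=> [du cu]; split; first exact: domZ.
have -> : a *: u = ( *%R a) \o u by [].
apply: Cc_comp => //; last by rewrite mulr0.
by move=> x; apply: cvgM; [exact: cvg_cst|exact: cvg_id].
Qed.

Lemma coreN u : core u -> core (- u).
Proof. by move=> cu; rewrite -scaleN1r; exact: coreZ. Qed.

Lemma coreB u v : core u -> core v -> core (u - v).
Proof. by move=> bu bv; apply: coreD => //; exact: coreN. Qed.

Lemma coreM u v : core u -> core v -> core (u * v).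
Proof.
move=> cu cv; have [d_uv _] := bd_mul (core_bd cu) (core_bd cv).
by split => //; apply: CcM; [case: cu|case: cv].
Qed.

Lemma core_clip a u : 0 <= a -> core u -> core (clip a u).
Proof.
move=> a0 [du cu]; split; first exact: dom_clip.
apply: (@Cc_comp (fun t => Num.min (Num.max 0 t) a)) => //.
  move=> x; apply: continuous_min; last exact: cvg_cst.
  by apply: continuous_max; [exact: cvg_cst|exact: cvg_id].
by rewrite maxxx min_l.
Qed.

End BoundedDomain.

(** * The Leibniz rule for Gamma *)

Section CoreLocality.
Context {R : realType} {d : measure_display} {X : borelMetricType R d}.
Context {m : {finite_measure set X -> \bar R}} (E : dirichlet_form m).
Hypothesis E_loc : strongly_local E.

Local Notation sqn := (@sqn R d X m).
Local Notation L2 := (@L2 R d X m).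

Lemma closed_ae_support (u : X -> R) : closed (ae_support m u).
Proof.
rewrite -openC openE => x /= /existsNP[G /not_implyP[[oG Gx] /contrapT uG]].
have : nbhs x G by exact: open_nbhs_nbhs.
apply: filterS => y Gy; apply/existsNP; exists G.
by apply/not_implyP; split => //; exact.
Qed.

Lemma ae_support_sub (u : X -> R) (A : set X) : closed A ->
  (forall x, ~ A x -> u x = 0) -> ae_support m u `<=` A.
Proof.
move=> cA uA x; apply: contraPP => nAx; apply/existsNP; exists (~` A).
apply/not_implyP; split; first by split => //; exact: closed_openC.
by move=> h; apply: h; apply: nearW => y; exact: uA.
Qed.

Lemma compact_ae_support (u : X -> R) : Cc u -> compact (ae_support m u).
Proof.
move=> [_ su]; apply: subclosed_compact su _; first exact: closed_ae_support.
apply: ae_support_sub; first exact: closed_closure.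
by move=> x nx; apply: contrapT => /eqP ux; apply: nx; exact: subset_closure.
Qed.

Lemma sqn_bounded (u : X -> R) (M : R) : measurable_fun setT u -> 0 <= M ->
  (forall x, `|u x| <= M) -> sqn u <= M ^+ 2 * fine (m setT).
Proof.
move=> mu M0 uM; rewrite -Rintegral_cst //; apply: le_Rintegral => //.
- apply: (@integrable_bounded _ _ _ _ _ (M ^+ 2)); first exact: measurable_funX.
  by move=> x; rewrite normrX lerXn2r ?nnegrE.
- exact: finite_measure_integrable_cst.
by move=> x _; rewrite -real_normK ?num_real // lerXn2r ?nnegrE.
Qed.

Lemma small_sqr (r : R) : 0 < r -> exists2 e : R, 0 < e & e ^+ 2 * fine (m setT) <= r.
Proof.
move=> r0; set M := fine (m setT) + 1.
have m0 : 0 <= fine (m setT) by rewrite fine_ge0.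
have M0 : 0 < M by rewrite ltr_wpDl.
exists (Num.sqrt (r / M)); first by rewrite sqrtr_gt0 divr_gt0.
rewrite sqr_sqrtr; last by rewrite divr_ge0 ?(ltW r0) ?(ltW M0).
rewrite mulrAC ler_pdivrMr // ler_wpM2l ?(ltW r0) //.
by rewrite /M lerDl.
Qed.

(** Strong locality needs w constant on a neighbourhood of the support, not merely on {v != 0}. Let
    t be v truncated to [-a, a]: the support of v - t lies in {|v| >= a}, hence in the open set {v
    != 0}, so E(v, w) = E(t, w). As a decreases, t is uniformly small with bounded energy, and
    [form_weak] applies. *)
Lemma core_local c v w : core E v -> core E w ->
  (forall x, v x != 0 -> w x = c) -> E v w = 0.
Proof.
move=> cv cw vw; have [dv [ctv sv]] := cv; have [dw _] := cw.
apply/eqP; rewrite -normr_eq0 eq_le normr_ge0 andbT.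
apply/ler_addgt0Pl => e e0; rewrite addr0.
have C0 : 0 <= 4 * E v v by rewrite mulr_ge0 ?form_ge0.
have [r r0 Hr] := form_weak dw C0 e0.
have [a a0 Ha] := small_sqr r0.
set t := clip a v - clip a (- v).
have ta : core E (clip a v) by apply: core_clip => //; exact: ltW.
have tna : core E (clip a (- v)).
  by apply: core_clip; [exact: ltW|exact: coreN].
have ct : core E t by exact: coreB.
have tle x : `|t x| <= a.
  rewrite /t !fctE ler_norml; have := clip_le a v x; have := clip_le a (- v) x.
  have := clip_ge0 v x (ltW a0); have := clip_ge0 (- v) x (ltW a0); lra.
have tE x : `|v x| <= a -> t x = v x.
  rewrite /t !fctE ler_norml => /andP[h1 h2]; have [v0|/ltW v0] := leP 0 (v x).
    by rewrite clip_id ?v0 // clip_eq0 ?subr0 ?(ltW a0) // oppr_le0.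
  rewrite clip_eq0 ?(ltW a0) // clip_id ?sub0r ?opprK //.
  by rewrite oppr_ge0 v0 lerNl.
have cvt : core E (v - t) by exact: coreB.
have Evt : E (v - t) w = 0.
  apply: (E_loc cvt.1 dw).
  - exact: compact_ae_support cvt.2.
  - exact: compact_ae_support cw.2.
  exists c, [set x | v x != 0]; split.
  - rewrite (_ : [set x | _] = v @^-1` [set y | y != 0]) //.
    by apply: open_comp; [move=> x _; exact: ctv|exact: open_neq].
  - apply: (@subset_trans _ [set x | a <= `|v x|]).
      apply: ae_support_sub.
        rewrite (_ : [set x | _] = (fun x => `|v x|) @^-1` [set y | a <= y]) //.
        apply: closed_comp; last exact: closed_ge.
        by move=> x _; apply: cvg_norm; exact: ctv.
      by move=> x /= /negP; rewrite -ltNge => /ltW /tE; rewrite !fctE => ->; rewrite subrr.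
    by move=> x /= av; rewrite -normr_gt0 (lt_le_trans a0).
  - by apply: nearW => x /= /vw.
have -> : E v w = E t w.
  by move: Evt; rewrite dformBl ?ct.1 // => [/eqP|]; [rewrite subr_eq0 => /eqP|exact: ct.1].
apply: Hr; first exact: ct.1.
  (* The parallelogram inequality and the Markov property bound the energy of [t] by 2 E(v, v) + 2
     E(v, v). *)
  rewrite dformBB; [|exact: ta.1|exact: tna.1].
  have := form_ge0 (domD ta.1 tna.1); rewrite dformDD; [|exact: ta.1|exact: tna.1].
  have := form_clip_le (ltW a0) dv; have := form_clip_le (ltW a0) (domN dv).
  have -> : E (- v) (- v) = E v v.
    by rewrite -scaleN1r dformZl ?dformZr //; [ring|exact: domZ].
  lra.
apply: le_trans Ha; apply: sqn_bounded => //; last exact: ltW.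
exact: dom_meas ct.1.
Qed.

End CoreLocality.

Section CoreCubic.
Context {R : realType} {d : measure_display} {X : borelMetricType R d}.
Context {m : {finite_measure set X -> \bar R}} (E : dirichlet_form m).
Hypothesis E_loc : strongly_local E.

(* The chain rule for the energy gives E(u^3, u) = 3/4 E(u^2, u^2); it is proved
   by letting the range of u grow by small slices, each slice being constant where
   the next one does not vanish. *)
Definition quartic_defect (u : X -> R) : R :=
  4 * E (u * u * u) u - 3 * E (u * u) (u * u).

(** This is [form_amgm] with parameter L, divided by L. When L = 0 the energy of u vanishes and the
    parameter must tend to 0 instead. *)
Lemma form_CS_le (L : R) s u : dom E s -> dom E u -> 0 <= L ->
  E u u <= L ^+ 2 * E s s -> `|E u s| <= L * E s s.
Proof.
move=> ds du L0 Eu; have := form_ge0 ds; have := form_ge0 du => Eu0 Es0.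
move: L0; rewrite le_eqVlt => /predU1P[L0|L0].
  have Eu00 : E u u = 0 by apply/eqP; rewrite eq_le Eu0 (le_trans Eu) // -L0 expr0n mul0r.
  rewrite -L0 mul0r; apply/ler_addgt0Pl => e e0; rewrite addr0.
  set t := e / (E s s + 1).
  have t0 : 0 < t by rewrite divr_gt0 // ltr_wpDl.
  have ts : t * E s s <= e.
    by rewrite /t mulrAC ler_pdivrMr ?ltr_wpDl // ler_wpM2l ?(ltW e0) // lerDl.
  have := form_amgm t ds du; rewrite Eu00 addr0 expr2 -mulrA (form_sym ds du) => H.
  have {}H : 2 * `|E u s| <= t * E s s by rewrite -(ler_pM2l t0); lra.
  have := normr_ge0 (E u s); lra.
have := form_amgm L ds du; rewrite (form_sym ds du) => H.
rewrite -(ler_pM2l L0); rewrite expr2 in Eu H; lra.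
Qed.

(** On {s != 0} the function A equals t, so (A + s)^3 = A^3 + 3 t^2 s + b and (A + s)^2 = A^2 + 2 t
    s + g, with b = 3 t s^2 + s^3 and g = s^2. Locality removes every product with a power of A, and
    the terms 12 t^2 E(s, s) cancel, which explains the coefficients 4 and 3. There remains 4 E(b,
    s) - 12 t E(g, s) - 3 E(g, g), bounded by (36 + 24 + 12) h E(s, s). *)
Lemma quartic_defect_step A s (t h : R) : core E A -> core E s ->
  0 <= t <= 1 -> 0 <= h <= 1 -> (forall x, 0 <= s x <= h) ->
  (forall x, s x != 0 -> A x = t) ->
  `|quartic_defect (A + s) - quartic_defect A| <= 72 * h * E s s /\
  E (A + s) (A + s) = E A A + E s s.
Proof.
move=> cA cs /andP[t0 t1] /andP[h0 h1] sh sA.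
have ms : measurable_fun setT s by exact: dom_meas cs.1.
pose f (y : R) := 3 * t * (y * y) + y * y * y.
pose b : X -> R := (3 * t) *: (s * s) + s * s * s.
pose g : X -> R := s * s.
have cg : core E g by exact: coreM.
have cb : core E b by apply: coreD; [exact: coreZ|exact: coreM].
have cAA : core E (A * A) by exact: coreM.
have cAAA : core E (A * A * A) by exact: coreM.
have As0 v c : core E v -> (forall x, s x != 0 -> v x = c) -> E s v = 0.
  by move=> cv vc; exact: (core_local E_loc cs cv vc).
have bs0 v c : core E v -> (forall x, s x != 0 -> v x = c) -> E b v = 0.
  move=> cv vc; apply: (core_local E_loc cb cv (c := c)) => x bx; apply: vc.
  by apply: contra_neq bx; rewrite /b !fctE => ->; rewrite !mulr0 scaler0 addr0.
have gs0 v c : core E v -> (forall x, s x != 0 -> v x = c) -> E g v = 0.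
  move=> cv vc; apply: (core_local E_loc cg cv (c := c)) => x bx; apply: vc.
  by apply: contra_neq bx; rewrite /g !fctE => ->; rewrite mulr0.
have EsA : E s A = 0 by exact: As0 sA.
have EbA : E b A = 0 by exact: bs0 sA.
have EsAAA : E s (A * A * A) = 0.
  by apply: (As0 _ (t * t * t)) => // x /sA; rewrite !fctE => ->.
have EsAA : E s (A * A) = 0.
  by apply: (As0 _ (t * t)) => // x /sA; rewrite !fctE => ->.
have EgAA : E g (A * A) = 0.
  by apply: (gs0 _ (t * t)) => // x /sA; rewrite !fctE => ->.
have cubE : (A + s) * (A + s) * (A + s) = A * A * A + ((3 * t ^+ 2) *: s + b).
  apply/funext => x; rewrite /b !fctE /GRing.scale /=.
  by have [->|/sA ->] := eqVneq (s x) 0; ring.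
have sqE : (A + s) * (A + s) = A * A + ((2 * t) *: s + g).
  apply/funext => x; rewrite /g !fctE /GRing.scale /=.
  by have [->|/sA ->] := eqVneq (s x) 0; ring.
have [dA ds db dg] : [/\ dom E A, dom E s, dom E b & dom E g].
  by split; [exact: cA.1|exact: cs.1|exact: cb.1|exact: cg.1].
have [dAA dAAA] : dom E (A * A) /\ dom E (A * A * A).
  by split; [exact: cAA.1|exact: cAAA.1].
have d3s : dom E ((3 * t ^+ 2) *: s) by exact: domZ.
have d2s : dom E ((2 * t) *: s) by exact: domZ.
have d3sb := domD d3s db; have d2sg := domD d2s dg.
have Es0 := form_ge0 ds.
have mfs : measurable_fun setT (f \o s).
  rewrite /f /=; apply: measurable_funD; last by do 2 apply: measurable_funM => //.
  by apply: measurable_funM => //; exact: measurable_funM.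
have f0 : f 0 = 0 by rewrite /f; ring.
have h90 : 0 <= 9 * h by rewrite mulr_ge0.
have h20 : 0 <= 2 * h by rewrite mulr_ge0.
(* The difference quotient is 3 t (y + z) + (y^2 + y z + z^2), at most 6 h + 3 h since t and h are
   at most 1. *)
have fL y z : 0 <= y <= h -> 0 <= z <= h -> `|f y - f z| <= 9 * h * `|y - z|.
  move=> /andP[y0 yh] /andP[z0 zh].
  have -> : f y - f z = (3 * t * (y + z) + (y * y + y * z + z * z)) * (y - z).
    by rewrite /f; ring.
  rewrite normrM ler_wpM2r // ger0_norm; last by rewrite !(addr_ge0, mulr_ge0).
  have : t * (y + z) <= 1 * (h + h) by rewrite ler_pM ?addr_ge0 // lerD.
  have : y * y <= h * 1 by rewrite ler_pM // (le_trans yh).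
  have : y * z <= h * 1 by rewrite ler_pM // (le_trans zh).
  have : z * z <= h * 1 by rewrite ler_pM // (le_trans zh).
  lra.
have [_ Eb] := form_lipschitz ds h90 f0 sh mfs fL.
have gL (y z : R) : 0 <= y <= h -> 0 <= z <= h -> `|y * y - z * z| <= 2 * h * `|y - z|.
  move=> /andP[y0 yh] /andP[z0 zh].
  have -> : y * y - z * z = (y + z) * (y - z) by ring.
  by rewrite normrM ler_wpM2r // ger0_norm ?addr_ge0 //; lra.
have mgs : measurable_fun setT ((fun y => y * y) \o s) by exact: measurable_funM.
have [_ Eg] := form_lipschitz (f := fun y => y * y) ds h20 (mulr0 (0 : R)) sh mgs gL.
have Ebs : `|E b s| <= 9 * h * E s s.
  exact: form_CS_le.
have Egs : `|E g s| <= 2 * h * E s s.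
  exact: form_CS_le.
split; last by rewrite dformDD // (form_sym dA ds) EsA mulr0 addr0.
have -> : quartic_defect (A + s) - quartic_defect A =
    4 * E b s - 12 * t * E g s - 3 * E g g.
  rewrite /quartic_defect cubE sqE dformDD //.
  rewrite (dformDl dAAA d3sb (domD dA ds)) !(dformDr dA ds) //.
  rewrite (form_sym dAAA ds) EsAAA (dformDl d3s db) // (dformDl d3s db) //.
  rewrite EbA !dformZl // EsA (form_sym dAA d2sg) (dformDl d2s dg) // EgAA.
  rewrite dformZl // EsAA dformDD // dformZl // dformZl // dformZr //.
  by rewrite (form_sym ds dg); ring.
have := form_ge0 dg => Eg0.
have h2 : (2 * h) ^+ 2 * E s s <= 4 * h * E s s.
  rewrite ler_wpM2r //; nra.
have h3 : t * `|E g s| <= 1 * (2 * h * E s s).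
  by rewrite ler_pM.
have := ler_norm (E b s); have := ler_norm (- E b s); rewrite normrN.
have : - (t * `|E g s|) <= t * E g s <= t * `|E g s|.
  by rewrite -mulrN !ler_wpM2l // ?ler_norm // lerNl -normrN ler_norm.
move=> /andP[? ?] ? ?; rewrite ler_norml; apply/andP; split; lra.
Qed.

(** Cut the range into cells of height h = 1/(n+1). The energies of the successive slices add up to
    E(a, a), so the accumulated error is at most 72 h E(a, a), which tends to 0. *)
Lemma quartic_defect_unit a : core E a -> (forall x, 0 <= a x <= 1) ->
  quartic_defect a = 0.
Proof.
move=> ca a1.
have H n : `|quartic_defect a| <= 72 * n.+1%:R^-1 * E a a.
  set h := (n.+1%:R^-1 : R); have h0 : 0 <= h by rewrite invr_ge0.
  have h1 : h <= 1 by rewrite invf_le1 ?ler1n.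
  have nh : n.+1%:R * h = 1 by rewrite mulfV.
  pose A k := clip (k%:R * h) a.
  have kh0 k : 0 <= k%:R * h by rewrite mulr_ge0.
  have cA k : core E (A k) by exact: core_clip.
  have -> : a = A n.+1 by apply/funext => x; rewrite /A nh clip_id.
  suff : forall k, (k <= n.+1)%N ->
      `|quartic_defect (A k)| <= 72 * h * E (A k) (A k) by exact.
  elim=> [_|k IH kn].
    have -> : A 0%N = 0 by rewrite /A mul0r clip0.
    have d0 : dom E (0 : X -> R) := dom0 E.
    by rewrite /quartic_defect !mul0r !dform0l // !mulr0 subr0 normr0.
  have {}IH := IH (ltnW kn).
  have kkh : k%:R * h <= k.+1%:R * h by rewrite ler_wpM2r // ler_nat.
  have -> : A k.+1 = A k + (A k.+1 - A k) by rewrite addrC subrK.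
  have cs : core E (A k.+1 - A k) by exact: coreB.
  have tb : 0 <= k%:R * h <= 1 by rewrite kh0 /= -[leRHS]nh ler_wpM2r // ler_nat ltnW.
  have hb : 0 <= h <= 1 by rewrite h0.
  have sb x : 0 <= (A k.+1 - A k) x <= h.
    have := clip_sub_bound a x (kh0 k) kkh.
    by rewrite -mulrBl -natrB // subSnn mul1r.
  have sA x : (A k.+1 - A k) x != 0 -> A k x = k%:R * h.
    by move=> /(clip_sub_eq0 (kh0 k) kkh) ka; rewrite /A clip_eq_bound // ltW.
  have [h2 ->] := quartic_defect_step (cA k) cs tb hb sb sA; rewrite mulrDr.
  have := ler_normD (quartic_defect (A k)) (quartic_defect (A k + (A k.+1 - A k)) - quartic_defect (A k)).
  rewrite [X in `|X| <= _]addrC subrK; lra.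
apply/eqP; rewrite -normr_eq0 eq_le normr_ge0 andbT.
apply/ler_addgt0Pl => e e0; rewrite addr0.
have K0 : 0 < 72 * (E a a + 1) by rewrite mulr_gt0 // ltr_wpDl ?form_ge0 //; exact: ca.1.
have [N /(_ N (leqnn N))] := natinv_lt (divr_gt0 e0 K0).
have := H N; have := form_ge0 ca.1; have : 0 < N.+1%:R^-1 :> R by rewrite invr_gt0.
move: (N.+1%:R^-1) => y y0 Ea0 Hy; rewrite ltr_pdivlMr // => ye.
by apply: le_trans Hy _; lra.
Qed.

Lemma quartic_defectZ k u : bounded_dom E u ->
  quartic_defect (k *: u) = k ^+ 4 * quartic_defect u.
Proof.
move=> bu; have bu2 := bd_mul bu bu; have bu3 := bd_mul bu2 bu.
rewrite /quartic_defect.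
have -> : (k *: u) * (k *: u) = k ^+ 2 *: (u * u).
  by apply/funext => x; rewrite !fctE /GRing.scale /=; ring.
have -> : k ^+ 2 *: (u * u) * (k *: u) = k ^+ 3 *: (u * u * u).
  by apply/funext => x; rewrite !fctE /GRing.scale /=; ring.
rewrite (dformZl _ bu3.1 (domZ _ bu.1)) (dformZr _ bu.1 bu3.1).
by rewrite (dformZl _ bu2.1 (domZ _ bu2.1)) (dformZr _ bu2.1 bu2.1); ring.
Qed.

(** Homogeneity of degree 4 removes the bound 1. The positive and negative parts are handled
    separately, since locality makes E vanish between powers of one and powers of the other. *)
Lemma quartic_defect_core u : core E u -> quartic_defect u = 0.
Proof.
move=> cu; have bu := core_bd cu; have [du [M0 uM0]] := bu.
set M := Num.max M0 1.
have M0' : 0 < M by rewrite lt_max ltr01 orbT.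
have uM x : `|u x| <= M by rewrite le_max uM0.
have pos v : core E v -> (forall x, 0 <= v x <= M) -> quartic_defect v = 0.
  move=> cv vM; have -> : v = M *: (M^-1 *: v) by rewrite scalerA mulfV ?gt_eqF // scale1r.
  rewrite quartic_defectZ; last exact/core_bd/coreZ.
  rewrite quartic_defect_unit ?mulr0 //; first exact: coreZ.
  move=> x; rewrite !fctE /GRing.scale /=; have /andP[v0 v1] := vM x.
  by rewrite mulr_ge0 ?invr_ge0 ?(ltW M0') //= mulrC ler_pdivrMr // mul1r.
set p := clip M u; set n := clip M (- u).
have cp : core E p by apply: core_clip => //; exact: ltW.
have cn : core E n by apply: core_clip; [exact: ltW|exact: coreN].
have pM x : 0 <= p x <= M by rewrite clip_ge0 ?clip_le ?ltW.
have nM x : 0 <= n x <= M by rewrite clip_ge0 ?clip_le ?ltW.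
have pn x : p x != 0 -> n x = 0.
  move=> px; apply: clip_eq0; first exact: ltW.
  by rewrite oppr_le0 ltW //; apply: (clip_sub_eq0 (lexx _) (ltW M0')); rewrite clip0 subr0.
have uE : u = p - n by exact: clip_posneg.
have cpp := coreM cp cp; have cppp := coreM cpp cp.
have cnn := coreM cn cn; have cnnn := coreM cnn cn.
have p0 (f : X -> R) (g : X -> R) : core E f -> core E g ->
    (forall x, p x = 0 -> f x = 0) -> (forall x, n x = 0 -> g x = 0) -> E f g = 0.
  move=> cf cg fp gn; apply: (core_local E_loc cf cg (c := 0)) => x fx.
  by apply/gn/pn; apply: contra_neq fx => /fp.
have Epn3 : E (p * p * p) n = 0.
  by apply: p0 => // x px; rewrite !fctE px mulr0.
have En3p : E p (n * n * n) = 0.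
  by apply: p0 => // x nx; rewrite !fctE nx mulr0.
have Epn2 : E (p * p) (n * n) = 0.
  by apply: p0 => // x px; rewrite !fctE px mulr0.
have e2 : u * u = p * p + n * n.
  apply/funext => x; rewrite uE !fctE.
  by have [->|/pn ->] := eqVneq (p x) 0; ring.
have e3 : u * u * u = p * p * p - n * n * n.
  apply/funext => x; rewrite uE !fctE.
  by have [->|/pn ->] := eqVneq (p x) 0; ring.
have := pos _ cp pM; have := pos _ cn nM; rewrite /quartic_defect e3 e2.
rewrite (dformDD cpp.1 cnn.1) Epn2 (dformBl cppp.1 cnnn.1 du) uE.
rewrite !(dformBr cp.1 cn.1 _) ?Epn3; [|exact: cnnn.1|exact: cppp.1].
rewrite (form_sym cnnn.1 cp.1) En3p; lra.
Qed.

End CoreCubic.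

(** The exceptional null set of [Gamma_amgm] depends on the parameter, so only countably many
    parameters can be used at one point; rational ones suffice for the discriminant inequality. *)
Lemma rat_discriminant (R : realType) (a b g : R) : 0 <= a -> 0 <= b ->
  (forall q : rat, 2 * ratr q * g <= (ratr q) ^+ 2 * a + b) -> g ^+ 2 <= a * b.
Proof.
move=> a0 b0 H; apply/ler_addgt0Pl => e e0.
have bp : 0 < b + 1 by rewrite ltr_wpDl.
(* Replacing [a] by c = a + f makes the optimal parameter g / c meaningful even when a = 0, at a
   cost b f <= e/2. Approximating g / c by a rational costs at most n <= e/2. *)
set f := e / (b + 1) / 2; have f0 : 0 < f by rewrite !divr_gt0.
have bf : b * f <= e / 2.
  rewrite /f (_ : b * _ = e / 2 * (b / (b + 1))); last by field; rewrite gt_eqF.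
  by rewrite ler_piMr ?divr_ge0 ?(ltW e0) // ler_pdivrMr // mul1r lerDl.
clearbody f; set c := a + f; have c0 : 0 < c by rewrite ltr_wpDl.
set n := Num.min 1 (e / 2).
have n0 : 0 < n by rewrite lt_min ltr01 divr_gt0.
have n1 : n <= 1 by rewrite ge_min lexx.
have ne : n <= e / 2 by rewrite ge_min lexx orbT.
clearbody n.
have /rat_in_itvoo[q] : g / c < (g + n) / c by rewrite ltr_pM2r ?invr_gt0 // ltrDl.
rewrite in_itv /= ltr_pdivrMr // ltr_pdivlMr // => /andP[q1 q2].
have Hc : 2 * ratr q * g * c <= ((ratr q) ^+ 2 * a + b) * c by rewrite ler_wpM2r ?(ltW c0) //.
have : 0 <= (ratr q) ^+ 2 * f * c.
  by apply: mulr_ge0; [apply: mulr_ge0; [exact: sqr_ge0|exact: ltW]|exact: ltW].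
have : (ratr q * c - g) ^+ 2 <= n * 1.
  rewrite expr2 ler_pM //; lra.
have : c = a + f by [].
move: (ratr q) q1 q2 Hc => t q1 q2 Hc cE h1 h2.
have h3 : t ^+ 2 * a * c = t ^+ 2 * c * c - t ^+ 2 * f * c by rewrite cE; ring.
have h4 : b * c = a * b + b * f by rewrite cE; ring.
lra.
Qed.

Section Leibniz.
Context {R : realType} {d : measure_display} {X : borelMetricType R d}.
Context {m : {finite_measure set X -> \bar R}} (E : dirichlet_form m).
Variable Gamma : (X -> R) -> (X -> R) -> X -> R.
Hypothesis E_reg : regular E.
Hypothesis E_loc : strongly_local E.
Hypothesis G_cdc : carre_du_champ E Gamma.

Local Notation L1 f := (m.-integrable setT (EFin \o f)).
Local Notation bd := (@bounded_dom R d X m E).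

Lemma Gamma_L1 u v : dom E u -> dom E v -> L1 (Gamma u v).
Proof. by move=> du dv; apply/Lfun1_integrable; exact: cdc_L1 G_cdc _ _ du dv. Qed.

Lemma Gamma_meas u v : dom E u -> dom E v -> measurable_fun setT (Gamma u v).
Proof. by move=> du dv; apply: integrable_measurable (Gamma_L1 du dv). Qed.

Lemma Gamma_sym u v : dom E u -> dom E v ->
  \forall x \ae m, Gamma u v x = Gamma v u x.
Proof. by move=> du dv; have /ae_eqTP := cdc_sym G_cdc du dv. Qed.

Lemma GammaDl u v w : dom E u -> dom E v -> dom E w ->
  \forall x \ae m, Gamma (u + v) w x = Gamma u w x + Gamma v w x.
Proof.
move=> du dv dw; have /ae_eqTP := cdc_linear G_cdc 1 du dv dw.
have -> : (1 \*: u \+ v)%R = u + v by apply/funext => x; rewrite /= scale1r.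
by apply: filterS => x ->; rewrite /= scale1r.
Qed.

Lemma GammaZl a u w : dom E u -> dom E w ->
  \forall x \ae m, Gamma (a *: u) w x = a * Gamma u w x.
Proof.
move=> du dw; have d0 := dom0 E.
have /ae_eqTP h0 := cdc_linear G_cdc 1 d0 d0 dw.
have e0 : (1 \*: cst 0 \+ cst 0)%R = cst 0 :> (X -> R).
  by apply/funext => x; rewrite /= scale1r addr0.
rewrite {}e0 in h0.
have /ae_eqTP := cdc_linear G_cdc a du d0 dw.
have -> : (a \*: u \+ cst 0)%R = a *: u by apply/funext => x; rewrite /= addr0.
apply: filterS2 h0 => x /= h0 ->; move: h0; rewrite scale1r /GRing.scale /=.
lra.
Qed.

Lemma GammaNl u w : dom E u -> dom E w ->
  \forall x \ae m, Gamma (- u) w x = - Gamma u w x.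
Proof.
move=> du dw; have := GammaZl (-1) du dw; rewrite scaleN1r.
by apply: filterS => x ->; rewrite mulN1r.
Qed.

Lemma GammaBl u v w : dom E u -> dom E v -> dom E w ->
  \forall x \ae m, Gamma (u - v) w x = Gamma u w x - Gamma v w x.
Proof.
move=> du dv dw; have := GammaDl du (domN dv) dw; have := GammaNl dv dw.
by apply: filterS2 => x -> ->.
Qed.

Lemma GammaDr u v w : dom E u -> dom E v -> dom E w ->
  \forall x \ae m, Gamma w (u + v) x = Gamma w u x + Gamma w v x.
Proof.
move=> du dv dw; have := Gamma_sym dw (domD du dv); have := Gamma_sym dw du.
have := Gamma_sym dw dv; have := GammaDl du dv dw.
by apply: filterS4 => x -> -> -> ->.
Qed.

Lemma GammaZr a u w : dom E u -> dom E w ->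
  \forall x \ae m, Gamma w (a *: u) x = a * Gamma w u x.
Proof.
move=> du dw; have := Gamma_sym dw (domZ a du); have := Gamma_sym dw du.
have := GammaZl a du dw.
by apply: filterS3 => x -> -> ->.
Qed.

Lemma GammaBr u v w : dom E u -> dom E v -> dom E w ->
  \forall x \ae m, Gamma w (u - v) x = Gamma w u x - Gamma w v x.
Proof.
move=> du dv dw; have := Gamma_sym dw (domB du dv); have := Gamma_sym dw du.
have := Gamma_sym dw dv; have := GammaBl du dv dw.
by apply: filterS4 => x -> -> -> ->.
Qed.

Lemma GammaDD u v : dom E u -> dom E v ->
  \forall x \ae m, Gamma (u + v) (u + v) x = Gamma u u x + 2 * Gamma u v x + Gamma v v x.
Proof.
move=> du dv; have dw := domD du dv.
have := GammaDl du dv dw; have := GammaDr du dv du; have := GammaDr du dv dv.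
have := Gamma_sym du dv.
by apply: filterS4 => x h1 -> -> ->; rewrite h1; ring.
Qed.

Lemma Gamma_amgm u v : dom E u -> dom E v ->
  forall t, \forall x \ae m, 2 * t * Gamma u v x <= t ^+ 2 * Gamma u u x + Gamma v v x.
Proof.
move=> du dv t; have dtu := domZ (- t) du.
have := GammaDD dtu dv; have := GammaZl (- t) du dv; have := GammaZl (- t) du dtu.
have := GammaZr (- t) du du; have := cdc_ge0 G_cdc (domD dtu dv).
move=> h1 h2 h3 h4 h5; near=> x.
have : 0 <= Gamma (- t *: u + v) (- t *: u + v) x by near: x.
have -> : Gamma (- t *: u + v) (- t *: u + v) x = Gamma (- t *: u) (- t *: u) x +
  2 * Gamma (- t *: u) v x + Gamma v v x by near: x.
have -> : Gamma (- t *: u) v x = - t * Gamma u v x by near: x.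
have -> : Gamma (- t *: u) (- t *: u) x = - t * Gamma u (- t *: u) x by near: x.
have -> : Gamma u (- t *: u) x = - t * Gamma u u x by near: x.
lra.
Unshelve. all: by end_near.
Qed.

Lemma Gamma_CS u v : dom E u -> dom E v ->
  \forall x \ae m, `|Gamma u v x| <= Num.sqrt (Gamma u u x) * Num.sqrt (Gamma v v x).
Proof.
move=> du dv.
(* Decoding naturals as rationals turns the family of a.e. statements into a sequence, to which
   countable intersection applies. *)
have H : \forall x \ae m, forall n : nat,
    if (unpickle n : option rat) is Some q
    then 2 * ratr q * Gamma u v x <= (ratr q) ^+ 2 * Gamma u u x + Gamma v v x else true.
  apply: ae_foralln => n; case: (unpickle n) => [q|]; last exact: nearW.
  exact: Gamma_amgm.
apply: filterS3 H (cdc_ge0 G_cdc du) (cdc_ge0 G_cdc dv) => x H u0 v0.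
rewrite -sqrtrM // -sqrtr_sqr ler_sqrt ?mulr_ge0 //; apply: rat_discriminant => // q.
by have := H (pickle q); rewrite pickleK.
Qed.

Definition gint (f u v : X -> R) : R := \int[m]_x (f x * Gamma u v x).

Lemma gint_L1 f u v : bd f -> dom E u -> dom E v -> L1 (fun x => f x * Gamma u v x).
Proof.
move=> [df [M fM]] du dv.
by apply: integrableM_bounded (dom_meas df) fM (Gamma_L1 du dv).
Qed.

Lemma gint_ae f u v (h : X -> R) : bd f -> dom E u -> dom E v ->
  measurable_fun setT h -> (\forall x \ae m, Gamma u v x = h x) ->
  gint f u v = \int[m]_x (f x * h x).
Proof.
move=> [df _] du dv mh H; apply: Rintegral_ae_eq.
- by apply: measurable_funM; [exact: dom_meas df|exact: Gamma_meas].
- by apply: measurable_funM => //; exact: dom_meas df.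
by apply: filterS H => x ->.
Qed.

Lemma gint_sym f u v : bd f -> dom E u -> dom E v -> gint f u v = gint f v u.
Proof.
move=> bf du dv; rewrite (gint_ae bf du dv (Gamma_meas dv du)) //.
exact: Gamma_sym.
Qed.

Lemma gintD f g u v : bd f -> bd g -> dom E u -> dom E v ->
  gint (f + g) u v = gint f u v + gint g u v.
Proof.
move=> bf bg du dv; rewrite /gint -RintegralD //; [|exact: gint_L1..].
by apply: eq_Rintegral => x _; rewrite fctE mulrDl.
Qed.

Lemma gintDl f u v w : bd f -> dom E u -> dom E v -> dom E w ->
  gint f (u + v) w = gint f u w + gint f v w.
Proof.
move=> bf du dv dw.
rewrite (gint_ae bf (domD du dv) dw _ (GammaDl du dv dw)); last first.
  by apply: measurable_funD; exact: Gamma_meas.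
rewrite /gint -RintegralD //; [|exact: gint_L1..].
by apply: eq_Rintegral => x _; rewrite mulrDr.
Qed.

Lemma gintDr f u v w : bd f -> dom E u -> dom E v -> dom E w ->
  gint f w (u + v) = gint f w u + gint f w v.
Proof.
move=> bf du dv dw; rewrite gint_sym ?gintDl ?(gint_sym _ dw) //; exact: domD.
Qed.

Lemma form_gint u v : dom E u -> dom E v -> E u v = 2^-1 * \int[m]_x Gamma u v x.
Proof. exact: cdc_energy G_cdc E_loc u v. Qed.

(* Adding the identity defining Gamma to the one where f and v are exchanged
   leaves only the terms with E(vf, u). *)
Lemma form_mul u v f : bd u -> bd v -> bd f ->
  2 * E (v * f) u = gint f u v + gint v u f.
Proof.
move=> bu bv bf; have [bu' bv' bf'] := And3 (bd_bdom bu) (bd_bdom bv) (bd_bdom bf).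
have h1 : E (u * f) v + E (v * f) u - E (u * v) f = gint f u v.
  exact: cdc_form G_cdc u v f bu' bv' bf'.
have h2 : E (u * v) f + E (f * v) u - E (u * f) v = gint v u f.
  exact: cdc_form G_cdc u f v bu' bf' bv'.
by rewrite -h1 -h2 (mulrC f v); ring.
Qed.

(* D a b c e is symmetric in its four arguments, so by polarization it vanishes as
   soon as D a a a a = 3 E(a^2, a^2) - 4 E(a^3, a) does. *)
Definition leibniz_defect a b c e : R :=
  gint c (a * b) e - gint (c * a) b e - gint (c * b) a e.
Local Notation D := leibniz_defect.

(** Expressing the first term through E(abc, e) makes the symmetry in a, b, c visible. *)
Lemma leibniz_defectE a b c e : bd a -> bd b -> bd c -> bd e ->
  D a b c e = 2 * E (a * b * c) e - gint (a * b) c e - gint (c * a) b e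
    - gint (c * b) a e.
Proof.
move=> ba bb bc be; have bab := bd_mul ba bb.
rewrite /D (form_mul be bab bc) (gint_sym bc be.1 bab.1) (gint_sym bab be.1 bc.1).
ring.
Qed.

Lemma leibniz_defectC12 a b c e : D a b c e = D b a c e.
Proof. by rewrite /D (mulrC a b); ring. Qed.

Lemma leibniz_defectC23 a b c e : bd a -> bd b -> bd c -> bd e ->
  D a b c e = D a c b e.
Proof.
move=> ba bb bc be; rewrite !leibniz_defectE // (mulrAC a c b) (mulrC c b).
by rewrite (mulrC c a) (mulrC b a); ring.
Qed.

(** Both sides are 2 E(ab, ec), expanded by [form_mul] in its two possible ways, minus the same four
    integrals. *)
Lemma leibniz_defect_mul a b c e : bd a -> bd b -> bd c -> bd e ->
  D e c a b + D e c b a = D a b e c + D a b c e.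
Proof.
move=> ba bb bc be; have bab := bd_mul ba bb; have bec := bd_mul be bc.
have := form_mul bec ba bb; have := form_mul bab be bc.
rewrite (form_sym bab.1 bec.1) => -> H; rewrite /D.
move: H; rewrite (gint_sym bb bec.1 ba.1) (gint_sym ba bec.1 bb.1).
rewrite (gint_sym (bd_mul ba be) bc.1 bb.1) (gint_sym (bd_mul ba bc) be.1 bb.1).
rewrite (gint_sym (bd_mul bb be) bc.1 ba.1) (gint_sym (bd_mul bb bc) be.1 ba.1).
by rewrite (mulrC a e) (mulrC a c) (mulrC b e) (mulrC b c); lra.
Qed.

(** As the first three arguments commute, D only depends on which argument comes last; let x_a, x_b,
    x_c, x_e be its values. Two instances of [leibniz_defect_mul] read x_b + x_c = x_a + x_e and x_a
    + x_c = x_b + x_e, and their sum is x_c = x_e. *)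
Lemma leibniz_defectC34 a b c e : bd a -> bd b -> bd c -> bd e ->
  D a b c e = D a b e c.
Proof.
move=> ba bb bc be.
have := leibniz_defect_mul bc bb ba be; have := leibniz_defect_mul bc ba bb be.
have -> : D e b c a = D c b e a.
  by rewrite leibniz_defectC12 leibniz_defectC23 // leibniz_defectC12.
have -> : D e b a c = D a b e c.
  by rewrite leibniz_defectC12 leibniz_defectC23 // leibniz_defectC12.
have -> : D e a c b = D c a e b.
  by rewrite leibniz_defectC12 leibniz_defectC23 // leibniz_defectC12.
have -> : D e a b c = D a b e c by rewrite leibniz_defectC12 leibniz_defectC23.
have -> : D c a b e = D a b c e by rewrite leibniz_defectC12 leibniz_defectC23.
have -> : D c b a e = D a b c e.
  by rewrite leibniz_defectC12 leibniz_defectC23 // leibniz_defectC12.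
lra.
Qed.

Lemma leibniz_defectD1 a a' b c e : bd a -> bd a' -> bd b -> bd c -> dom E e ->
  D (a + a') b c e = D a b c e + D a' b c e.
Proof.
move=> ba ba' bb bc de; rewrite /D mulrDl mulrDr.
rewrite (gintDl bc (bd_mul ba bb).1 (bd_mul ba' bb).1 de).
rewrite (gintD (bd_mul bc ba) (bd_mul bc ba') bb.1 de).
by rewrite (gintDl (bd_mul bc bb) ba.1 ba'.1 de); ring.
Qed.

Lemma leibniz_defectD4 a b c e e' : bd a -> bd b -> bd c -> dom E e -> dom E e' ->
  D a b c (e + e') = D a b c e + D a b c e'.
Proof.
move=> ba bb bc de de'; rewrite /D.
rewrite (gintDr bc de de' (bd_mul ba bb).1) (gintDr (bd_mul bc ba) de de' bb.1).
by rewrite (gintDr (bd_mul bc bb) de de' ba.1); ring.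
Qed.

Lemma leibniz_defectN4 a b c e : bd a -> bd b -> bd c -> dom E e ->
  D a b c (- e) = - D a b c e.
Proof.
move=> ba bb bc de; have d0 : dom E (0 : X -> R) := dom0 E.
have D0 : D a b c 0 = 0 by have := leibniz_defectD4 ba bb bc d0 d0; rewrite addr0; lra.
by have := leibniz_defectD4 ba bb bc de (domN de); rewrite subrr D0; lra.
Qed.

Lemma leibniz_defect_diag a : bd a -> D a a a a = - quartic_defect E a.
Proof.
move=> ba; have baa := bd_mul ba ba; rewrite /D /quartic_defect.
have := form_mul ba baa ba; have := form_mul baa ba ba.
rewrite (gint_sym ba baa.1 ba.1); lra.
Qed.

(** In the sum of the expansions of D at a + b and at a - b on the diagonal the odd terms cancel,
    and the pure terms a, a, a, a and b, b, b, b vanish; 12 D a a b b is left. *)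
Lemma leibniz_defect_core_pair a b : core E a -> core E b -> D a a b b = 0.
Proof.
move=> ca cb; have ba := core_bd ca; have bb := core_bd cb.
have D0 u : core E u -> D u u u u = 0.
  by move=> cu; rewrite leibniz_defect_diag ?(quartic_defect_core E_loc cu) ?oppr0 //; exact: core_bd.
have add2 x y z u v : bd x -> bd y -> bd z -> bd u -> bd v ->
    D x (y + z) u v = D x y u v + D x z u v.
  move=> bx by_ bz bu bv; rewrite leibniz_defectC12.
  by rewrite (leibniz_defectD1 by_ bz bx bu bv.1) (leibniz_defectC12 y) (leibniz_defectC12 z).
have add3 x y z u v : bd x -> bd y -> bd z -> bd u -> bd v ->
    D x u (y + z) v = D x u y v + D x u z v.
  move=> bx by_ bz bu bv; rewrite leibniz_defectC23 //; last exact: bdD.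
  by rewrite add2 // !(@leibniz_defectC23 x u) //; exact: bdD.
have exp u : bd u -> D (a + u) (a + u) (a + u) (a + u) =
    D a a a a + 4 * D a a a u + 6 * D a a u u + 4 * D a u u u + D u u u u.
  move=> bu; have bau := bdD ba bu.
  have s12 := leibniz_defectC12; have s23 := leibniz_defectC23; have s34 := leibniz_defectC34.
  rewrite (leibniz_defectD1 ba bu bau bau bau.1) !add2 // !add3 //.
  have da := ba.1; have du := bu.1; rewrite !leibniz_defectD4 //.
  have e1 : D a a u a = D a a a u by rewrite s34.
  have e2 : D a u a a = D a a a u by rewrite s23.
  have e3 : D u a a a = D a a a u by rewrite s12 e2.
  have f1 : D a u a u = D a a u u by rewrite s23.
  have f2 : D a u u a = D a a u u by rewrite s34.
  have f3 : D u a a u = D a a u u by rewrite s12.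
  have f4 : D u a u a = D a a u u by rewrite s34.
  have f5 : D u u a a = D a a u u by rewrite s23.
  have g1 : D u a u u = D a u u u by rewrite s12.
  have g2 : D u u a u = D a u u u by rewrite s23.
  have g3 : D u u u a = D a u u u by rewrite s34.
  by rewrite e1 e2 e3 f1 f2 f3 f4 f5 g1 g2 g3; ring.
have n4 := leibniz_defectN4; have s34 := leibniz_defectC34.
have da := ba.1; have db := bb.1; have bnb := bdN bb; have dnb := bnb.1.
have e1 : D a a a (- b) = - D a a a b by rewrite n4.
have e2 : D a a (- b) (- b) = D a a b b by rewrite n4 // s34 // n4 // opprK.
have e3 : D a (- b) (- b) (- b) = - D a b b b.
  by rewrite n4 // s34 // n4 // opprK leibniz_defectC23 // s34 // n4.
have := D0 _ (coreD ca cb); have := D0 _ (coreB ca cb).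
rewrite !exp // e1 e2 e3 (D0 _ (coreN cb)) (D0 _ ca) (D0 _ cb); lra.
Qed.

(** Polarization in the last two arguments gives D u u v w = 0; polarization in the first two gives
    the rest. *)
Lemma leibniz_defect_core a b c e : core E a -> core E b -> core E c -> core E e ->
  D a b c e = 0.
Proof.
have s12 := leibniz_defectC12; have s23 := leibniz_defectC23; have s34 := leibniz_defectC34.
have two u v w : core E u -> core E v -> core E w -> D u u v w = 0.
  move=> cu cv cw; have bu := core_bd cu; have bv := core_bd cv; have bw := core_bd cw.
  have := leibniz_defect_core_pair cu (coreD cv cw).
  have bvw := bdD bv bw; have dv := bv.1; have dw := bw.1.
  rewrite leibniz_defectD4 // !(s34 _ _ (v + w)) // !leibniz_defectD4 //.
  rewrite !leibniz_defect_core_pair // (s34 u u w v) //; lra.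
move=> ca cb cc ce; have ba := core_bd ca; have bb := core_bd cb.
have bc := core_bd cc; have be := core_bd ce; have de := be.1.
have bab := bdD ba bb.
have := two _ _ _ (coreD ca cb) cc ce.
rewrite leibniz_defectD1 // (s12 a) (s12 b) !leibniz_defectD1 //.
rewrite !two // (s12 b a); lra.
Qed.

(** Continuity in the energy of the last argument. If M bounds |f|, the pointwise inequality with
    parameter t integrates to M t E(u, u) + (M / t) E(z, z); t makes the first half small, then r
    the second. *)
Lemma gint_small f u e : bd f -> dom E u -> 0 < e -> exists2 r, 0 < r &
  forall z, dom E z -> E z z <= r -> `|gint f u z| <= e.
Proof.
move=> bf du e0; have [df [M0 fM0]] := bf.
pose M := Num.max M0 1; have M1 : 1 <= M by rewrite le_max lexx orbT.
have M_gt0 : 0 < M by rewrite (lt_le_trans ltr01).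
have fM x : `|f x| <= M by rewrite le_max fM0.
have Eu := form_ge0 du.
have [t t0 h1] : exists2 t, 0 < t & M * t * E u u <= e / 2.
  exists (e / (2 * M * (E u u + 1))).
    by rewrite divr_gt0 // !mulr_gt0 // ltr_wpDl.
  rewrite (_ : M * _ * E u u = e / 2 * (E u u / (E u u + 1))); last first.
    by field; rewrite !gt_eqF // ltr_wpDl.
  rewrite ler_piMr ?divr_ge0 ?(ltW e0) // ler_pdivrMr ?ltr_wpDl //; lra.
exists (t * e / (2 * M)); first by apply: divr_gt0; exact: mulr_gt0.
move=> z dz Ez.
have du0 := cdc_ge0 G_cdc du; have dz0 := cdc_ge0 G_cdc dz.
have le : \forall x \ae m, `|f x * Gamma u z x| <=
    M / (2 * t) * (t ^+ 2 * Gamma u u x + Gamma z z x).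
  have := Gamma_amgm du dz t; have := Gamma_amgm du dz (- t).
  apply: filterS2 => x; rewrite sqrrN => H1 H2.
  have hG : `|Gamma u z x| <= (t ^+ 2 * Gamma u u x + Gamma z z x) / (2 * t).
    rewrite ler_pdivlMr ?mulr_gt0 //.
    by case: (ler0P (Gamma u z x)) => _; lra.
  by rewrite normrM mulrAC -mulrA ler_pM.
have L1r : L1 (fun x => M / (2 * t) * (t ^+ 2 * Gamma u u x + Gamma z z x)).
  apply: integrableZ_R; apply: integrableD_R; last exact: Gamma_L1.
  by apply: integrableZ_R; exact: Gamma_L1.
apply: (@le_trans _ _ (\int[m]_x `|f x * Gamma u z x|)).
  by apply: le_normr_Rintegral => //; exact: gint_L1.
apply: (le_trans (Rintegral_ae_le _ L1r le)).
  by have := integrable_norm (gint_L1 bf du dz).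
rewrite RintegralZl //; last first.
  apply: integrableD_R; last exact: Gamma_L1.
  by apply: integrableZ_R; exact: Gamma_L1.
have Gu := Gamma_L1 du du; have Gz := Gamma_L1 dz dz.
have tGu := integrableZ_R (t ^+ 2) Gu.
rewrite RintegralD // RintegralZl //.
have -> : \int[m]_x Gamma u u x = 2 * E u u by rewrite form_gint // mulrA mulfV // mul1r.
have -> : \int[m]_x Gamma z z x = 2 * E z z by rewrite form_gint // mulrA mulfV // mul1r.
have -> : M / (2 * t) * (t ^+ 2 * (2 * E u u) + 2 * E z z) = M * t * E u u + M / t * E z z.
  by field; rewrite gt_eqF.
have h2 : M / t * E z z <= e / 2.
  rewrite (_ : e / 2 = M / t * (t * e / (2 * M))); last first.
    by field; rewrite !gt_eqF.
  by rewrite ler_wpM2l // divr_ge0 // ltW.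
lra.
Qed.

Lemma core_dense u e : dom E u -> 0 < e -> exists2 g, core E g & E (u - g) (u - g) <= e.
Proof.
move=> du e0; have se0 : 0 < Num.sqrt e by rewrite sqrtr_gt0.
have [g [dg cg] ug] := E_reg.2 u du _ se0; exists g; first by split.
move: ug; rewrite /form1_norm ler_psqrt ?nnegrE ?(ltW e0) //; last first.
  by rewrite addr_ge0 ?form_ge0 ?Rintegral_ge0 //; [exact: domB|move=> x _; exact: sqr_ge0].
by apply: le_trans; rewrite lerDl; exact: (sqn_ge0 (u - g)).
Qed.

(** Only the last slot is extended by density, as D involves just Gamma there. The first three slots
    also enter as multipliers and have to stay bounded. *)
Lemma leibniz_defect_ext a b c e : bd a -> bd b -> bd c -> dom E e ->
  (forall g, core E g -> D a b c g = 0) -> D a b c e = 0.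
Proof.
move=> ba bb bc de H.
apply/eqP; rewrite -normr_eq0 eq_le normr_ge0 andbT.
apply/ler_addgt0Pl => eps eps0; rewrite addr0.
have eps3 : 0 < eps / 3 by rewrite divr_gt0.
have [r1 r10 H1] := gint_small bc (bd_mul ba bb).1 eps3.
have [r2 r20 H2] := gint_small (bd_mul bc ba) bb.1 eps3.
have [r3 r30 H3] := gint_small (bd_mul bc bb) ba.1 eps3.
pose r := Num.min r1 (Num.min r2 r3).
have r0 : 0 < r by rewrite !lt_min r10 r20.
have [g cg Eg] := core_dense de r0; have [dg _] := cg.
have deg := domB de dg.
have -> : D a b c e = D a b c (e - g).
  have dng := domN dg.
  by rewrite leibniz_defectD4 // leibniz_defectN4 // (H g cg) oppr0 addr0.
move: Eg; rewrite !le_min => /and3P[E1 E2 E3].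
have := H1 _ deg E1; have := H2 _ deg E2; have := H3 _ deg E3; rewrite /D.
rewrite !ler_norml => /andP[? ?] /andP[? ?] /andP[? ?].
by apply/andP; split; lra.
Qed.

(** The arguments leave the core one at a time: by symmetry the one to be extended is moved to the
    last slot. *)
Lemma leibniz_defect_eq0 a b c e : bd a -> bd b -> bd c -> dom E e -> D a b c e = 0.
Proof.
have s12 := leibniz_defectC12; have s23 := leibniz_defectC23; have s34 := leibniz_defectC34.
have h1 u v w z : core E u -> core E v -> core E w -> dom E z -> D u v w z = 0.
  move=> cu cv cw dz; apply: leibniz_defect_ext => //; [exact: core_bd..|].
  by move=> g cg; exact: leibniz_defect_core.
have h2 u v w z : core E u -> core E v -> bd w -> dom E z -> D u v w z = 0.
  move=> cu cv bw dz; have bu := core_bd cu; have bv := core_bd cv.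
  apply: leibniz_defect_ext => // g cg.
  by have bg := core_bd cg; rewrite s34 // h1 //; exact: bw.1.
have h3 u v w z : core E u -> bd v -> bd w -> dom E z -> D u v w z = 0.
  move=> cu bv bw dz; have bu := core_bd cu.
  apply: leibniz_defect_ext => // g cg; have bg := core_bd cg.
  by rewrite s34 // s23 // h2 //; exact: bw.1.
move=> ba bb bc de; apply: leibniz_defect_ext => // g cg; have bg := core_bd cg.
by rewrite s34 // s23 // s12 h3 //; exact: bc.1.
Qed.

End Leibniz.

(** * Bounded functions of the domain separate integrable functions *)

Section Density.
Context {R : realType} {d : measure_display} {X : borelMetricType R d}.
Context {m : {finite_measure set X -> \bar R}} (E : dirichlet_form m).

Local Notation L1 f := (m.-integrable setT (EFin \o f)).
Local Notation bd := (@bounded_dom R d X m E).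

Lemma bounded_L2 (f : X -> R) M : measurable_fun setT f -> (forall x, `|f x| <= M) ->
  L2 (m := m) f.
Proof.
move=> mf fM; split => //; apply: (@integrable_bounded _ _ _ _ _ (M ^+ 2)).
  exact: measurable_funX.
by move=> x; rewrite normrX lerXn2r ?nnegrE // (le_trans _ (fM x)).
Qed.

Lemma dom_dense_sqn (f : X -> R) e : L2 (m := m) f -> 0 < e ->
  exists2 u, dom E u & sqn (m := m) (f - u) <= e.
Proof.
move=> f2 e0; have se0 : 0 < Num.sqrt e by rewrite sqrtr_gt0.
have f2' : f \in Lfun m 2%:E by apply/Lfun2P.
have [u du fu] := dom_dense E f2' se0; exists u => //.
have [mfu ifu] := L2B f2 (dom_L2' du).
have : ('N[m]_2%:E[EFin \o (f - u)%R] `^ 2 <= e%:E)%E.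
  have -> : e%:E = ((Num.sqrt e)%:E `^ 2)%E.
    by rewrite poweR_EFin powR_mulrn ?sqrtr_ge0 // sqr_sqrtr // ltW.
  apply: gt0_ler_poweR => //; rewrite ?in_itv /= ?leey ?Lnorm_ge0 ?lee_fin ?andbT //.
  exact: ltW.
rewrite poweR_Lnorm //.
under eq_integral => x _ do rewrite /= powR_mulrn // real_normK ?num_real //.
rewrite -[X in (X <= _)%E]fineK ?lee_fin //; exact: integrable_fin_num.
Qed.

(** The sign f of h is approximated in L^2 by a function of the domain, truncated to [-1, 1]. As h
    is only integrable, L^2 closeness controls the part min(|h|, K), and domination the remainder
    |h| - min(|h|, K). *)
Lemma ae_eq0_of_bd (h : X -> R) : L1 h ->
  (forall c, bd c -> \int[m]_x (c x * h x) = 0) -> \forall x \ae m, h x = 0.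
Proof.
move=> L1h H; have mh := integrable_measurable L1h.
pose f x := \1_(h @^-1` `]0, +oo[) x - \1_(h @^-1` `]-oo, 0[) x : R.
have mf : measurable_fun setT f.
  by apply: measurable_funB; apply: measurable_indic; rewrite -[X in measurable X]setTI; exact: mh.
have f1 x : `|f x| <= 1.
  rewrite /f !indicE.
  by case: (_ \in _); case: (_ \in _); rewrite ?subrr ?subr0 ?sub0r ?normrN ?normr0 ?normr1.
have hA x : (x \in h @^-1` `]0, +oo[) = (0 < h x).
  by apply/idP/idP => [/set_mem|hx]; [|apply/mem_set]; rewrite /= in_itv /= andbT.
have hB x : (x \in h @^-1` `]-oo, 0[) = (h x < 0).
  by apply/idP/idP => [/set_mem|hx]; [|apply/mem_set]; rewrite /= in_itv.
have fh x : f x * h x = `|h x|.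
  rewrite /f !indicE hA hB; have [h0|h0|->] := ltgtP (h x) 0.
  - by rewrite sub0r mulN1r ltr0_norm.
  - by rewrite subr0 mul1r gtr0_norm.
  - by rewrite normr0 mulr0.
have L1a : L1 (fun x => `|h x|) := integrable_norm L1h.
suff h0 : \int[m]_x `|h x| <= 0.
  have n0 : \forall x \ae m, 0 <= `|h x| by apply: nearW.
  have := Rintegral_eq0_ae L1a n0 h0.
  by apply: filterS => x /eqP; rewrite normr_eq0 => /eqP.
apply/ler_addgt0Pl => e e0; rewrite addr0.
(* The four quarters of [e]: two for twice the remainder of h above K, one for s m(X) and one for
   (K^2 / s) r, where z K <= s + (K^2 / s) z^2 separates the two small quantities. *)
have e4 : 0 < e / 4 by rewrite divr_gt0.
have [N HN] : exists N : nat, \int[m]_x `|Num.min `|h x| N%:R - `|h x| | < e / 4.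
  have h1 n : measurable_fun setT (fun x => Num.min `|h x| n%:R).
    by apply: measurable_minr => //; exact: measurableT_comp.
  have h2 : measurable_fun setT (fun x => `|h x|) by exact: measurableT_comp.
  have h3 : \forall x \ae m, Num.min `|h x| n%:R @[n --> \oo] --> `|h x|.
    apply: nearW => x; apply/cvgrPdist_lt => r r0.
    near=> n; rewrite min_l ?subrr ?normr0 //.
    by near: n; apply: nbhs_infty_ger.
  have h4 : \forall x \ae m, forall n : nat, `|Num.min `|h x| n%:R| <= `|h x|.
    by apply: nearW => x n; rewrite ger0_norm; [rewrite ge_min lexx|rewrite le_min normr_ge0 ler0n].
  have [N HN] := Rintegral_dominated h1 h2 h3 L1a h4 e4.
  by exists N; exact: HN.
set mu := fine (m setT).
have mu0 : 0 <= mu by rewrite fine_ge0.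
have [s s0 smu] : exists2 s, 0 < s & s * mu <= e / 4.
  exists (e / 4 / (mu + 1)); first by rewrite divr_gt0 // ltr_wpDl.
  by rewrite mulrAC ler_pdivrMr ?ltr_wpDl // ler_wpM2l ?(ltW e4) // lerDl.
set K := (N%:R : R) in HN *.
have K0 : 0 <= K by [].
have [r r0 rK] : exists2 r, 0 < r & K ^+ 2 / s * r <= e / 4.
  exists (e / 4 / (K ^+ 2 / s + 1)).
    by rewrite divr_gt0 // ltr_wpDl // divr_ge0 ?sqr_ge0 ?ltW.
  rewrite mulrCA ler_piMr ?(ltW e4) // ler_pdivrMr ?mul1r ?lerDl //.
  by rewrite ltr_wpDl // divr_ge0 ?sqr_ge0 ?ltW.
have [u du fu] := dom_dense_sqn (bounded_L2 mf f1) r0.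
set g := clip 1 u - clip 1 (- u).
have bg : bd g.
  by apply: bdB; apply: bd_clip => //; exact: domN.
(* Truncation to [-1, 1] is a contraction that fixes the values of [f]. *)
have fg x : `|f x - g x| <= `|f x - u x|.
  have := f1 x; rewrite ler_norml => /andP[fl fr].
  have [u1|u1] := leP 1 (u x).
    have nu : (- u) x <= 0 by rewrite oppr_le0 (le_trans _ u1).
    rewrite /g !fctE (clip_eq_bound ler01 u1) (clip_eq0 ler01 nu).
    by case: (ler0P (f x - _)); case: (ler0P (f x - u x)); lra.
  have [u0|u0] := leP 0 (u x).
    have nu : (- u) x <= 0 by rewrite oppr_le0.
    have ub : 0 <= u x <= 1 by rewrite u0 ltW.
    by rewrite /g !fctE (clip_id ub) (clip_eq0 ler01 nu) subr0.
  rewrite /g !fctE (clip_eq0 ler01 (ltW u0)) sub0r.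
  have [u2|u2] := leP 1 ((- u) x).
    rewrite (clip_eq_bound ler01 u2); move: u2; rewrite fctE => u2.
    by case: (ler0P (f x - _)); case: (ler0P (f x - u x)); lra.
  have ub : 0 <= (- u) x <= 1 by rewrite (ltW u2) oppr_ge0 ltW.
  by rewrite (clip_id ub) fctE opprK.
have mg : measurable_fun setT g := dom_meas bg.1.
have [mfu ifu] := L2B (bounded_L2 mf f1) (dom_L2' du).
have Hle x : `|h x| - g x * h x <= (s + K ^+ 2 / s * (f - u) x ^+ 2) +
    2 * `|Num.min `|h x| K - `|h x| |.
  have -> : `|h x| - g x * h x = (f x - g x) * h x by rewrite -fh; ring.
  apply: le_trans (ler_norm _) _; rewrite normrM.
  have z2 : `|f x - g x| <= 2.
    have := f1 x; have : `|g x| <= 1.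
      have := clip_le 1 u x; have := clip_le 1 (- u) x.
      have := clip_ge0 u x ler01; have := clip_ge0 (- u) x ler01.
      by rewrite /g !fctE ler_norml => *; apply/andP; split; lra.
    by have := ler_normB (f x) (g x); lra.
  have := fg x; have b1 : Num.min `|h x| K <= K by rewrite ge_min lexx orbT.
  have b2 : Num.min `|h x| K <= `|h x| by rewrite ge_min lexx.
  have b0 : 0 <= Num.min `|h x| K by rewrite le_min normr_ge0.
  rewrite [`|Num.min _ _ - _|]distrC (ger0_norm (x := `|h x| - _)) ?subr_ge0 // !fctE.
  rewrite -(real_normK (num_real (f x - u x))).
  have := normr_ge0 (f x - g x); have := normr_ge0 (f x - u x).
  move: (Num.min _ _) b0 b1 b2 z2 => b b0 b1 b2; move: `|h x| b2 => a b2.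
  move: `|f x - g x| `|f x - u x| => y z y2 z0 y0 yz.
  have h1 : y * b <= z * K by rewrite ler_pM.
  have h2 : y * (a - b) <= 2 * (a - b) by rewrite ler_wpM2r // subr_ge0.
  have h3 : z * K <= s + K ^+ 2 / s * z ^+ 2.
    have hs : s * (s + K ^+ 2 / s * z ^+ 2) = s * s + K ^+ 2 * z ^+ 2.
      by field; rewrite gt_eqF.
    rewrite -(ler_pM2l s0) hs.
    have := sqr_ge0 (s - K * z); have := mulr_ge0 (ltW s0) (mulr_ge0 z0 K0); nra.
  lra.
have L1gh : L1 (fun x => g x * h x).
  by have [_ [M gM]] := bg; exact: integrableM_bounded mg gM L1h.
have -> : \int[m]_x `|h x| = \int[m]_x (`|h x| - g x * h x).
  by rewrite RintegralB // (H g bg) subr0.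
have L1c : L1 (cst s) by exact: finite_measure_integrable_cst.
have L1s : L1 (fun x => K ^+ 2 / s * (f - u) x ^+ 2) by exact: integrableZ_R.
have L1d : L1 (fun x => `|Num.min `|h x| K - `|h x| |).
  apply: integrable_norm; apply: integrableB_R => //.
  apply: integrable_ae_le L1a.
    by apply: measurable_minr => //; exact: measurableT_comp.
  by apply: nearW => x; rewrite ger0_norm; [rewrite ge_min lexx|rewrite le_min normr_ge0 ler0n].
apply: le_trans (le_Rintegral measurableT _ _ (fun x _ => Hle x)) _.
- exact: integrableB_R.
- by apply: integrableD_R; [exact: integrableD_R|exact: integrableZ_R].
rewrite RintegralD //; [|exact: integrableD_R|exact: integrableZ_R].
rewrite RintegralD // RintegralZl // RintegralZl // Rintegral_cst //.
have : K ^+ 2 / s * \int[m]_x (f - u) x ^+ 2 <= e / 4.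
  apply: le_trans rK; rewrite ler_wpM2l // divr_ge0 ?sqr_ge0 // ltW //.
rewrite -/mu; lra.
Unshelve. all: by end_near.
Qed.

End Density.

(** * Locality and calculus of Gamma *)

Section GammaLocality.
Context {R : realType} {d : measure_display} {X : borelMetricType R d}.
Context {m : {finite_measure set X -> \bar R}} (E : dirichlet_form m).
Variable Gamma : (X -> R) -> (X -> R) -> X -> R.
Hypothesis E_reg : regular E.
Hypothesis E_loc : strongly_local E.
Hypothesis G_cdc : carre_du_champ E Gamma.

Local Notation L1 f := (m.-integrable setT (EFin \o f)).
Local Notation bd := (@bounded_dom R d X m E).

(** The integral of the pointwise defect against any bounded [c] of the domain is
    [leibniz_defect a b c e], which is 0. *)
Lemma Gamma_leibniz a b e : bd a -> bd b -> dom E e ->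
  \forall x \ae m, Gamma (a * b) e x = a x * Gamma b e x + b x * Gamma a e x.
Proof.
move=> ba bb de; have bab := bd_mul ba bb.
pose h x := Gamma (a * b) e x - a x * Gamma b e x - b x * Gamma a e x.
have L1ab : L1 (Gamma (a * b) e) := Gamma_L1 G_cdc bab.1 de.
have L1b := gint_L1 G_cdc ba bb.1 de; have L1a := gint_L1 G_cdc bb ba.1 de.
have L1h : L1 h by apply: integrableB_R => //; exact: integrableB_R.
have : \forall x \ae m, h x = 0.
  apply: (ae_eq0_of_bd (E := E) L1h) => c bc.
  have := leibniz_defect_eq0 E_reg E_loc G_cdc ba bb bc de.
  rewrite /leibniz_defect /gint => <-.
  have i1 := gint_L1 G_cdc bc bab.1 de.
  have i2 := gint_L1 G_cdc (bd_mul bc ba) bb.1 de.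
  have i3 := gint_L1 G_cdc (bd_mul bc bb) ba.1 de.
  rewrite -RintegralB // -RintegralB //; last exact: integrableB_R.
  by apply: eq_Rintegral => x _; rewrite /h !fctE; ring.
by apply: filterS => x; rewrite /h => h0; lra.
Qed.

Lemma Gamma_add_le u v : dom E u -> dom E v ->
  \forall x \ae m, Gamma (u + v) (u + v) x <= 2 * Gamma u u x + 2 * Gamma v v x.
Proof.
move=> du dv; have := GammaDD G_cdc du dv; have := Gamma_amgm G_cdc du dv 1.
by apply: filterS2 => x h1 ->; lra.
Qed.

Lemma Gamma_null u v : dom E u -> dom E v ->
  \forall x \ae m, Gamma u u x = 0 -> Gamma u v x = 0.
Proof.
move=> du dv; have := Gamma_CS G_cdc du dv; apply: filterS => x + u0.
by rewrite u0 sqrtr0 mul0r normr_le0 => /eqP.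
Qed.

Section UnitFunction.
Variable k : X -> R.
Hypotheses (bk : bd k) (k01 : forall x, 0 <= k x <= 1).

(* saturation n = 1 - (1 - k)^n; its energy density against k is
   n (1 - k)^(n - 1) Gamma k k, so that saturation n / n tends to 0 uniformly with
   bounded energy while its density against k remains Gamma k k on {k = 0}. *)
Fixpoint saturation (n : nat) : X -> R :=
  if n is n'.+1 then saturation n' + (k - k * saturation n') else 0.

Lemma saturationE n x : saturation n x = 1 - (1 - k x) ^+ n.
Proof.
elim: n => [|n IH] /=; first by rewrite expr0 subrr.
by rewrite !fctE IH exprS; ring.
Qed.

Lemma bd_saturation n : bd (saturation n).
Proof.
elim: n => [|n IH] /=; last by apply: bdD => //; apply: bdB => //; exact: bd_mul.
by split; [exact: dom0|exists 0 => x; rewrite normr0].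
Qed.

Lemma Gamma_saturation n v : dom E v -> \forall x \ae m,
  Gamma (saturation n) v x = n%:R * (1 - k x) ^+ n.-1 * Gamma k v x.
Proof.
move=> dv; elim: n => [|n IH].
  have d0 : dom E (0 : X -> R) := dom0 E.
  have := GammaDl G_cdc d0 d0 dv; apply: filterS => x; rewrite addr0 /= => h.
  by rewrite mul0r mul0r; lra.
have bz := bd_saturation n; have bkz := bd_mul bk bz.
have h1 := GammaDl G_cdc bz.1 (domB bk.1 bkz.1) dv.
have h2 := GammaBl G_cdc bk.1 bkz.1 dv.
have h3 := Gamma_leibniz bk bz dv.
apply: filterS4 h1 h2 h3 IH => x /= -> -> -> ->.
rewrite saturationE; case: n {bz bkz} => [|n] /=; first by rewrite expr0; ring.
by rewrite exprS -(natr1 n.+1); ring.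
Qed.

Let y n := n.+1%:R^-1 *: saturation n.+1.

Let by_ n : bd (y n). Proof. exact/bdZ/bd_saturation. Qed.

Let Gamma_y n v : dom E v ->
  \forall x \ae m, Gamma (y n) v x = (1 - k x) ^+ n * Gamma k v x.
Proof.
move=> dv; have := GammaZl G_cdc n.+1%:R^-1 (bd_saturation n.+1).1 dv.
have := Gamma_saturation n.+1 dv.
by apply: filterS2 => x h ->; rewrite h /= !mulrA mulVf ?mul1r.
Qed.

Let y_small n x : `|y n x| <= n.+1%:R^-1.
Proof.
have /andP[k0 k1] := k01 x.
rewrite /y !fctE normrM ger0_norm ?invr_ge0 // ler_piMr ?invr_ge0 //.
rewrite saturationE ger0_norm ?subr_ge0 ?gerBl ?exprn_ge0 ?subr_ge0 //.
by apply: exprn_ile1; rewrite ?subr_ge0 // gerBl.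
Qed.

Let form_y_le n : E (y n) (y n) <= E k k.
Proof.
have dy := (by_ n).1; have dk := bk.1; rewrite !(form_gint E_loc G_cdc) //.
rewrite ler_wpM2l ?invr_ge0 //.
apply: Rintegral_ae_le; [exact: Gamma_L1 (by_ n).1 (by_ n).1|exact: Gamma_L1 bk.1 bk.1|].
have h1 := Gamma_y n (by_ n).1; have h2 := Gamma_y n bk.1.
have h3 := Gamma_sym G_cdc (by_ n).1 bk.1; have h4 := cdc_ge0 G_cdc bk.1.
apply: filterS4 h1 h2 h3 h4 => x -> h2 h3 h4.
have /andP[k0 k1] := k01 x.
have k1n : 0 <= (1 - k x) ^+ n <= 1.
  by rewrite exprn_ge0 ?subr_ge0 //= exprn_ile1 ?subr_ge0 // gerBl.
have /andP[a0 a1] := k1n.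
rewrite -h3 h2 mulrA; rewrite ler_piMl //; exact: mulr_ile1.
Qed.

(** By [form_weak] the energies E(y n, k) tend to 0. Each equals half the integral of (1 - k)^n
    Gamma k k, which is at least half the integral of Gamma k k over {k = 0}. *)
Lemma Gamma_unit_zero : \forall x \ae m, k x = 0 -> Gamma k k x = 0.
Proof.
pose I x := (k x == 0)%:R * Gamma k k x.
have mk := dom_meas bk.1.
have mI : measurable_fun setT (fun x => (k x == 0)%:R : R).
  rewrite (_ : (fun x => _) = \1_(k @^-1` [set 0])).
    by apply: measurable_indic; rewrite -[X in measurable X]setTI; exact: mk.
  apply/funext => x; rewrite indicE; congr ((nat_of_bool _)%:R).
  by apply/idP/idP => [/eqP kx|/set_mem kx]; [exact/mem_set|exact/eqP].
have L1I : L1 I.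
  apply: (integrableM_bounded mI (M := 1)) (Gamma_L1 G_cdc bk.1 bk.1) => x.
  by case: (k x == 0); rewrite ?normr1 ?normr0.
have I0 : \forall x \ae m, 0 <= I x.
  by have := cdc_ge0 G_cdc bk.1; apply: filterS => x h; rewrite mulr_ge0.
suff : \int[m]_x I x <= 0.
  move/(Rintegral_eq0_ae L1I I0); apply: filterS => x; rewrite /I => h kx.
  by move: h; rewrite kx eqxx mul1r.
apply/ler_addgt0Pl => e e0; rewrite addr0.
have e2 : 0 < e / 2 by rewrite divr_gt0.
have [r r0 Hr] := form_weak bk.1 (form_ge0 bk.1) e2.
have [t t0 Ht] := small_sqr (m := m) r0.
have [n /(_ n (leqnn n)) nt] := natinv_lt t0.
have sq : sqn (m := m) (y n) <= r.
  apply: le_trans Ht; apply: sqn_bounded; first exact: dom_meas (by_ n).1.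
    exact: ltW.
  by move=> x; apply: le_trans (y_small n x) (ltW nt).
have := Hr _ (by_ n).1 (form_y_le n) sq.
rewrite (form_gint E_loc G_cdc (by_ n).1 bk.1) => /(le_trans (ler_norm _)) H.
suff : \int[m]_x I x <= \int[m]_x Gamma (y n) k x by lra.
apply: Rintegral_ae_le L1I (Gamma_L1 G_cdc (by_ n).1 bk.1) _.
have h1 := Gamma_y n bk.1; have h2 := cdc_ge0 G_cdc bk.1.
apply: filterS2 h1 h2 => x -> h2; rewrite /I.
have /andP[k0 k1] := k01 x.
have [->|kx] := eqVneq (k x) 0; first by rewrite subr0 expr1n.
by rewrite mul0r mulr_ge0 // exprn_ge0 // subr_ge0.
Qed.

End UnitFunction.

End GammaLocality.

(** * Positive parts and their approximation by truncations *)

Section PositivePart.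
Context {R : realType} {d : measure_display} {X : borelMetricType R d}.
Context {m : {finite_measure set X -> \bar R}} (E : dirichlet_form m).

Local Notation L1 f := (m.-integrable setT (EFin \o f)).
Local Notation sqn := (@sqn R d X m).

Definition pos_part (u : X -> R) : X -> R := fun x => Num.max 0 (u x).

Lemma pos_part_ge0 u x : 0 <= pos_part u x.
Proof. by rewrite le_max lexx. Qed.

Lemma pos_part_split u : u = pos_part u - pos_part (- u).
Proof.
apply/funext => x; rewrite /pos_part !fctE.
have [u0|/ltW u0] := leP 0 (u x).
  by rewrite max_l ?subr0 // oppr_le0.
by rewrite max_r ?sub0r ?opprK // oppr_ge0.
Qed.

Lemma pos_part_L2 u : dom E u -> L2 (m := m) (pos_part u).
Proof.
move=> du; have [mu u2] := dom_L2' du.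
have mp : measurable_fun setT (pos_part u) by exact: measurable_maxr.
split => //; apply: integrable_ae_le u2; first exact: measurable_funX.
apply: nearW => x; rewrite ger0_norm ?sqr_ge0 // /pos_part.
by have [u0|u0] := leP 0 (u x); rewrite ?expr0n ?sqr_ge0.
Qed.

Lemma clip_pos_part_cvg u e : dom E u -> 0 < e -> exists N : nat, forall n, (N <= n)%N ->
  sqn (clip n%:R u - pos_part u) < e.
Proof.
move=> du e0; have [mu u2] := dom_L2' du; have [mp _] := pos_part_L2 du.
have h1 n : measurable_fun setT (fun x => (clip n%:R u - pos_part u) x ^+ 2).
  apply: measurable_funX; apply: measurable_funB => //.
  exact: dom_meas (dom_clip (ler0n _ n) du).
have h3 : \forall x \ae m,
    (clip n%:R u - pos_part u) x ^+ 2 @[n --> \oo] --> (cst 0 : X -> R) x.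
  apply: nearW => x; apply/cvgrPdist_lt => r r0.
  near=> n; rewrite !fctE /clip -/(pos_part u x) min_l ?subrr ?expr0n ?subrr ?normr0 //.
  by near: n; apply: nbhs_infty_ger.
have h4 : \forall x \ae m, forall n : nat,
    `|(clip n%:R u - pos_part u) x ^+ 2| <= u x ^+ 2.
  apply: nearW => x n; rewrite normrX -(real_normK (num_real (u x))).
  rewrite lerXn2r ?nnegrE // !fctE /clip -/(pos_part u x).
  have c1 : Num.min (pos_part u x) n%:R <= pos_part u x by rewrite ge_min lexx.
  have c0 : 0 <= Num.min (pos_part u x) n%:R by rewrite le_min pos_part_ge0 ler0n.
  have pu : pos_part u x <= `|u x| by rewrite /pos_part ge_max normr_ge0 ler_norm.
  by rewrite distrC (ger0_norm (x := _ - _)) ?subr_ge0 // lerBlDr (le_trans pu) // lerDl.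
have h2 : measurable_fun setT (cst 0 : X -> R) by exact: measurable_cst.
have [N HN] := Rintegral_dominated h1 h2 h3 u2 h4 e0.
exists N => n /HN; apply: le_lt_trans; rewrite le_eqVlt; apply/orP; left; apply/eqP.
by apply: eq_Rintegral => x _; rewrite subr0 ger0_norm ?sqr_ge0.
Unshelve. all: by end_near.
Qed.

Lemma dom_pos_part u : dom E u -> dom E (pos_part u).
Proof.
move=> du; suff [] : dom E (pos_part u) /\ E (pos_part u) (pos_part u) <= E u u by [].
apply: form_lsc; first exact: pos_part_L2.
move=> e e0; have [N /(_ N (leqnn N)) HN] := clip_pos_part_cvg du e0.
exists (clip N%:R u); split; [exact: dom_clip|exact: form_clip_le|exact: ltW].
Qed.

(** Let p be the positive part and c_n its truncation. Since E(c_n, p - c_n) >= 0, one has E(c_n,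
    c_n) <= E(p, p) - E(p - c_n, p - c_n). If the last energy always exceeded e, lower
    semicontinuity along c_n would give E(p, p) <= E(p, p) - e. *)
Lemma clip_form_cvg u e N0 : dom E u -> 0 < e -> exists2 n : nat, (N0 <= n)%N &
  E (pos_part u - clip n%:R u) (pos_part u - clip n%:R u) <= e.
Proof.
move=> du e0; apply: contrapT => H; have dp := dom_pos_part du.
suff [_] : dom E (pos_part u) /\ E (pos_part u) (pos_part u) <= E (pos_part u) (pos_part u) - e.
  lra.
apply: form_lsc; first exact: pos_part_L2.
move=> r r0; have [N HN] := clip_pos_part_cvg du r0.
set n := maxn N0 N; exists (clip n%:R u).
have dc : dom E (clip n%:R u) by exact: dom_clip.
split => //; last by apply: ltW; apply: HN; exact: leq_maxr.
have : e < E (pos_part u - clip n%:R u) (pos_part u - clip n%:R u).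
  by rewrite ltNge; apply/negP => H'; apply: H; exists n => //; exact: leq_maxl.
have : 0 <= E (clip n%:R u) (pos_part u - clip n%:R u).
  apply: (form_steep_ge0 (a := n%:R)) => //; first exact: domB.
  - by move=> x; rewrite clip_ge0 ?clip_le.
  - by move=> x; rewrite !fctE subr_ge0 /clip ge_min lexx.
  move=> x; rewrite !fctE subr_eq0 /clip -/(pos_part u x) => H1.
  rewrite min_r //; apply: contraNT H1; rewrite -ltNge => /ltW h.
  by rewrite min_l.
rewrite (dformBr dp dc dc) (dformBB dp dc) (form_sym dp dc); lra.
Qed.

End PositivePart.

Section GammaCalculus.
Context {R : realType} {d : measure_display} {X : borelMetricType R d}.
Context {m : {finite_measure set X -> \bar R}} (E : dirichlet_form m).
Variable Gamma : (X -> R) -> (X -> R) -> X -> R.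
Hypothesis E_reg : regular E.
Hypothesis E_loc : strongly_local E.
Hypothesis G_cdc : carre_du_champ E Gamma.

Local Notation L1 f := (m.-integrable setT (EFin \o f)).
Local Notation bd := (@bounded_dom R d X m E).

Lemma Gamma_scale a u : dom E u ->
  \forall x \ae m, Gamma (a *: u) (a *: u) x = a ^+ 2 * Gamma u u x.
Proof.
move=> du; have := GammaZl G_cdc a du (domZ a du); have := GammaZr G_cdc a du du.
by apply: filterS2 => x -> ->; ring.
Qed.

Lemma Gamma_zero_bd_ge0 k : bd k -> (forall x, 0 <= k x) ->
  \forall x \ae m, k x = 0 -> Gamma k k x = 0.
Proof.
move=> bk k0; have [dk [M0 kM0]] := bk.
pose M := Num.max M0 1; have M1 : 0 < M by rewrite lt_max ltr01 orbT.
have k01 x : 0 <= (M^-1 *: k) x <= 1.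
  rewrite !fctE /GRing.scale /= mulr_ge0 ?invr_ge0 ?(ltW M1) //=.
  rewrite mulrC ler_pdivrMr // mul1r (le_trans (ler_norm _)) //.
  by rewrite le_max kM0.
have := Gamma_unit_zero E_reg E_loc G_cdc (bdZ M^-1 bk) k01.
have := Gamma_scale M^-1 dk.
apply: filterS2 => x -> h kx; apply/eqP; move: h; rewrite !fctE kx scaler0.
move=> /(_ erefl)/eqP; rewrite mulf_eq0 expf_eq0 /= invr_eq0 gt_eqF //.
Qed.

(** With c a truncation of u close to it in energy, Gamma c c vanishes on {u = 0}, so there Gamma u
    u <= 2 Gamma (u - c) (u - c), whose integral is 4 E(u - c, u - c) <= e. *)
Lemma Gamma_zero_ge0 u : dom E u -> (forall x, 0 <= u x) ->
  \forall x \ae m, u x = 0 -> Gamma u u x = 0.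
Proof.
move=> du u0; have G0 := cdc_ge0 G_cdc du.
pose A := u @^-1` [set 0].
have mA : measurable A.
  by rewrite -[X in measurable X]setTI; exact: (dom_meas du).
have LI := integrableM_indic mA (Gamma_L1 G_cdc du du).
have I0 : \forall x \ae m, 0 <= \1_A x * Gamma u u x.
  by apply: filterS G0 => x h; rewrite mulr_ge0 // indicE.
suff : \int[m]_x (\1_A x * Gamma u u x) <= 0.
  move/(Rintegral_eq0_ae LI I0); apply: filterS => x h ux; move: h.
  by rewrite indicE mem_set // mul1r.
apply/ler_addgt0Pl => e e0; rewrite addr0.
have e4 : 0 < e / 4 by rewrite divr_gt0.
have pu : pos_part u = u by apply/funext => x; rewrite /pos_part max_r.
have [n _] := clip_form_cvg 0 du e4; rewrite pu; set c := clip n%:R u => Ec.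
have dc : dom E c by exact: dom_clip.
have bc : bd c by exact: bd_clip.
have dw := domB du dc; have Gw0 := cdc_ge0 G_cdc dw.
have c0 : \forall x \ae m, c x = 0 -> Gamma c c x = 0.
  by apply: Gamma_zero_bd_ge0 => // x; exact: clip_ge0.
have := form_gint E_loc G_cdc dw dw => Ew.
suff : \int[m]_x (\1_A x * Gamma u u x) <= 2 * \int[m]_x Gamma (u - c) (u - c) x by lra.
rewrite -RintegralZl //; last exact: (Gamma_L1 G_cdc dw dw).
apply: Rintegral_ae_le LI _ _; first by apply: integrableZ_R; exact: (Gamma_L1 G_cdc dw dw).
have := Gamma_add_le G_cdc dw dc; rewrite subrK.
apply: filterS3 Gw0 c0 => x w0 c0 le.
rewrite indicE; case: (boolP (x \in A)) => [/set_mem /= Ax|_].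
  by move: le; rewrite c0 ?mulr0 ?addr0 ?mul1r // /c clip_eq0 // Ax.
by rewrite mul0r mulr_ge0.
Qed.

Lemma Gamma_zero u : dom E u -> \forall x \ae m, u x = 0 -> Gamma u u x = 0.
Proof.
move=> du; have dp := dom_pos_part du; have dn := dom_pos_part (domN du).
have dnn := domN dn.
have := Gamma_zero_ge0 dp (pos_part_ge0 u).
have := Gamma_zero_ge0 dn (pos_part_ge0 (- u)).
have := Gamma_add_le G_cdc dp dnn; have := Gamma_scale (-1) dn.
rewrite -(pos_part_split u) scaleN1r => h1 h2 h3 h4.
apply: filterS3 (filterI h1 h2) (filterI h3 h4) (cdc_ge0 G_cdc du) => x [-> le] [h3' h4'] u0 ux.
apply/eqP; rewrite eq_le u0 andbT (le_trans le) //.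
by rewrite h3' ?h4' ?mulr0 ?addr0 // /pos_part ?fctE ux ?oppr0 maxxx.
Qed.

(** Locality on the measurable set {u = v}, with no interior required: this is what allows
    truncations and minima to be treated on each piece separately. *)
Lemma Gamma_eq u v e : dom E u -> dom E v -> dom E e ->
  \forall x \ae m, u x = v x -> Gamma u e x = Gamma v e x.
Proof.
move=> du dv de; have dw := domB du dv.
have := GammaBl G_cdc du dv de; have := Gamma_zero dw; have := Gamma_null G_cdc dw de.
apply: filterS3 => x h1 h2 h3 uv; apply/eqP; rewrite -subr_eq0 -h3 h1 // h2 //.
by rewrite !fctE uv subrr.
Qed.

Lemma Gamma_eq2 u v : dom E u -> dom E v ->
  \forall x \ae m, u x = v x -> Gamma u u x = Gamma v v x.
Proof.
move=> du dv; have := Gamma_eq du dv du; have := Gamma_eq du dv dv.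
have := Gamma_sym G_cdc du dv; apply: filterS3 => x h1 h2 h3 uv.
by rewrite h3 // -h1 h2.
Qed.

(** The constant c need not belong to the domain, so u - c is replaced by v = c k - k^2, which
    vanishes on {k = c}. The Leibniz rule gives Gamma v k = - c Gamma k k there, and c != 0. *)
Lemma Gamma_level u c : dom E u -> \forall x \ae m, u x = c -> Gamma u u x = 0.
Proof.
have [-> |c0] := eqVneq c 0; first exact: Gamma_zero.
have bdcase k : bd k -> \forall x \ae m, k x = c -> Gamma k k x = 0.
  move=> bk; have bkk := bd_mul bk bk; have dk := bk.1; have dck := domZ c dk.
  have bv := bdB (bdZ c bk) bkk; have dv := bv.1.
  have h1 := Gamma_zero dv; have h2 := GammaBl G_cdc dck bkk.1 dk.
  have h3 := GammaZl G_cdc c dk dk; have h4 := Gamma_leibniz E_reg E_loc G_cdc bk bk dk.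
  have h5 := Gamma_null G_cdc dv dk.
  apply: filterS3 (filterI h1 h2) (filterI h3 h4) h5 => x [h1' h2'] [h3' h4'] h5' kx.
  have : Gamma (c *: k - k * k) k x = 0.
    by apply/h5'/h1'; rewrite !fctE kx /GRing.scale /= subrr.
  rewrite h2' h3' h4' kx => h; apply/eqP; move: h.
  have -> : c * Gamma k k x - (c * Gamma k k x + c * Gamma k k x) = - (c * Gamma k k x) by ring.
  by move/eqP; rewrite oppr_eq0 mulf_eq0 (negPf c0).
(* Truncation at level |c| makes the function bounded without changing it on {u = c}. *)
move=> du; set a := `|c|.
have a0 : 0 <= a by exact: normr_ge0.
set k := clip a u - clip a (- u).
have bk : bd k by apply: bdB; apply: bd_clip => //; exact: domN.
have := Gamma_eq2 du bk.1; have := bdcase _ bk; apply: filterS2 => x h1 h2 ux.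
have kx : k x = c.
  rewrite /k /clip !fctE ux /a; have [c0'|c0'] := leP 0 c.
    by rewrite ger0_norm // minxx max_l ?oppr_le0 // min_l ?subr0.
  rewrite ltr0_norm // max_r ?oppr_ge0 ?(ltW c0') // minxx min_l ?sub0r ?opprK // oppr_ge0 ltW //.
by rewrite h2 ?h1 // ux kx.
Qed.

End GammaCalculus.

(** * The Caccioppoli inequality for a given cutoff function *)

Section PowerInequalities.
Context {R : realType}.
Implicit Types (p x y : R).

Lemma powR_young p x y : 1 < p -> 0 <= x -> 0 <= y ->
  x `^ (p - 1) * y <= (1 - p^-1) * x `^ p + p^-1 * y `^ p.
Proof.
move=> p1 x0 y0; have p0 : 0 < p by lra.
have q0 : 0 < p / (p - 1) by rewrite divr_gt0 // subr_gt0.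
have pq : (p / (p - 1))^-1 + p^-1 = 1 by field; rewrite subr_eq0 !gt_eqF.
have := @conjugate_powR R (x `^ (p - 1)) y (p / (p - 1)) p (powR_ge0 _ _) y0 q0 p0 pq.
rewrite -powRrM (_ : (p - 1) * (p / (p - 1)) = p); last by field; rewrite gt_eqF // subr_gt0.
move: pq; move: ((p / (p - 1))^-1) => a pq; have -> : a = 1 - p^-1 by lra.
lra.
Qed.

Lemma powR_split p x : 1 < p -> 0 <= x -> x `^ p = x `^ (p - 1) * x.
Proof.
have [->|xn0] := eqVneq x 0 => p1 x0.
  by rewrite mulr0 powR0 // gt_eqF // (lt_trans ltr01).
rewrite -[X in _ * X](powRr1 x0) -powRD; last by rewrite xn0 implybT.
by rewrite subrK.
Qed.

(** The tangent inequality for the convex function t^p at x, obtained from Young's inequality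
    without differentiating. *)
Lemma powR_sub_le p x y : 1 < p -> 0 <= x -> 0 <= y ->
  x `^ p - y `^ p <= p * x `^ (p - 1) * (x - y).
Proof.
move=> p1 x0 y0; have p0 : 0 < p by lra.
have := powR_young p1 x0 y0; rewrite -(ler_pM2l p0) => H.
have e1 : p * ((1 - p^-1) * x `^ p + p^-1 * y `^ p) = (p - 1) * x `^ p + y `^ p.
  by field; rewrite gt_eqF.
rewrite e1 in H; rewrite mulrBr -mulrA [p * _ * y](_ : _ = p * (x `^ (p - 1) * y)); last by ring.
rewrite -powR_split //; lra.
Qed.

End PowerInequalities.

(** * Staircases and truncations as piecewise affine functions *)

Lemma grid_piece (R : realType) (h t : R) n : (0 < n)%N -> 0 <= t <= n%:R * h ->
  exists2 i, (i < n)%N & i%:R * h <= t <= i.+1%:R * h.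
Proof.
elim: n => // n IH _ /andP[t0 tn].
have [nt|/ltW tn'] := leP (n%:R * h) t; first by exists n => //; rewrite nt.
have [n0|n0] := posnP n.
  by exists n => //; rewrite tn n0 mul0r t0.
by have [|i ni it] := IH n0; [rewrite t0|exists i => //; exact: ltnW].
Qed.

Section StaircaseValues.
Context {R : realType} {d : measure_display} {X : borelMetricType R d}.
Variables (c : nat -> R) (h : R) (u : X -> R).
Hypothesis h0 : 0 <= h.

Lemma staircase_below i x : i%:R * h <= u x -> staircase c h u i x = (\sum_(j < i) c j) * h.
Proof.
elim: i => [|i IH] iu; first by rewrite big_ord0 mul0r.
have ih0 : 0 <= i%:R * h by rewrite mulr_ge0.
have i'h0 : 0 <= i.+1%:R * h by rewrite mulr_ge0.
have iu' : i%:R * h <= u x by apply: le_trans iu; rewrite ler_wpM2r // ler_nat.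
rewrite /= !fctE (IH iu') (clip_eq_bound ih0 iu') (clip_eq_bound i'h0 iu) big_ord_recr /=.
by rewrite /GRing.scale /= -natr1; ring.
Qed.

Lemma staircase_piece n i x : (i < n)%N -> i%:R * h <= u x <= i.+1%:R * h ->
  staircase c h u n x = (\sum_(j < i) c j) * h + c i * (u x - i%:R * h).
Proof.
move=> + /andP[iu ui].
have ih0 : 0 <= i%:R * h by rewrite mulr_ge0.
have ux0 := le_trans ih0 iu.
elim: n => // n IH; rewrite ltnS leq_eqVlt => /predU1P[<-|ni].
  have ub : 0 <= u x <= i.+1%:R * h by rewrite ux0.
  by rewrite /= !fctE staircase_below // (clip_eq_bound ih0 iu) (clip_id ub).
have le k : (i < k)%N -> u x <= k%:R * h.
  by move=> ik; apply: le_trans ui _; rewrite ler_wpM2r // ler_nat.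
have u1 : 0 <= u x <= n%:R * h by rewrite ux0 le.
have u2 : 0 <= u x <= n.+1%:R * h by rewrite ux0 le // ltnW.
by rewrite /= !fctE IH // (clip_id u1) (clip_id u2) subrr scaler0 addr0.
Qed.

(** The slope on a cell is the derivative of t^p at its right end, the largest one on the cell;
    hence the staircase lies above t^p. *)
Lemma staircase_ge_powR p n x : 1 < p -> (0 < n)%N -> 0 <= u x <= n%:R * h ->
  (forall i, c i = p * (i.+1%:R * h) `^ (p - 1)) -> u x `^ p <= staircase c h u n x.
Proof.
move=> p1 n0 un cE; have [i ni iu] := grid_piece n0 un.
have p0 : 0 < p by rewrite (lt_trans ltr01).
rewrite (staircase_piece ni iu).
have sumle : (i%:R * h) `^ p <= (\sum_(j < i) c j) * h.
  elim: (i) => [|j IH]; first by rewrite big_ord0 !mul0r powR0 // gt_eqF.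
  rewrite big_ord_recr /= mulrDl cE.
  have jh : 0 <= j%:R * h by rewrite mulr_ge0.
  have j'h : 0 <= j.+1%:R * h by rewrite mulr_ge0.
  have := powR_sub_le p1 j'h jh.
  by rewrite -mulrBl -natrB // subSnn mul1r; lra.
have /andP[i1 i2] := iu; have /andP[u0 _] := un.
have ih : 0 <= i%:R * h by rewrite mulr_ge0.
have := powR_sub_le p1 u0 ih; rewrite cE.
have : p * u x `^ (p - 1) * (u x - i%:R * h) <=
    p * (i.+1%:R * h) `^ (p - 1) * (u x - i%:R * h).
  rewrite ler_wpM2r ?subr_ge0 // ler_wpM2l ?(ltW p0) // ge0_ler_powR ?nnegrE ?mulr_ge0 //.
  by rewrite subr_ge0 ltW.
lra.
Qed.

End StaircaseValues.

Section ClampCalculus.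
Context {R : realType} {d : measure_display} {X : borelMetricType R d}.
Context {m : {finite_measure set X -> \bar R}} (E : dirichlet_form m).
Variable Gamma : (X -> R) -> (X -> R) -> X -> R.
Hypothesis E_reg : regular E.
Hypothesis E_loc : strongly_local E.
Hypothesis G_cdc : carre_du_champ E Gamma.

Local Notation L1 f := (m.-integrable setT (EFin \o f)).
Local Notation bd := (@bounded_dom R d X m E).

(** The form of the chain rule used below: u - a v lies on a level set exactly where the affine
    relation holds, and its Gamma vanishes there. *)
Lemma Gamma_affine u v a c : dom E u -> dom E v ->
  \forall x \ae m, u x = a * v x + c -> Gamma u u x = a ^+ 2 * Gamma v v x.
Proof.
move=> du dv; have dav := domZ a dv; have dw := domB du dav.
have h1 := Gamma_level E_reg E_loc G_cdc c dw.
have h2 := Gamma_null G_cdc dw du; have h3 := Gamma_null G_cdc dw dav.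
have h4 := GammaBl G_cdc du dav du; have h5 := GammaBl G_cdc du dav dav.
have h6 := Gamma_sym G_cdc du dav; have h7 := Gamma_scale G_cdc a dv.
apply: filterS4 (filterI h1 h2) (filterI h3 h4) (filterI h5 h6) h7.
move=> x [h1' h2'] [h3' h4'] [h5' h6'] h7' ux.
have w0 : Gamma (u - a *: v) (u - a *: v) x = 0.
  by apply: h1'; rewrite !fctE ux /GRing.scale /=; ring.
have := h2' w0; have := h3' w0; rewrite h4' h5' h7' h6'; lra.
Qed.

Lemma Gamma_clip_le b u : 0 <= b -> dom E u ->
  \forall x \ae m, Gamma (clip b u) (clip b u) x <= Gamma u u x.
Proof.
move=> b0 du; have dc := dom_clip b0 du.
have h1 := Gamma_level E_reg E_loc G_cdc 0 dc.
have h2 := Gamma_level E_reg E_loc G_cdc b dc.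
have h3 := Gamma_eq2 E_reg E_loc G_cdc dc du.
apply: filterS4 h1 h2 h3 (cdc_ge0 G_cdc du) => x h1 h2 h3 u0.
have [ux|ux] := leP (u x) 0; first by rewrite h1 // clip_eq0.
have [bu|ub] := leP b (u x); first by rewrite h2 // clip_eq_bound.
by rewrite h3 // clip_id // (ltW ux) ltW.
Qed.

(** Written through [pos_part] so that it visibly belongs to the domain; [fminE] identifies it with
    the pointwise minimum. *)
Definition fmin (u v : X -> R) : X -> R := u - pos_part (u - v).

Lemma fminE u v x : fmin u v x = Num.min (u x) (v x).
Proof.
rewrite /fmin /pos_part !fctE; have [uv|uv] := leP (u x) (v x).
  by rewrite max_l ?subr0 // subr_le0.
by rewrite max_r ?subr_ge0 ?(ltW uv) //; ring.
Qed.

Lemma dom_fmin u v : dom E u -> dom E v -> dom E (fmin u v).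
Proof. by move=> du dv; apply: domB => //; apply: dom_pos_part; exact: domB. Qed.

Lemma Gamma_fmin_le u v C : dom E u -> dom E v ->
  \forall x \ae m, Gamma u u x <= C -> Gamma v v x <= C ->
    Gamma (fmin u v) (fmin u v) x <= C.
Proof.
move=> du dv; have dm := dom_fmin du dv.
have := Gamma_eq2 E_reg E_loc G_cdc dm du; have := Gamma_eq2 E_reg E_loc G_cdc dm dv.
apply: filterS2 => x h1 h2 uC vC; have := fminE u v x.
by case: (leP (u x) (v x)) => _ e; [rewrite h2|rewrite h1].
Qed.

Definition clamp k (u : X -> R) : X -> R := clip k u - clip k (- u).

Lemma clamp_id k u x : `|u x| <= k -> clamp k u x = u x.
Proof.
move=> uk; have k0 := le_trans (normr_ge0 _) uk; move: uk; rewrite ler_norml => /andP[h1 h2].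
rewrite /clamp !fctE; have [u0|/ltW u0] := leP 0 (u x).
  have nu : (- u) x <= 0 by rewrite oppr_le0.
  have ub : 0 <= u x <= k by rewrite u0.
  by rewrite (clip_id ub) (clip_eq0 k0 nu) subr0.
have ub : 0 <= (- u) x <= k by rewrite oppr_ge0 u0 lerNl.
by rewrite (clip_id ub) (clip_eq0 k0 u0) sub0r opprK.
Qed.

Lemma clamp_bound k u x : 0 <= k -> k <= u x -> clamp k u x = k.
Proof.
move=> k0 ku; have nu : (- u) x <= 0 by rewrite oppr_le0 (le_trans k0).
by rewrite /clamp !fctE (clip_eq_bound k0 ku) (clip_eq0 k0 nu) subr0.
Qed.

Lemma clamp_boundN k u x : 0 <= k -> u x <= - k -> clamp k u x = - k.
Proof.
move=> k0 ku; have nu : k <= (- u) x by rewrite lerNr.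
have u0 : u x <= 0 by rewrite (le_trans ku) // oppr_le0.
by rewrite /clamp !fctE (clip_eq_bound k0 nu) (clip_eq0 k0 u0) sub0r.
Qed.

Lemma clamp_le k u x : 0 <= k -> `|clamp k u x| <= k /\ `|clamp k u x| <= `|u x|.
Proof.
move=> k0; have [uk|uk] := leP `|u x| k; first by rewrite clamp_id.
suff ck : `|clamp k u x| = k by rewrite ck; split => //; exact: ltW.
have [u0|u0] := leP 0 (u x).
  by rewrite clamp_bound ?ger0_norm //; move: uk; rewrite ger0_norm // => /ltW.
rewrite clamp_boundN ?normrN ?ger0_norm //.
by move: uk; rewrite ltr0_norm // lerNr => /ltW.
Qed.

Lemma bd_clamp k u : 0 <= k -> dom E u -> bd (clamp k u).
Proof. by move=> k0 du; apply: bdB; apply: bd_clip => //; exact: domN. Qed.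

Lemma Gamma_clamp k u v : 0 <= k -> dom E u -> dom E v ->
  \forall x \ae m, Gamma v (clamp k u) x = (`|u x| < k)%R%:R * Gamma v u x.
Proof.
move=> k0 du dv; have dc := (bd_clamp k0 du).1.
have h1 := Gamma_level E_reg E_loc G_cdc k dc.
have h2 := Gamma_level E_reg E_loc G_cdc (- k) dc.
have h3 := Gamma_eq E_reg E_loc G_cdc dc du dv.
have h4 := Gamma_null G_cdc dc dv.
have h5 := Gamma_sym G_cdc dv dc; have h6 := Gamma_sym G_cdc dv du.
apply: filterS3 (filterI h1 h2) (filterI h3 h4) (filterI h5 h6).
move=> x [h1' h2'] [h3' h4'] [-> ->].
have [ku|uk] := leP k `|u x|; last by rewrite mul1r h3' // clamp_id // ltW.
rewrite mul0r h4' //; move: ku; rewrite ler_normr => /orP[ku|ku].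
  by rewrite h1' // clamp_bound.
by rewrite h2' // clamp_boundN // lerNr.
Qed.

Lemma Gamma_clamp_le k u : 0 <= k -> dom E u ->
  \forall x \ae m, Gamma (clamp k u) (clamp k u) x <= Gamma u u x.
Proof.
move=> k0 du; have dc := (bd_clamp k0 du).1.
have h1 := Gamma_clamp k0 du dc; have h2 := Gamma_clamp k0 du du.
have h3 := Gamma_sym G_cdc dc du.
apply: filterS4 h1 h2 h3 (cdc_ge0 G_cdc du) => x -> + -> u0 => ->.
by case: (_ < _); rewrite ?mul1r ?mul0r.
Qed.

Lemma Gamma_staircase c h n u : 0 <= h -> dom E u ->
  \forall x \ae m, forall i, (i < n)%N -> i%:R * h <= u x <= i.+1%:R * h ->
    Gamma (staircase c h u n) (staircase c h u n) x = c i ^+ 2 * Gamma u u x.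
Proof.
move=> h0 du; have ds := dom_staircase c h0 du n.
apply: ae_foralln => i.
have := Gamma_affine (c i) ((\sum_(j < i) c j) * h - c i * (i%:R * h)) ds du.
apply: filterS => x H ni iu; apply: H; rewrite (staircase_piece _ _ ni iu) //; ring.
Qed.

Lemma Gamma_mul_le a b : bd a -> bd b -> \forall x \ae m,
  Gamma (a * b) (a * b) x <= 2 * a x ^+ 2 * Gamma b b x + 2 * b x ^+ 2 * Gamma a a x.
Proof.
move=> ba bb; have bab := bd_mul ba bb.
have h1 := Gamma_leibniz E_reg E_loc G_cdc ba bb bab.1.
have h2 := Gamma_leibniz E_reg E_loc G_cdc ba bb bb.1.
have h3 := Gamma_leibniz E_reg E_loc G_cdc ba bb ba.1.
have h4 := Gamma_sym G_cdc bab.1 bb.1; have h5 := Gamma_sym G_cdc bab.1 ba.1.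
have h6 := Gamma_sym G_cdc ba.1 bb.1; have h7 := Gamma_CS G_cdc ba.1 bb.1.
have h8 := cdc_ge0 G_cdc ba.1; have h9 := cdc_ge0 G_cdc bb.1.
apply: filterS4 (filterI h1 h2) (filterI h3 (filterI h4 h5)) (filterI h6 h7) (filterI h8 h9).
move=> x [-> e2] [e3 [e4 e5]] [e6 e7] [a0 b0].
rewrite -e4 -e5 e2 e3 -e6.
move: e7; set A := Gamma a a x in a0 *; set B := Gamma b b x in b0 *; set C := Gamma a b x.
move=> CS.
have : 2 * (a x * b x * C) <= a x ^+ 2 * B + b x ^+ 2 * A.
  have sA := sqr_sqrtr a0; have sB := sqr_sqrtr b0.
  rewrite -[in leRHS]sA -[in leRHS]sB; move: CS.
  move: (Num.sqrt A) (Num.sqrt B) (sqrtr_ge0 A) (sqrtr_ge0 B) => y z y0 z0 CS.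
  have : a x * b x * C <= `|a x| * `|b x| * (y * z).
    by apply: le_trans (ler_norm _) _; rewrite !normrM ler_wpM2l.
  have := sqr_ge0 (`|a x| * z - `|b x| * y).
  rewrite -(real_normK (num_real (a x))) -(real_normK (num_real (b x))); nra.
lra.
Qed.

End ClampCalculus.

Section LpClass.
Context {R : realType} {d : measure_display} {T : measurableType d}.
Variable m : {finite_measure set T -> \bar R}.

Local Notation L1 f := (m.-integrable setT (EFin \o f)).

Lemma Lfun_powP (p : R) (f : T -> R) : 1 <= p -> f \in Lfun m p%:E <->
  measurable_fun setT f /\ L1 (fun x => `|f x| `^ p).
Proof.
move=> p1; split=> [fp|[mf ifp]].
  split; first by move: fp; rewrite inE => /andP[]; rewrite inE.
  exact: Lfun_integrable.
rewrite inE; apply/andP; split; rewrite inE //=.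
rewrite /finite_norm unlock poweR_lty //=.
by move/integrableP : ifp => [_]; under eq_integral => x _ do rewrite /= ger0_norm ?powR_ge0 //.
Qed.

Lemma measurable_powR_comp (p : R) (f : T -> R) : measurable_fun setT f ->
  measurable_fun setT (fun x => f x `^ p).
Proof. by move=> mf; exact: (measurableT_comp (measurable_powR _)). Qed.

Lemma Lfun_ae_le (p : R) (f g : T -> R) : 1 <= p -> measurable_fun setT f ->
  (\forall x \ae m, `|f x| <= `|g x|) -> g \in Lfun m p%:E -> f \in Lfun m p%:E.
Proof.
move=> p1 mf fg /(Lfun_powP _ p1)[mg ig]; apply/Lfun_powP => //; split => //.
apply: (integrable_ae_le _ _ ig).
  by apply: measurable_powR_comp; exact: measurableT_comp.
apply: filterS fg => x fgx; rewrite ger0_norm ?powR_ge0 //.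
by apply: ge0_ler_powR; rewrite ?nnegrE // (le_trans ler01).
Qed.

Lemma LfunD_R (p : R) (f g : T -> R) : 1 <= p -> f \in Lfun m p%:E -> g \in Lfun m p%:E ->
  (fun x => f x + g x) \in Lfun m p%:E.
Proof.
move=> p1 fp gp; have p1' : (1 <= p%:E)%E by rewrite lee_fin.
by have [_ +] := Lfun_addr_closed m p1' => /(_ _ _ fp gp).
Qed.

Lemma LfunZ_R (p k : R) (f : T -> R) : 1 <= p -> f \in Lfun m p%:E ->
  (fun x => k * f x) \in Lfun m p%:E.
Proof.
move=> p1 fp; rewrite (_ : (fun x => k * f x) = (k \o* f)%R); first exact: Lfun_scale.
by apply/funext => x /=; rewrite mulrC.
Qed.

Lemma integrable_young (p : R) (f g : T -> R) : 1 < p ->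
  f \in Lfun m p%:E -> g \in Lfun m p%:E ->
  L1 (fun x => `|f x| `^ (p - 1) * `|g x|).
Proof.
move=> p1 /(Lfun_powP _ (ltW p1))[mf fp] /(Lfun_powP _ (ltW p1))[mg gp].
have h : L1 (fun x => (1 - p^-1) * `|f x| `^ p + p^-1 * `|g x| `^ p).
  by apply: integrableD_R; exact: integrableZ_R.
apply: (integrable_ae_le _ _ h).
  apply: measurable_funM; last exact: measurableT_comp.
  by apply: measurable_powR_comp; exact: measurableT_comp.
by apply: nearW => x; rewrite ger0_norm ?mulr_ge0 ?powR_ge0 //; exact: powR_young.
Qed.

End LpClass.

Section Caccioppoli.
Context {R : realType} {d : measure_display} {X : borelMetricType R d}.
Context {m : {finite_measure set X -> \bar R}} (E : dirichlet_form m).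
Variable Gamma : (X -> R) -> (X -> R) -> X -> R.
Hypothesis E_reg : regular E.
Hypothesis E_loc : strongly_local E.
Hypothesis G_cdc : carre_du_champ E Gamma.

Local Notation L1 f := (m.-integrable setT (EFin \o f)).
Local Notation bd := (@bounded_dom R d X m E).

Variables (p L c : R) (w phi : X -> R) (F : set X).
Hypotheses (p2 : 2 < p) (L0 : 0 <= L) (w_p : dom_p E Gamma p w).
Hypotheses (bphi : bd phi) (phi01 : forall x, 0 <= phi x <= 1).
Hypothesis phiF : forall x, ~ F x -> phi x = 0.
Hypothesis phiL : \forall x \ae m, Gamma phi phi x <= L ^+ 2.
Hypothesis harm : forall v, dom_p E Gamma p v -> (forall x, ~ F x -> v x = 0) ->
  form_p m Gamma p w v = 0.

Let p1 : 1 < p. Proof. by apply: lt_trans p2; lra. Qed.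
Let p0 : 0 < p. Proof. by apply: lt_trans p1. Qed.
Let dw : dom E w. Proof. by case: w_p. Qed.
Let wp : w \in Lfun m p%:E. Proof. by case: w_p. Qed.
Let S x := Num.sqrt (Gamma w w x).
Let Sp : S \in Lfun m p%:E. Proof. by case: w_p. Qed.
Let S0 x : 0 <= S x. Proof. exact: sqrtr_ge0. Qed.

Let iSp : L1 (fun x => S x `^ p).
Proof.
have /(Lfun_powP _ _ (ltW p1))[_ h] := Sp.
by apply: eq_integrable h => // x _; rewrite /= ger0_norm.
Qed.

Let G0 : \forall x \ae m, 0 <= Gamma w w x. Proof. exact: cdc_ge0 G_cdc _ dw. Qed.

Let powS (q : R) x : 0 <= Gamma w w x -> Gamma w w x `^ (q / 2) = S x `^ q.
Proof. by move=> g0; rewrite /S -powR12_sqrt // -powRrM mulrC. Qed.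

Section Approximation.
Variable n : nat.
Hypothesis n0 : (0 < n)%N.
Let h : R := n%:R^-1.
Let slopes i := p * (i.+1%:R * h) `^ (p - 1).
(** Stands for phi^p. Being piecewise affine in phi, it has a computable Gamma: it lies above phi^p,
    and the square root of its Gamma is at most p (phi + h)^(p-1) L. *)
Let eta := staircase slopes h phi n.

Let hge0 : 0 <= h. Proof. by rewrite invr_ge0. Qed.
Let nh : n%:R * h = 1. Proof. by rewrite mulfV // pnatr_eq0 -lt0n. Qed.
Let phin x : 0 <= phi x <= n%:R * h. Proof. by rewrite nh. Qed.
Let hle1 : h <= 1. Proof. by rewrite invf_le1 ?ler1n // ltr0n. Qed.
Let deta : dom E eta. Proof. exact: dom_staircase bphi.1 _. Qed.

Let eta_ge x : phi x `^ p <= eta x.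
Proof. exact: staircase_ge_powR. Qed.

Let eta_ge0 x : 0 <= eta x.
Proof. by apply: le_trans (eta_ge x); exact: powR_ge0. Qed.

Let eta0 x : phi x = 0 -> eta x = 0.
Proof.
move=> px; have b : 0%:R * h <= phi x <= 1%:R * h by rewrite px mul0r lexx mul1r hge0.
by rewrite /eta (staircase_piece _ hge0 n0 b) px big_ord0 !mul0r subrr mulr0 addr0.
Qed.

Let slopes_ge0 i : 0 <= slopes i.
Proof. by rewrite mulr_ge0 ?powR_ge0 // ltW. Qed.

Let slopes_le i x : i%:R * h <= phi x <= i.+1%:R * h ->
  slopes i <= p * (phi x + h) `^ (p - 1).
Proof.
move=> /andP[ix xi]; have /andP[x0 x1] := phi01 x.
rewrite /slopes ler_wpM2l ?(ltW p0) // ge0_ler_powR ?subr_ge0 ?(ltW p1) ?nnegrE //.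
- by rewrite mulr_ge0.
- by rewrite addr_ge0.
by rewrite -natr1 mulrDl mul1r lerD2r.
Qed.

Let Cpow x : (phi x + h) `^ (p - 1) <= 2 `^ (p - 1).
Proof.
have /andP[x0 x1] := phi01 x.
apply: ge0_ler_powR; rewrite ?subr_ge0 ?nnegrE ?addr_ge0 // ?(ltW p1) //.
by have := lerD x1 hle1; rewrite -[1 + 1]/(2%:R).
Qed.

Let beta : bd eta.
Proof.
rewrite /eta; elim: (n) => [|k bk] /=.
  by split; [exact: dom0|exists 0 => x; rewrite normr0].
apply: bdD => //; apply: bdZ; apply: bdB; apply: bd_clip => //;
  by [rewrite mulr_ge0|exact: bphi.1].
Qed.

Let Gamma_eta : \forall x \ae m,
  Gamma eta eta x <= (p * (phi x + h) `^ (p - 1) * L) ^+ 2.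
Proof.
have := Gamma_staircase E_reg E_loc G_cdc slopes n hge0 bphi.1.
apply: filterS3 (cdc_ge0 G_cdc bphi.1) phiL => x g0 Gp Ge.
have [i ni ix] := grid_piece n0 (phin x).
rewrite (Ge i ni ix) [leRHS]exprMn ler_pM ?sqr_ge0 //.
by rewrite lerXn2r ?nnegrE ?slopes_ge0 ?slopes_le // mulr_ge0 ?powR_ge0 // ltW.
Qed.

Let omega x := p * (phi x + h) `^ (p - 1) * L.

Let omega_ge0 x : 0 <= omega x.
Proof. by rewrite !mulr_ge0 ?powR_ge0 // ltW. Qed.

Let omega_le x : omega x <= p * 2 `^ (p - 1) * L.
Proof. by rewrite ler_wpM2r // ler_wpM2l ?(ltW p0). Qed.

Let Gamma_w_eta : \forall x \ae m, `|Gamma w eta x| <= S x * omega x.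
Proof.
apply: filterS2 Gamma_eta (Gamma_CS G_cdc dw deta) => x ge cs.
apply: le_trans cs _; rewrite ler_wpM2l // -(ger0_norm (omega_ge0 x)) -sqrtr_sqr.
by rewrite ler_wsqrtr.
Qed.

(** This is eta (w - c) with w clamped, so that the product stays in the domain; c multiplies [eta]
    because constants need not lie there. *)
Let test k := eta * clamp k w - c *: eta.

Let bd_test k : 0 <= k -> bd (test k).
Proof. by move=> k0; apply: bdB; [apply: bd_mul => //; exact: bd_clamp|exact: bdZ]. Qed.

Let test_p k : 0 <= k -> dom_p E Gamma p (test k).
Proof.
move=> k0; have [dt [M tM]] := bd_test k0; have bc := bd_clamp k0 dw.
have [_ [N etaN]] := beta.
have [dc _] := bc; have dcut x := (clamp_le w x k0).1.
split => //; first by exact: (Lfun_bounded m p0 (dom_meas dt) tM).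
have mG : measurable_fun setT (fun x => Num.sqrt (Gamma (test k) (test k) x)).
  apply: (measurableT_comp (continuous_measurable_fun (@sqrt_continuous R))).
  exact: (Gamma_meas G_cdc dt dt).
(* W^2 bounds the Gamma of [eta], and N bounds [eta]. The Leibniz rule then bounds the Gamma of the
   test function by 4 N^2 S^2 + 4 k^2 W^2 + 2 c^2 W^2, whose square root is at most K S + K'. *)
pose W := p * 2 `^ (p - 1) * L.
pose K := Num.sqrt (4 * N ^+ 2).
pose K' := Num.sqrt (4 * k ^+ 2 * W ^+ 2 + 2 * (c ^+ 2 * W ^+ 2)).
apply: (@Lfun_ae_le _ _ _ _ _ _ (fun x => K * S x + K')) => //; first exact: ltW.
  have bm := bd_mul beta bc.
  have h2 := Gamma_mul_le E_reg E_loc G_cdc beta bc.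
  have h3 := Gamma_clamp_le E_reg E_loc G_cdc k0 dw.
  have h4 := Gamma_add_le G_cdc bm.1 (domN (domZ c deta)).
  have h5 := Gamma_scale G_cdc (- c) deta.
  have h7 := cdc_ge0 G_cdc bc.1; have h8 := cdc_ge0 G_cdc deta.
  apply: filterS4 (filterI h2 h3) (filterI h4 h5) (filterI h7 (filterI h8 Gamma_eta)) G0.
  move=> x [h2' h3'] [h4' h5'] [cl0 [et0 h6']] g0.
  rewrite -scaleNr h5' sqrrN in h4'.
  rewrite !ger0_norm ?addr_ge0 ?mulr_ge0 ?sqrtr_ge0 //.
  have K0 : 0 <= K * S x + K' by rewrite addr_ge0 ?mulr_ge0 ?sqrtr_ge0.
  rewrite -[leRHS](ger0_norm K0) -sqrtr_sqr ler_wsqrtr //.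
  rewrite /test -scaleNr; apply: (le_trans h4').
  have K2 : K ^+ 2 = 4 * N ^+ 2 by rewrite sqr_sqrtr // mulr_ge0 ?sqr_ge0.
  have K'2 : K' ^+ 2 = 4 * k ^+ 2 * W ^+ 2 + 2 * (c ^+ 2 * W ^+ 2).
    rewrite sqr_sqrtr //; have := sqr_ge0 W; have := sqr_ge0 k; have := sqr_ge0 c.
    move: (W ^+ 2) (k ^+ 2) (c ^+ 2) => a1 a2 a3 *.
    by apply: addr_ge0; do ?apply: mulr_ge0.
  have GS : S x ^+ 2 = Gamma w w x by rewrite sqr_sqrtr.
  have -> : (K * S x + K') ^+ 2 = K ^+ 2 * S x ^+ 2 + 2 * (K * S x * K') + K' ^+ 2 by ring.
  have KS : 0 <= K * S x * K' by rewrite !mulr_ge0 ?sqrtr_ge0.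
  rewrite K2 K'2 GS.
  have eN : eta x ^+ 2 <= N ^+ 2.
    by rewrite lerXn2r ?nnegrE //; [exact: le_trans (etaN x)|exact: le_trans (ler_norm _) (etaN x)].
  have cN : clamp k w x ^+ 2 <= k ^+ 2.
    by rewrite -(real_normK (num_real (clamp k w x))) lerXn2r ?nnegrE.
  have gW : Gamma eta eta x <= W ^+ 2.
    apply: le_trans h6' _; rewrite lerXn2r ?nnegrE ?omega_ge0 // ?omega_le //.
    exact: le_trans (omega_le x).
  have W0 : 0 <= W ^+ 2 by exact: sqr_ge0.
  have g1 : eta x ^+ 2 * Gamma (clamp k w) (clamp k w) x <= N ^+ 2 * Gamma w w x.
    by rewrite ler_pM ?sqr_ge0.
  have g2 : clamp k w x ^+ 2 * Gamma eta eta x <= k ^+ 2 * W ^+ 2.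
    by rewrite ler_pM ?sqr_ge0.
  have g3 : c ^+ 2 * Gamma eta eta x <= c ^+ 2 * W ^+ 2 by rewrite ler_wpM2l ?sqr_ge0.
  lra.
apply: LfunD_R; [exact: ltW|by apply: LfunZ_R => //; exact: ltW|exact: Lfun_cst].
Qed.

Let int_test k : 0 <= k ->
  \int[m]_x (Gamma w w x `^ ((p - 2) / 2) * Gamma w (test k) x) = 0.
Proof.
move=> k0; apply: harm (test_p k0) _ => x nF.
by rewrite /test !fctE (eta0 (phiF nF)) mul0r scaler0 subrr.
Qed.

Let S2 x : S x `^ (p - 1) = S x `^ (p - 2) * S x.
Proof.
have -> : p - 2 = p - 1 - 1 by ring.
by apply: powR_split => //; rewrite ltrBrDr.
Qed.

Let f x := Gamma w w x `^ ((p - 2) / 2) *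
  (eta x * Gamma w w x + (w x - c) * Gamma w eta x).

Let mGw : measurable_fun setT (fun x => Gamma w w x `^ ((p - 2) / 2)).
Proof. by apply: measurable_powR_comp; exact: (Gamma_meas G_cdc dw dw). Qed.

Let mf : measurable_fun setT f.
Proof.
apply: measurable_funM => //; apply: measurable_funD; apply: measurable_funM.
- exact: dom_meas deta.
- exact: (Gamma_meas G_cdc dw dw).
- by apply: measurable_funB => //; exact: dom_meas dw.
- exact: (Gamma_meas G_cdc dw deta).
Qed.

Let wc_p : (fun x => `|w x| + `|c|) \in Lfun m p%:E.
Proof.
apply: LfunD_R; [exact: ltW| |exact: Lfun_cst].
apply: (Lfun_ae_le _ _ _ wp); [exact: ltW| |].
  by apply: measurableT_comp => //; exact: dom_meas dw.
by apply: nearW => x; rewrite normr_id.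
Qed.

(** Removal of the clamp. The integrands for the test functions converge pointwise to [f], each has
    integral 0, and Young's inequality makes the common bound S^(p-1) (|w| + |c|) integrable. *)
Let int_f : L1 f /\ \int[m]_x f x = 0.
Proof.
have [_ [N etaN]] := beta.
pose W := p * 2 `^ (p - 1) * L.
have W0 : 0 <= W by rewrite !mulr_ge0 ?powR_ge0 // ltW.
pose g x := N * S x `^ p + W * (S x `^ (p - 1) * (`|w x| + `|c|)).
have L1g : L1 g.
  apply: integrableD_R; first exact: integrableZ_R.
  apply: integrableZ_R; have := integrable_young p1 Sp wc_p.
  apply: eq_integrable => // x _ /=; rewrite (ger0_norm (S0 x)).
  by rewrite (ger0_norm (addr_ge0 (normr_ge0 (w x)) (normr_ge0 c))).
pose f_ (k : nat) x := Gamma w w x `^ ((p - 2) / 2) * Gamma w (test k%:R) x.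
have f_E : \forall x \ae m, forall k : nat, f_ k x = Gamma w w x `^ ((p - 2) / 2) *
    (eta x * ((`|w x| < k%:R)%R%:R * Gamma w w x) + (clamp k%:R w x - c) * Gamma w eta x).
  apply: ae_foralln => k; have k0 : 0 <= k%:R :> R by [].
  have bc := bd_clamp k0 dw; have bm := bd_mul beta bc.
  have h1 := GammaBr G_cdc bm.1 (domZ c deta) dw.
  have h2 := GammaZr G_cdc c deta dw.
  have h3 := Gamma_sym G_cdc dw bm.1.
  have h4 := Gamma_leibniz E_reg E_loc G_cdc beta bc dw.
  have h5 := Gamma_sym G_cdc bc.1 dw; have h6 := Gamma_sym G_cdc deta dw.
  have h7 := Gamma_clamp E_reg E_loc G_cdc k0 dw dw.
  apply: filterS4 (filterI h1 h2) (filterI h3 h4) (filterI h5 h6) h7.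
  move=> x [h1' h2'] [h3' h4'] [h5' h6'] h7'.
  by rewrite /f_ h1' h2' h3' h4' h5' h6' h7'; ring.
(* Quantifying over the indicator b and over y with |y| <= |w| covers all clamped integrands and
   their limit at once. *)
have bound : \forall x \ae m, forall b : bool, forall y : R, `|y| <= `|w x| ->
    `|Gamma w w x `^ ((p - 2) / 2) * (eta x * (b%:R * Gamma w w x) + (y - c) * Gamma w eta x)|
    <= g x.
  apply: filterS2 G0 Gamma_w_eta => x g0 gwe b y yw.
  have SG : S x * S x = Gamma w w x by rewrite -expr2 sqr_sqrtr.
  have Spp : S x `^ p = S x `^ (p - 2) * (S x * S x).
    by rewrite (powR_split p1) // S2 mulrA.
  have P0 : 0 <= S x `^ (p - 2) by exact: powR_ge0.
  rewrite powS // normrM (ger0_norm P0) /g S2 Spp -SG.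
  have h1 : `|eta x * (b%:R * (S x * S x))| <= N * (S x * S x).
    rewrite normrM ler_pM //; case: b; rewrite ?mul1r ?mul0r ?normr0 ?mulr_ge0 //.
    by rewrite ger0_norm ?mulr_ge0.
  have h2 : `|(y - c) * Gamma w eta x| <= (`|w x| + `|c|) * (S x * W).
    rewrite normrM ler_pM //.
      by apply: le_trans (ler_normB _ _) _; rewrite lerD2r.
    by apply: le_trans gwe _; rewrite ler_wpM2l.
  have := ler_wpM2l P0 (le_trans (ler_normD _ _) (lerD h1 h2)).
  by move=> /le_trans; apply; rewrite mulrDr le_eqVlt; apply/orP; left; apply/eqP; ring.
have mf_ k : measurable_fun setT (f_ k).
  apply: measurable_funM => //; apply: (Gamma_meas G_cdc dw (bd_test _).1).
  exact: ler0n.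
have cv : \forall x \ae m, f_ k x @[k --> \oo] --> f x.
  apply: filterS f_E => x fE; apply/cvgrPdist_lt => e e0.
  near=> k; rewrite fE.
  have wk : `|w x| < k%:R by near: k; exact: nbhs_infty_gtr.
  by rewrite wk mul1r clamp_id ?ltW // subrr normr0.
have bdd : \forall x \ae m, forall k, `|f_ k x| <= g x.
  apply: filterS2 f_E bound => x fE bd_ k; rewrite fE; apply: bd_.
  exact: (clamp_le w x (ler0n _ _)).2.
have L1f : L1 f.
  apply: integrable_ae_le L1g => //; apply: filterS bound => x /(_ true (w x) (lexx _)).
  by rewrite mul1r.
split => //; apply/eqP; rewrite -normr_eq0 eq_le normr_ge0 andbT.
apply/ler_addgt0Pl => e e0; rewrite addr0.
have [K /(_ K (leqnn K)) HK] := Rintegral_dominated mf_ mf cv L1g bdd e0.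
have L1fK : L1 (f_ K) by exact: integrable_ae_le (mf_ K) (filterS (fun x H => H K) bdd) L1g.
have -> : \int[m]_x f x = - \int[m]_x (f_ K x - f x).
  by rewrite RintegralB // int_test ?sub0r ?opprK.
rewrite normrN; apply: le_trans (ltW HK).
apply: le_normr_Rintegral => //; exact: integrableB_R.
Unshelve. all: by end_near.
Qed.

(** The difference of the two integrands is at most [f] almost everywhere, by eta >= phi^p and
    Cauchy-Schwarz for Gamma w eta, and [f] has integral 0. *)
Lemma caccioppoli_step :
  \int[m]_x (phi x `^ p * S x `^ p) <=
  p * L * \int[m]_x ((phi x + h) `^ (p - 1) * (`|w x - c| * S x `^ (p - 1))).
Proof.
have [L1f if0] := int_f.
have mphi := dom_meas bphi.1.
have wcp : (fun x => w x - c) \in Lfun m p%:E.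
  apply: (@LfunD_R _ _ _ _ _ _ (cst (- c))) => //; [exact: ltW|exact: Lfun_cst].
have L1Z : L1 (fun x => `|w x - c| * S x `^ (p - 1)).
  have := integrable_young p1 Sp wcp.
  by apply: eq_integrable => // x _; rewrite /= mulrC (ger0_norm (S0 x)).
have L1pZ : L1 (fun x => (phi x + h) `^ (p - 1) * (`|w x - c| * S x `^ (p - 1))).
  apply: (integrableM_bounded (M := 2 `^ (p - 1))) L1Z.
    by apply: measurable_powR_comp; exact: measurable_funD.
  by move=> x; rewrite ger0_norm ?powR_ge0.
have L1pS : L1 (fun x => phi x `^ p * S x `^ p).
  apply: (integrableM_bounded (M := 1)) iSp; first exact: measurable_powR_comp.
  move=> x; rewrite ger0_norm ?powR_ge0 //; have /andP[x0 x1] := phi01 x.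
  have -> : 1 = 1 `^ p :> R by rewrite powR1.
  by rewrite ge0_ler_powR ?nnegrE ?ler01 // ltW.
rewrite -RintegralZl // -subr_le0 -RintegralB //; last exact: integrableZ_R.
rewrite -if0; apply: Rintegral_ae_le => //; first by apply: integrableB_R => //; exact: integrableZ_R.
apply: filterS2 G0 Gamma_w_eta => x g0 gwe; rewrite /f powS //.
have SG : S x * S x = Gamma w w x by rewrite -expr2 sqr_sqrtr.
have Spp : S x `^ p = S x `^ (p - 2) * (S x * S x).
  by rewrite (powR_split p1) // S2 mulrA.
have P0 : 0 <= S x `^ (p - 2) by exact: powR_ge0.
rewrite S2 Spp -SG.
have h1 : phi x `^ p * (S x * S x) <= eta x * (S x * S x) by rewrite ler_wpM2r ?mulr_ge0.
have h2 : - (`|w x - c| * (S x * omega x)) <= (w x - c) * Gamma w eta x.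
  rewrite lerNl; apply: le_trans (ler_norm _) _; rewrite normrN normrM.
  by rewrite ler_wpM2l.
have := ler_wpM2l P0 (lerD h1 h2); rewrite /omega.
apply: le_trans; rewrite le_eqVlt; apply/orP; left; apply/eqP; ring.
Qed.

End Approximation.

Let wcp : (fun x => w x - c) \in Lfun m p%:E.
Proof. by apply: (@LfunD_R _ _ _ _ _ _ (cst (- c))) => //; [exact: ltW|exact: Lfun_cst]. Qed.

Let L1Z : L1 (fun x => `|w x - c| * S x `^ (p - 1)).
Proof.
have := integrable_young p1 Sp wcp.
by apply: eq_integrable => // x _; rewrite /= mulrC (ger0_norm (S0 x)).
Qed.

Let mphi : measurable_fun setT phi. Proof. exact: dom_meas bphi.1. Qed.

Let phi_powR_le1 q x : 0 <= q -> `|phi x `^ q| <= 1.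
Proof.
move=> q0; rewrite ger0_norm ?powR_ge0 //; have /andP[x0 x1] := phi01 x.
have -> : 1 = 1 `^ q :> R by rewrite powR1.
by rewrite ge0_ler_powR ?nnegrE ?ler01.
Qed.

Let p10 : 0 <= p - 1. Proof. by rewrite subr_ge0 ltW. Qed.

Let L1pZ : L1 (fun x => phi x `^ (p - 1) * (`|w x - c| * S x `^ (p - 1))).
Proof.
apply: (integrableM_bounded (M := 1)) L1Z; first exact: measurable_powR_comp.
by move=> x; exact: phi_powR_le1.
Qed.

Let L1pS : L1 (fun x => phi x `^ p * S x `^ p).
Proof.
apply: (integrableM_bounded (M := 1)) iSp; first exact: measurable_powR_comp.
by move=> x; apply: phi_powR_le1; exact: ltW.
Qed.

(** The mesh h tends to 0. As p - 1 > 1, the tangent inequality for t^(p-1) on [0, 2] gives (phi +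
    h)^(p-1) <= phi^(p-1) + K h. *)
Lemma caccioppoli_limit :
  \int[m]_x (phi x `^ p * S x `^ p) <=
  p * L * \int[m]_x (phi x `^ (p - 1) * (`|w x - c| * S x `^ (p - 1))).
Proof.
apply/ler_addgt0Pl => e e0.
set Z := \int[m]_x (`|w x - c| * S x `^ (p - 1)).
have Z0 : 0 <= Z by apply: Rintegral_ge0 => x _; rewrite mulr_ge0 ?powR_ge0.
set K := (p - 1) * 2 `^ (p - 1 - 1).
have K0 : 0 <= K by rewrite mulr_ge0 ?powR_ge0.
set B := p * L * (K * Z).
have B0 : 0 <= B by rewrite !mulr_ge0 // ltW.
have B1 : 0 < B + 1 by rewrite ltr_wpDl.
have [N /(_ N (leqnn N)) HN] := natinv_lt (divr_gt0 e0 B1).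
apply: le_trans (caccioppoli_step (ltn0Sn N)) _.
set h : R := N.+1%:R^-1 in HN *.
have h0 : 0 <= h by rewrite invr_ge0.
have h1 : h <= 1 by rewrite invf_le1 ?ler1n // ltr0n.
have step : \int[m]_x ((phi x + h) `^ (p - 1) * (`|w x - c| * S x `^ (p - 1))) <=
    K * h * Z + \int[m]_x (phi x `^ (p - 1) * (`|w x - c| * S x `^ (p - 1))).
  rewrite -RintegralZl // -RintegralD //; last exact: integrableZ_R.
  apply: le_Rintegral => //.
  - apply: (integrableM_bounded (M := 2 `^ (p - 1))) L1Z.
      by apply: measurable_powR_comp; exact: measurable_funD.
    move=> x; rewrite ger0_norm ?powR_ge0 //; have /andP[x0 x1] := phi01 x.
    have y0 : 0 <= phi x + h by rewrite addr_ge0.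
    have y2 : phi x + h <= 2 by lra.
    by apply: ge0_ler_powR; rewrite ?nnegrE.
  - by apply: integrableD_R => //; exact: integrableZ_R.
  move=> x _; rewrite -mulrDl ler_wpM2r ?mulr_ge0 ?powR_ge0 //.
  have /andP[x0 x1] := phi01 x.
  have q1 : 1 < p - 1 by rewrite ltrBrDr.
  have y0 : 0 <= phi x + h by rewrite addr_ge0.
  have hE : phi x + h - phi x = h by ring.
  have := powR_sub_le q1 y0 x0; rewrite hE.
  have : (p - 1) * (phi x + h) `^ (p - 1 - 1) * h <= K * h.
    have y2 : phi x + h <= 2 by lra.
    have p20 : 0 <= p - 1 - 1 by rewrite subr_ge0 ltW.
    by rewrite ler_wpM2r // ler_wpM2l // ge0_ler_powR ?nnegrE.
  lra.
have pL : 0 <= p * L by rewrite mulr_ge0 // ltW.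
have Bhe : B * h <= e.
  have : h * (B + 1) <= e by rewrite -ler_pdivlMr // ltW.
  by apply: le_trans; rewrite mulrDr mulr1 mulrC lerDl.
apply: le_trans (ler_wpM2l pL step) _; rewrite mulrDr lerD2r.
apply: le_trans Bhe; rewrite /B le_eqVlt; apply/orP; left; apply/eqP; ring.
Qed.

(** Young's inequality is applied to (phi S)^(p-1) and p L |w - c|. It leaves (1 - 1/p) A on the
    right; subtracting it and dividing by 1/p gives the factor (p L)^p exactly. *)
Lemma caccioppoli_cutoff :
  \int[m]_x (phi x `^ p * S x `^ p) <=
  (p * L) `^ p * \int[m]_x ((phi x != 0)%:R * `|w x - c| `^ p).
Proof.
set A := \int[m]_x (phi x `^ p * S x `^ p).
have pL : 0 <= p * L by rewrite mulr_ge0 // ltW.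
have mI : measurable_fun setT (fun x => (phi x != 0)%:R : R).
  rewrite (_ : (fun x => _) = \1_(phi @^-1` [set~ 0])).
    apply: measurable_indic; rewrite -[X in measurable X]setTI; apply: mphi => //.
    exact: measurableC.
  apply/funext => x; rewrite indicE; congr ((nat_of_bool _)%:R).
  by apply/idP/idP => [/eqP kx|/set_mem kx]; [exact/mem_set|exact/eqP].
have L1I : L1 (fun x => (phi x != 0)%:R * `|w x - c| `^ p).
  have /(Lfun_powP _ _ (ltW p1))[_ h] := wcp.
  apply: (integrableM_bounded (M := 1)) h => // x.
  by case: (_ != _); rewrite ?normr1 ?normr0.
suff : A <= (1 - p^-1) * A +
    p^-1 * ((p * L) `^ p * \int[m]_x ((phi x != 0)%:R * `|w x - c| `^ p)).
  move=> h; have pV : 0 < p^-1 by rewrite invr_gt0.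
  by rewrite -(ler_pM2l pV); lra.
apply: le_trans caccioppoli_limit _.
rewrite -RintegralZl // -!RintegralZl //; last exact: integrableZ_R.
rewrite -RintegralD //; [|exact: integrableZ_R|by do 2 apply: integrableZ_R].
apply: le_Rintegral => //; first exact: integrableZ_R.
  by apply: integrableD_R; [exact: integrableZ_R|do 2 apply: integrableZ_R].
move=> x _; have /andP[x0 x1] := phi01 x.
have X0 : 0 <= phi x * S x by rewrite mulr_ge0.
have [px|px] := eqVneq (phi x) 0.
  by rewrite px !powR0 ?mul0r ?mulr0 ?addr0 // gt_eqF // subr_gt0.
have Y0 : 0 <= p * L * `|w x - c| by rewrite mulr_ge0.
have := powR_young p1 X0 Y0.
rewrite !powRM ?mulr_ge0 // ?(ltW p0) // mul1r.
rewrite (_ : _ * _ * (p * L * _) = p * L * (phi x `^ (p - 1) * (`|w x - c| * S x `^ (p - 1)))) //.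
by ring.
Qed.

End Caccioppoli.

(** * Cutoff functions for the intrinsic metric *)

Section Cutoff.
Context {R : realType} {d : measure_display} {X : borelMetricType R d}.
Context {m : {finite_measure set X -> \bar R}} (E : dirichlet_form m).
Variable Gamma : (X -> R) -> (X -> R) -> X -> R.
Hypothesis E_reg : regular E.
Hypothesis E_loc : strongly_local E.
Hypothesis G_cdc : carre_du_champ E Gamma.

Local Notation L1 f := (m.-integrable setT (EFin \o f)).
Local Notation bd := (@bounded_dom R d X m E).
Local Notation ball := (rho_ball E Gamma).

Lemma open_meas (A : set X) : open A -> measurable A.
Proof. by move=> oA; rewrite borel_measurableE; exact: sub_gen_smallest. Qed.

(** Regularity only provides a uniform approximation g of a Urysohn function. With error 1/4, the
    rescaled slice of g between 1/4 and 3/4 takes the values 1 and 0 exactly. *)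
Lemma regular_cutoff (A B : set X) : closed A -> open B -> A `<=` B ->
  compact (closure B) -> exists2 chi, bd chi &
    [/\ forall x, 0 <= chi x <= 1, forall x, A x -> chi x = 1
      & forall x, ~ B x -> chi x = 0].
Proof.
move=> cA oB AB cB.
have sep : uniform_separator (~` B) A.
  have nX : normal_space X by exact: (@pseudometric_normal R).
  apply: (proj1 (@normal_separatorP R X) nX) => //; first exact: open_closedC.
  by apply/seteqP; split => // x [nB /AB].
pose f : X -> R := Urysohn (~` B) A.
have f0 x : ~ B x -> f x = 0 by move=> nB; apply: (Urysohn_sub0 sep); exists x.
have f1 x : A x -> f x = 1 by move=> Ax; apply: (Urysohn_sub1 sep); exists x.
have Cf : Cc f.
  split; first exact: Urysohn_continuous.
  apply: subclosed_compact cB _; first exact: closed_closure.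
  apply: closure_subset => x /= fx; apply: contrapT => /f0 fx0.
  by move: fx; rewrite fx0 eqxx.
have e4 : (0 : R) < 4^-1 by rewrite invr_gt0.
have [g [dg _] fg] := E_reg.1 f Cf _ e4.
pose chi : X -> R := 2 *: (clip (3 / 4) g - clip (1 / 4) g).
have q1 : (0 : R) <= 1 / 4 by lra.
have q2 : (0 : R) <= 3 / 4 by lra.
have q3 : (1 / 4 : R) <= 3 / 4 by lra.
exists chi.
  by apply: bdZ; apply: bdB; exact: bd_clip.
split => x.
- have := clip_sub_bound g x q1 q3; rewrite /chi !fctE /GRing.scale /= => /andP[? ?].
  by apply/andP; split; lra.
- move=> /f1 fx; have := fg x; rewrite fx ler_norml => /andP[h1 h2].
  have h3 : 3 / 4 <= g x by lra.
  have h4 : 1 / 4 <= g x by lra.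
  rewrite /chi !fctE (clip_eq_bound q2 h3) (clip_eq_bound q1 h4) /GRing.scale /=.
  by field.
move=> /f0 fx; have := fg x; rewrite fx sub0r normrN ler_norml => /andP[h1 h2].
have h3 : g x <= 1 / 4 by lra.
rewrite /chi !fctE; have [->|ne] := eqVneq (clip (3 / 4) g x - clip (1 / 4) g x) 0.
  by rewrite scaler0.
by have := clip_sub_eq0 q1 q3 ne; rewrite ltNge h3.
Qed.

Definition admissible (u : X -> R) :=
  [/\ dom_loc E u, continuous u & energy_measure_le E Gamma u].

Lemma rho_gt (x y : X) (t : R) : (t%:E < rho E Gamma x y)%E ->
  exists2 u, admissible u & t < u x - u y.
Proof. by move=> /ereal_sup_gt[_ [u au <-]]; rewrite lte_fin; exists u. Qed.

Lemma rho_ge (x y : X) (t : R) u : admissible u -> (rho E Gamma x y < t%:E)%E ->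
  u x - u y < t.
Proof.
move=> au; rewrite -lte_fin; apply: le_lt_trans.
by apply: ereal_sup_ubound; exists u.
Qed.

Lemma open_drop (u : X -> R) x t : continuous u -> open [set y | t < u x - u y].
Proof.
move=> cu; rewrite (_ : [set y | _] = (fun y => u x - u y) @^-1` [set z | t < z]) //.
apply: open_comp; last exact: open_gt.
by move=> y _; apply: cvgB; [exact: cvg_cst|exact: cu].
Qed.

(** rho(x, y) is a supremum of continuous functions of y: at a point where it exceeds t, one of them
    exceeds t on a whole neighbourhood, which misses the ball of radius t. *)
Lemma closure_rho_ball (x : X) (t t' : R) : t < t' -> closure (ball x t) `<=` ball x t'.
Proof.
move=> tt' y cy; rewrite /rho_ball /= ltNge; apply/negP => ty.
have : (t%:E < rho E Gamma x y)%E by apply: lt_le_trans ty; rewrite lte_fin.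
move=> /rho_gt[u au uy].
have oU := open_drop x t (let: And3 _ c _ := au in c).
have [z [bz /= uz]] := cy _ (open_nbhs_nbhs (conj oU uy)).
by have := rho_ge au bz; rewrite ltNge (ltW uz).
Qed.

Hypothesis X_top : (open : set (set X)) = tau_rho E Gamma.

Lemma open_rho_ball x r : open (ball x r).
Proof.
rewrite X_top; apply: sub_gen_smallest.
by exists (x, r).
Qed.

Lemma energy_le_Gamma (w : X -> R) (G : set X) : open G -> dom E w ->
  (forall A, measurable A -> A `<=` G -> (energy_measure m Gamma w A <= m A)%E) ->
  \forall x \ae m, G x -> Gamma w w x <= 1.
Proof.
move=> oG dw H; have mG := Gamma_meas G_cdc dw dw.
pose A := G `&` [set x | 1 < Gamma w w x].
have mA : measurable A.
  apply: measurableI; first exact: open_meas.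
  rewrite (_ : [set x | _] = Gamma w w @^-1` `]1, +oo[); last first.
    by apply/seteqP; split=> x /=; rewrite in_itv /= andbT.
  by rewrite -[X in measurable X]setTI; exact: mG.
have L1G := Gamma_L1 G_cdc dw dw.
pose f x := \1_A x * (Gamma w w x - 1).
have L1G1 : L1 (fun x => Gamma w w x - 1).
  by apply: integrableB_R => //; exact: finite_measure_integrable_cst.
have L1f : L1 f by exact: integrableM_indic.
have f0 x : 0 <= f x.
  rewrite /f indicE; case: (boolP (x \in A)) => [/set_mem[_ /= xA]|_]; last by rewrite mul0r.
  by rewrite mul1r subr_ge0 ltW.
have I0 : \int[m]_x f x <= 0.
  have -> : \int[m]_x f x = \int[m]_(x in A) (Gamma w w x - 1).
    rewrite [RHS]Rintegral_mkcond; congr (Rintegral _ _ _); apply/funext => x.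
    by rewrite /f patchE indicE; case: (_ \in _); rewrite ?mul1r ?mul0r.
  have L1A : m.-integrable A (EFin \o Gamma w w) by exact: integrableS L1G.
  rewrite RintegralB //; last exact: finite_measure_integrable_cst.
  rewrite Rintegral_cst // mul1r subr_le0 fine_le //.
  - exact: integrable_fin_num.
  - by rewrite fin_num_measure.
  by apply: H => // x [].
have f0' : \forall x \ae m, 0 <= f x by apply: nearW.
have := Rintegral_eq0_ae L1f f0' I0.
apply: filterS => x fx Gx; rewrite leNgt; apply/negP => Gx1.
have xA : x \in A by apply/mem_set.
move: fx; rewrite /f indicE xA mul1r => /eqP; rewrite subr_eq0 => /eqP e1.
by move: Gx1; rewrite e1 ltxx.
Qed.

End Cutoff.

Section CutoffFunction.
Context {R : realType} {d : measure_display} {X : borelMetricType R d}.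
Context {m : {finite_measure set X -> \bar R}} (E : dirichlet_form m).
Variable Gamma : (X -> R) -> (X -> R) -> X -> R.
Hypothesis E_reg : regular E.
Hypothesis E_loc : strongly_local E.
Hypothesis G_cdc : carre_du_champ E Gamma.

Local Notation bd := (@bounded_dom R d X m E).
Local Notation ball := (rho_ball E Gamma).
Local Notation admissible := (admissible E Gamma).

Hypothesis X_top : (open : set (set X)) = tau_rho E Gamma.
Variables (x0 : X) (s : R).
Hypothesis ball_cpt : compact (closure (ball x0 s)).

Lemma rel_compact_ball : rel_compact_open (ball x0 s).
Proof. by split; [exact: open_rho_ball|rewrite precompactE]. Qed.

Lemma rho_ball_mono t t' : t <= t' -> ball x0 t `<=` ball x0 t'.
Proof. by move=> tt x; rewrite /rho_ball /= => /lt_le_trans; apply; rewrite lee_fin. Qed.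

Lemma bd_fmin u v (b : R) : bd u -> bd v -> (forall x, 0 <= u x <= b) ->
  (forall x, 0 <= v x <= b) -> bd (fmin u v) /\ forall x, 0 <= fmin u v x <= b.
Proof.
move=> [du _] [dv _] ub vb.
have H x : 0 <= fmin u v x <= b.
  by rewrite fminE; case: (leP (u x) (v x)).
split => //; split; first exact: dom_fmin.
by exists b => x; have /andP[h1 h2] := H x; rewrite ger0_norm.
Qed.

(** [u] is known in the domain only locally and u - a would need a constant: [w] replaces the first
    and a [chi] the second, both correctly on the ball of radius t2. *)
Lemma barrier (chi u : X -> R) (t2 a b : R) : t2 <= s -> 0 <= b ->
  bd chi -> (forall x, ball x0 t2 x -> chi x = 1) -> admissible u ->
  exists2 f, bd f & [/\ forall x, 0 <= f x <= b,
    \forall x \ae m, ball x0 t2 x -> Gamma f f x <= 1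
  & \forall x \ae m, ball x0 t2 x -> f x = clip b (fun y => u y - a) x].
Proof.
move=> t2s b0 [dchi _] chi1 [ul _ ue].
have [w dw uw] := ul _ rel_compact_ball.
have dwa : dom E (w - a *: chi) by apply: domB => //; exact: domZ.
exists (clip b (w - a *: chi)); first exact: bd_clip.
split.
- by move=> x; rewrite clip_ge0 //= clip_le.
- have h1 := energy_le_Gamma G_cdc (open_rho_ball X_top x0 s) dw (ue _ _ rel_compact_ball dw uw).
  have h2 := Gamma_clip_le E_reg E_loc G_cdc b0 dwa.
  have h3 := Gamma_affine E_reg E_loc G_cdc 1 (- a) dwa dw.
  apply: filterS3 h1 h2 h3 => x h1 h2 h3 bx; apply: (le_trans h2).
  rewrite h3; last by rewrite !fctE chi1 // /GRing.scale /= mulr1 mul1r.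
  by rewrite expr1n mul1r; apply: h1; exact: (rho_ball_mono t2s).
apply: filterS uw => x ux bx; rewrite /clip !fctE chi1 // /GRing.scale /= mulr1 ux //.
exact: (rho_ball_mono t2s).
Qed.

(** Minima preserve the bound on Gamma. One function that is low suffices to bring the minimum to 0,
    while all of them must be high for it to equal b. The empty minimum is b [chi], constant on the
    ball of radius t2. *)
Lemma barriers (chi : X -> R) (u : X -> X -> R) (a : X -> R) (t2 b : R) (l : seq X) :
  t2 <= s -> 0 <= b -> bd chi -> (forall x, 0 <= chi x <= 1) ->
  (forall x, ball x0 t2 x -> chi x = 1) ->
  (forall y, y \in l -> admissible (u y)) ->
  exists2 g, bd g & [/\ forall x, 0 <= g x <= b,
    \forall x \ae m, ball x0 t2 x -> Gamma g g x <= 1,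
    \forall x \ae m, ball x0 t2 x -> (forall y, y \in l -> b <= u y x - a y) -> g x = b
  & \forall x \ae m, ball x0 t2 x -> (exists2 y, y \in l & u y x <= a y) -> g x = 0].
Proof.
move=> t2s b0 bchi chi01 chi1; elim: l => [_|y l IH lu].
  exists (b *: chi); first exact: bdZ.
  split.
  - move=> x; have /andP[h1 h2] := chi01 x; rewrite fctE /GRing.scale /=.
    by rewrite mulr_ge0 //= -[leRHS]mulr1 ler_wpM2l.
  - have := Gamma_level E_reg E_loc G_cdc b (bdZ b bchi).1.
    by apply: filterS => x h bx; rewrite h // fctE chi1 // /GRing.scale /= mulr1.
  - by apply: nearW => x bx _; rewrite fctE chi1 // /GRing.scale /= mulr1.
  by apply: nearW => x bx [].
have [|g bg [g01 g1 gb g0]] := IH.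
  by move=> z zl; apply: lu; rewrite inE zl orbT.
have uy : admissible (u y) by apply: lu; rewrite mem_head.
have [f bf [f01 f1 fE]] := barrier (a y) t2s b0 bchi chi1 uy.
have [bfg fg01] := bd_fmin bf bg f01 g01.
exists (fmin f g) => //; split => //.
- have := Gamma_fmin_le E_reg E_loc G_cdc 1 bf.1 bg.1.
  by apply: filterS3 f1 g1 => x h1 h2 h3 bx; apply: h3; [exact: h1|exact: h2].
- apply: filterS2 gb fE => x h1 h2 bx H; rewrite fminE h1 //; last first.
    by move=> z zl; apply: H; rewrite inE zl orbT.
  by rewrite h2 // clip_eq_bound ?minxx //; apply: H; rewrite mem_head.
apply: filterS2 g0 fE => x h1 h2 bx [z]; rewrite inE => /predU1P[->|zl] zx.
  rewrite fminE h2 // clip_eq0 ?subr_le0 // min_l //.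
  by have /andP[] := g01 x.
rewrite fminE h1 //; last by exists z.
by rewrite min_r //; have /andP[] := f01 x.
Qed.

(** The minimum g of the barriers equals t - r on the ball of radius r and 0 on the shell between t1
    and t2, but nothing is known farther out. Multiplying by [chi'] kills that part; on the shell g
    already vanishes, so the gradient of [chi'] never contributes. *)
Lemma cutoff_function (r t : R) : r < t -> t < s ->
  exists phi F, [/\ bd phi, forall x, 0 <= phi x <= 1, closed F, F `<=` ball x0 s
   & [/\ forall x, ~ F x -> phi x = 0,
     \forall x \ae m, ball x0 r x -> phi x = 1
   & \forall x \ae m, Gamma phi phi x <= ((t - r)^-1) ^+ 2]].
Proof.
(* Off the ball of radius t1 one has rho >= t1 > t, so some admissible function drops by more than
   t. The radius t2 leaves room for the support of phi inside the ball of radius s. *)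
move=> rt ts; have [t1 tt1 t1s] : exists2 t1, t < t1 & t1 < s.
  by exists ((t + s) / 2); lra.
have [t2 t12 t2s] : exists2 t2, t1 < t2 & t2 < s by exists ((t1 + s) / 2); lra.
have b0 : 0 < t - r by rewrite subr_gt0.
have [b bE] : exists b, b = t - r by exists (t - r).
rewrite -bE in b0 *.
have cpt t' : t' < s -> compact (closure (ball x0 t')).
  move=> t's; apply: subclosed_compact ball_cpt _; first exact: closed_closure.
  by apply: closure_subset; exact: (rho_ball_mono (ltW t's)).
have [chi bchi [chi01 chi1 _]] := regular_cutoff E_reg (@closed_closure _ _)
  (open_rho_ball X_top x0 s) (@closure_rho_ball _ _ _ _ E Gamma x0 _ _ t2s) ball_cpt.
have [chi' bchi' [chi'01 chi'1 chi'0]] := regular_cutoff E_reg (@closed_closure _ _)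
  (open_rho_ball X_top x0 t2) (@closure_rho_ball _ _ _ _ E Gamma x0 _ _ t12) (cpt _ t2s).
pose K := closure (ball x0 t2) `\` ball x0 t1.
have cK : compact K.
  apply: subclosed_compact (cpt _ t2s) _; last exact: subDsetl.
  by apply: closedI; [exact: closed_closure|apply: open_closedC; exact: open_rho_ball].
have [u uP] : exists u : X -> X -> R, forall y, K y -> admissible (u y) /\ t < u y x0 - u y y.
  have H y : exists u : X -> R, K y -> admissible u /\ t < u x0 - u y.
    have [[_ yK]|] := pselect (K y); last by exists 0.
    have : (t%:E < rho E Gamma x0 y)%E.
      apply: (@lt_le_trans _ _ t1%:E); first by rewrite lte_fin.
      by rewrite leNgt; apply/negP.
    by move=> /rho_gt[u au ut]; exists u.
  by have [u uP] := choice H; exists u.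
move: cK; rewrite compact_cover => /(_ X K (fun y => [set z | t < u y x0 - u y z])).
case.
- by move=> y /uP[[_ cu _] _]; exact: open_drop.
- by move=> y Ky; exists y => //=; exact: (uP _ Ky).2.
move=> D DK KD.
have Dadm (y : X) : y \in finmap.enum_fset D -> admissible (u y).
  by move=> yD; have /DK/set_mem/uP[] := yD.
have chi1' x : ball x0 t2 x -> chi x = 1.
  by move=> bx; apply: chi1; exact: subset_closure.
(* With this offset, barrier y is t minus the drop of u y from x0: more than t - r where the drop is
   less than r, negative where it exceeds t. *)
have [g bg [g01 g1 gb g0]] := barriers (fun y => u y x0 - t) (ltW t2s) (ltW b0) bchi chi01 chi1' Dadm.
exists (b^-1 *: (g * chi')), (closure (ball x0 t2)).
have bgc := bd_mul bg bchi'.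
have bphi := bdZ b^-1 bgc.
have phi0 x : ~ ball x0 t2 x -> (b^-1 *: (g * chi')) x = 0.
  by move=> /chi'0 c0; rewrite !fctE c0 mulr0 scaler0.
(* On the ball of radius t2 either [chi'] is 1 or g is 0, so phi is there a multiple of g alone. *)
have phiE : \forall x \ae m, ball x0 t2 x -> (b^-1 *: (g * chi')) x = b^-1 * g x + 0.
  apply: filterS g0 => x h bx; have [b1|nb1] := pselect (ball x0 t1 x).
    by rewrite !fctE chi'1 ?mulr1 ?addr0 //; exact: subset_closure.
  have [y yD /= uy] := KD x (conj (subset_closure bx) nb1).
  by rewrite !fctE h ?mul0r ?mulr0 ?addr0 ?scaler0 //; exists y => //; lra.
split => //.
- move=> x; have /andP[h1 h2] := g01 x; have /andP[h3 h4] := chi'01 x.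
  rewrite !fctE /GRing.scale /=; have bi : 0 <= b^-1 by rewrite invr_ge0 ltW.
  apply/andP; split; first by apply: mulr_ge0 => //; apply: mulr_ge0.
  rewrite mulrC ler_pdivrMr // mul1r -[leRHS]mulr1; exact: ler_pM.
- exact: closed_closure.
- exact: closure_rho_ball.
split.
- by move=> x nx; apply: phi0 => bx; apply: nx; exact: subset_closure.
- apply: filterS2 phiE gb => x h1 h2 bx.
  have bx2 : ball x0 t2 x by apply: (rho_ball_mono _ bx); lra.
  rewrite h1 // h2 // ?addr0 ?mulVf ?gt_eqF // => y /Dadm au.
  by have := rho_ge au bx; lra.
have h1 := Gamma_zero E_reg E_loc G_cdc bphi.1.
have h2 := Gamma_affine E_reg E_loc G_cdc b^-1 0 bphi.1 bg.1.
apply: filterS4 g1 phiE h1 h2 => x g1 pE h1 h2.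
have [bx|nbx] := pselect (ball x0 t2 x); last by rewrite h1 ?phi0 ?sqr_ge0.
by rewrite h2 ?pE // -[leRHS]mulr1 ler_wpM2l ?sqr_ge0 ?g1.
Qed.

End CutoffFunction.

(** * The inequality on balls *)

Lemma Rintegral_indicator {d} {T : measurableType d} {R : realType}
    (m : {finite_measure set T -> \bar R}) (A : set T) (f : T -> R) :
  measurable A -> m.-integrable setT (EFin \o f) ->
  (\int[m]_x (\1_A x * f x))%:E = (\int[m]_(x in A) (f x)%:E)%E.
Proof.
move=> mA If; rewrite /Rintegral fineK; last first.
  by apply: integrable_fin_num => //; exact: integrableM_indic.
rewrite [RHS]integral_mkcond; apply: eq_integral => x _.
by rewrite patchE indicE; case: (_ \in _); rewrite ?mul1r ?mul0r.
Qed.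

(* g is not assumed measurable: the integral of a nonnegative function is the
   supremum of the integrals of the simple functions below it. *)
Lemma ge0_le_integral_ae {d} {T : measurableType d} {R : realType}
    (m : {measure set T -> \bar R}) (D : set T) (f g : T -> R) : measurable D ->
  measurable_fun setT f -> (forall x, 0 <= f x) -> (forall x, 0 <= g x) ->
  (\forall x \ae m, D x -> f x <= g x) ->
  (\int[m]_(x in D) (f x)%:E <= \int[m]_(x in D) (g x)%:E)%E.
Proof.
move=> mD mf f0 g0 [N [mN N0 HN]].
have f0E x : D x -> (0 <= (f x)%:E)%E by rewrite lee_fin.
have mfD : measurable_fun D (EFin \o f).
  by apply/measurable_EFinP; exact: measurable_funS mf.
rewrite (ge0_negligible_integral mN mD mfD f0E N0).
rewrite [leLHS]integral_mkcond [leRHS]integral_mkcond.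
rewrite !ge0_integralTE; last 2 first.
- by move=> x; apply: erestrict_ge0 => y _; rewrite lee_fin.
- by move=> x; apply: erestrict_ge0 => y _; rewrite lee_fin.
apply: le_ereal_sup => _ [h hf <-]; exists h => // x.
apply: le_trans (hf x) _; rewrite !patchE.
case: ifPn => [/set_mem[Dx nNx]|_]; last by case: ifPn; rewrite // lee_fin.
rewrite mem_set // lee_fin; apply: contrapT => nfg; apply: nNx; apply: HN => /=.
by move=> fg; apply: nfg; exact: fg.
Qed.

Section BallCaccioppoli.
Context {R : realType} {d : measure_display} {X : borelMetricType R d}.
Context {m : {finite_measure set X -> \bar R}} (E : dirichlet_form m).
Variable Gamma : (X -> R) -> (X -> R) -> X -> R.
Hypothesis E_reg : regular E.
Hypothesis E_loc : strongly_local E.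
Hypothesis G_cdc : carre_du_champ E Gamma.
Hypothesis X_top : (open : set (set X)) = tau_rho E Gamma.

Local Notation L1 f := (m.-integrable setT (EFin \o f)).
Local Notation ball := (rho_ball E Gamma).

Lemma p_harmonic_ext p (U F : set X) u v : open U -> p_harmonic E Gamma p U u ->
  closed F -> F `<=` U -> compact F -> dom_p E Gamma p v ->
  (forall x, ~ F x -> v x = 0) -> form_p m Gamma p (ext E Gamma p U u) v = 0.
Proof.
move=> oU [_ hU] cF FU kF dv vF; have sF := ae_support_sub (m := m) cF vF.
apply: (hU U v) => //; split => //; first exact: subset_trans sF FU.
by apply: subclosed_compact kF sF; exact: closed_ae_support.
Qed.

Variables (p : R) (U : set X) (x0 : X) (r s c : R) (u : X -> R).
Hypotheses (p2 : 2 < p) (U_open : open U) (rs : r < s).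
Hypothesis ball_sub : closure (ball x0 s) `<=` U.
Hypothesis ball_cpt : compact (closure (ball x0 s)).
Hypothesis u_harm : p_harmonic E Gamma p U u.

Let w := ext E Gamma p U u.
Let p1 : 1 < p. Proof. by apply: lt_trans p2; lra. Qed.
Let p0 : 0 < p. Proof. by apply: lt_trans p1. Qed.
Let w_ext : extension E Gamma p U u w. Proof. exact: xgetPex u_harm.1. Qed.
Let dw : dom E w. Proof. by case: w_ext.1. Qed.
Let S x := Num.sqrt (Gamma w w x).
Let Sp : S \in Lfun m p%:E. Proof. by case: w_ext.1. Qed.
Let iSp : L1 (fun x => S x `^ p).
Proof.
have /(Lfun_powP _ _ (ltW p1))[_ h] := Sp.
by apply: eq_integrable h => // x _; rewrite /= ger0_norm ?sqrtr_ge0.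
Qed.
Let iwc : L1 (fun x => `|w x - c| `^ p).
Proof.
have wp : w \in Lfun m p%:E by case: w_ext.1.
have /(Lfun_powP _ _ (ltW p1))[//] : (fun x => w x - c) \in Lfun m p%:E.
by apply: (@LfunD_R _ _ _ _ _ _ (cst (- c))) => //; [exact: ltW|exact: Lfun_cst].
Qed.
Let mball t : measurable (ball x0 t).
Proof. by apply: open_meas; exact: open_rho_ball. Qed.

Lemma caccioppoli_ball_lt t : r < t -> t < s ->
  \int[m]_x (\1_(ball x0 r) x * S x `^ p) <=
  (p * (t - r)^-1) `^ p * \int[m]_x (\1_(ball x0 s) x * `|w x - c| `^ p).
Proof.
move=> rt ts.
have [phi [F [bphi phi01 cF Fs [phiF phi1 phiG]]]] :=
  cutoff_function E_reg E_loc G_cdc X_top ball_cpt rt ts.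
have b0 : 0 <= (t - r)^-1 by rewrite invr_ge0 subr_ge0 ltW.
have Fcl : F `<=` closure (ball x0 s) by apply: subset_trans Fs _; exact: subset_closure.
have harm v : dom_p E Gamma p v -> (forall x, ~ F x -> v x = 0) -> form_p m Gamma p w v = 0.
  apply: p_harmonic_ext => //; first exact: subset_trans Fcl ball_sub.
  exact: subclosed_compact ball_cpt Fcl.
have := caccioppoli_cutoff E_reg E_loc G_cdc c p2 b0 w_ext.1 bphi phi01 phiF phiG harm.
have mphi := dom_meas bphi.1.
have mphip : measurable_fun setT (fun x => phi x `^ p).
  exact: measurable_powR_comp.
have phip1 x : `|phi x `^ p| <= 1.
  have /andP[h0 h1] := phi01 x.
  have -> : 1 = 1 `^ p :> R by rewrite powR1.
  rewrite ger0_norm ?powR_ge0 //; apply: ge0_ler_powR; rewrite ?nnegrE //; exact: ltW.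
move=> H; apply: le_trans (le_trans _ H) _.
  apply: Rintegral_ae_le.
  - exact: integrableM_indic.
  - exact: integrableM_bounded iSp.
  apply: filterS phi1 => x h; rewrite ler_wpM2r ?powR_ge0 // indicE.
  case: (boolP (x \in _)) => [/set_mem/h ->|_]; first by rewrite powR1.
  exact: powR_ge0.
rewrite ler_wpM2l ?powR_ge0 //; apply: Rintegral_ae_le.
- apply: (integrableM_bounded (M := 1)) iwc; last first.
    by move=> x; case: (_ != _); rewrite ?normr1 ?normr0.
  rewrite (_ : (fun x => _) = \1_(phi @^-1` [set~ 0])).
    apply: measurable_indic; rewrite -[X in measurable X]setTI; apply: mphi => //.
    exact: measurableC.
  apply/funext => x; rewrite indicE; congr ((nat_of_bool _)%:R).
  by apply/idP/idP => [/eqP kx|/set_mem kx]; [exact/mem_set|exact/eqP].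
- exact: integrableM_indic.
apply: nearW => x; rewrite ler_wpM2r ?powR_ge0 // indicE ler_nat.
have [//|px] := eqVneq (phi x) 0; rewrite mem_set //.
by apply: Fs; apply: contrapT => /phiF px0; rewrite px0 eqxx in px.
Qed.

(** After taking p-th roots the radius t enters only through the factor t - r, so t may tend to s
    without any change of the two integrals. *)
Lemma caccioppoli_ball :
  (\int[m]_x (\1_(ball x0 r) x * S x `^ p)) `^ p^-1 <=
  p / (s - r) * (\int[m]_x (\1_(ball x0 s) x * `|w x - c| `^ p)) `^ p^-1.
Proof.
have A0 : 0 <= \int[m]_x (\1_(ball x0 r) x * S x `^ p).
  by apply: Rintegral_ge0 => x _; rewrite mulr_ge0 ?powR_ge0.
have B0 : 0 <= \int[m]_x (\1_(ball x0 s) x * `|w x - c| `^ p).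
  by apply: Rintegral_ge0 => x _; rewrite mulr_ge0 ?powR_ge0.
move: caccioppoli_ball_lt A0 B0.
move: (\int[m]_x _) (\int[m]_x _) => B A AB A0 B0.
have {}AB t : r < t -> t < s -> (t - r) * A `^ p^-1 <= p * B `^ p^-1.
  move=> rt ts; have tr : 0 < t - r by rewrite subr_gt0.
  have pV : 0 <= p^-1 by rewrite invr_ge0 ltW.
  have tr0 : 0 <= p * (t - r)^-1 by apply: mulr_ge0; [exact: ltW|rewrite invr_ge0 ltW].
  have h := AB t rt ts.
  have : A `^ p^-1 <= ((p * (t - r)^-1) `^ p * B) `^ p^-1.
    apply: ge0_ler_powR; rewrite ?nnegrE // => //.
    by apply: mulr_ge0 => //; exact: powR_ge0.
  rewrite powRM ?powR_ge0 // -powRrM divff ?gt_eqF // powRr1 // => h'.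
  by rewrite -ler_pdivlMl // mulrA [_^-1 * p]mulrC.
have sr : 0 < s - r by rewrite subr_gt0.
rewrite mulrAC ler_pdivlMr // [leLHS]mulrC.
move: (p * B `^ p^-1) AB => {A0 B0 B}B AB; rewrite leNgt; apply/negP => BA.
have A1 : 0 <= A `^ p^-1 by exact: powR_ge0.
move: (A `^ p^-1) AB BA A1 => {}A AB BA A0.
have B0 : 0 <= B.
  have h := AB ((r + s) / 2); apply: le_trans (h _ _); [|lra|lra].
  by apply: mulr_ge0 => //; lra.
have A1 : 0 < A.
  rewrite lt_neqAle A0 andbT; apply/negP => /eqP A00.
  by move: BA; rewrite -A00 mulr0 ltNge B0.
have : B / A < s - r by rewrite ltr_pdivrMr.
have q0 : 0 <= B / A by rewrite divr_ge0.
have H t : r < t -> t < s -> t - r <= B / A by rewrite ler_pdivlMr //; exact: AB.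
move: (B / A) q0 H => q q0 H qs.
(* At this radius, t - r = (q + s - r) / 2, which is larger than q because q < s - r. *)
have := H ((q + r + s) / 2); lra.
Qed.

End BallCaccioppoli.

Theorem corollary5p3 (R : realType) (d : measure_display)
    (X : borelMetricType R d) (m : {finite_measure set X -> \bar R})
    (E : dirichlet_form m) (Gamma : (X -> R) -> (X -> R) -> X -> R) (p : R)
    (X_lc : locally_compact [set: X]) (X_sep : @separable R d X)
    (m_radon : radon m) (m_supp : full_support m)
    (E_reg : regular E) (E_loc : strongly_local E)
    (Gamma_cdc : carre_du_champ E Gamma) (p_gt2 : 2 < p)
    (X_conn : connected [set: X])
    (X_top : (open : set (set X)) = tau_rho E Gamma)
    (U : set X) (U_open : open U) (x0 : X) (Ux0 : U x0)
    (r s : R) (r_gt0 : 0 < r) (r_lt_s : r < s)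
    (ball_sub : closure (rho_ball E Gamma x0 s) `<=` U)
    (* harmonicity is tested with compactly supported functions only, and rho is
       not assumed complete: the closed ball has to be compactly included *)
    (ball_cpt : compact (closure (rho_ball E Gamma x0 s)))
    (u : X -> R) (u_dom : dom_p_restr E Gamma p U u)
    (u_harm : p_harmonic E Gamma p U u) (c : R) :
  ((\int[m]_(x in rho_ball E Gamma x0 r)
      (Gamma_restr E Gamma p U u x `^ (p / 2))%:E) `^ p^-1
   <= (p / (s - r))%:E *
      (\int[m]_(x in rho_ball E Gamma x0 s) (`|u x - c| `^ p)%:E) `^ p^-1)%E.
Proof.
have p1 : 1 < p by lra.
have pV : 0 <= p^-1 by rewrite invr_ge0; lra.
have [[dw wp Sp] uw] : extension E Gamma p U u (ext E Gamma p U u) := xgetPex _ u_dom.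
have H := caccioppoli_ball E_reg E_loc Gamma_cdc X_top c p_gt2 U_open r_lt_s ball_sub
  ball_cpt u_harm.
rewrite /Gamma_restr; set w := ext E Gamma p U u in dw wp Sp uw H *.
have mball t : measurable (rho_ball E Gamma x0 t).
  by apply: open_meas; exact: open_rho_ball.
have iwc : m.-integrable setT (EFin \o (fun x => `|w x - c| `^ p)).
  have /(Lfun_powP _ _ (ltW p1))[//] : (fun x => w x - c) \in Lfun m p%:E.
  by apply: (@LfunD_R _ _ _ _ _ _ (cst (- c))) => //; [exact: ltW|exact: Lfun_cst].
have iSp : m.-integrable setT (EFin \o (fun x => Num.sqrt (Gamma w w x) `^ p)).
  have /(Lfun_powP _ _ (ltW p1))[_ h] := Sp.
  by apply: eq_integrable h => // x _; rewrite /= ger0_norm ?sqrtr_ge0.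
move: H; move: (Rintegral_indicator (mball r) iSp) (Rintegral_indicator (mball s) iwc).
move: (\int[m]_x (\1_(rho_ball E Gamma x0 r) x * _)) => A AE.
move: (\int[m]_x (\1_(rho_ball E Gamma x0 s) x * _)) => B BE.
rewrite -lee_fin EFinM -(poweR_EFin A) -(poweR_EFin B) AE BE => {A AE B BE}.
have intge0 (A : set X) (f : X -> R) (q : R) :
    (\int[m]_(x in A) (f x `^ q)%:E)%E \in `[0%E, +oo%E].
  by rewrite in_itv /= leey andbT; apply: integral_ge0 => x _; rewrite lee_fin powR_ge0.
(* Two replacements remain: Gamma^(p/2) by S^p, equal only where Gamma w w >= 0, and w by u, equal
   only almost everywhere on U. As u need not be measurable, the integrals are compared by
   [ge0_le_integral_ae]. *)
move=> H; apply: le_trans (le_trans _ H) _.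
  apply: gt0_ler_poweR => //.
  apply: ge0_le_integral_ae => //.
  - exact: measurable_powR_comp (Gamma_meas Gamma_cdc dw dw).
  - by move=> x; exact: powR_ge0.
  apply: filterS (cdc_ge0 Gamma_cdc dw) => x g0 _.
  by rewrite -powR12_sqrt // -powRrM mulrC.
apply: lee_wpmul2l; first by rewrite lee_fin divr_ge0; lra.
apply: gt0_ler_poweR => //.
apply: ge0_le_integral_ae => //.
  apply: measurable_powR_comp; apply: measurableT_comp => //.
  by apply: measurable_funB => //; exact: dom_meas dw.
by apply: filterS uw => x ux sx; rewrite ux //; apply: ball_sub; exact: subset_closure.
Qed.
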